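(* Consider the problem $\min_{x\in\mathbb{R}^d} f(x)=\frac1n\sum_{i=1}^n f_i(x)$ and the algorithm PGTC described in the context. Assume: (i) each $f_i:\mathbb{R}^d\to\mathbb{R}$ is differentiable and $L_f$-smooth for some $L_f>0$, i.e. $\|\nabla f_i(x)-\nabla f_i(y)\|\le L_f\|x-y\|$ for all $x,y\in\mathbb{R}^d$; (ii) the minimum value $f^*$ of $f$ satisfies $f^*>-\infty$; (iii) the undirected graph $\mathcal G$ is connected and its weight matrix $W$ is doubly stochastic; (iv) for some $\varphi\in(0,1]$ and $r>0$ the stochastic compressor $C:\mathbb{R}^d\to\mathbb{R}^d$ satisfies $\mathbb{E}_C\big[\|C(x)/r-x\|^2\big]\le(1-\varphi)\|x\|^2$ for all $x\in\mathbb{R}^d$. Suppose $\alpha_x,\alpha_y\in(0,\frac1r)$, $\gamma=\zeta_\gamma\rho\varphi_1$ and $\eta=\zeta_\eta\gamma\rho^2/L_f$, where $0<\zeta_\gamma=\zeta_\eta\le\bar\zeta_1$ and $$\bar\zeta_1=\min\Big\{\tfrac{1}{8\bar\lambda_{W-I}\sqrt{r_0}},\ \tfrac{n}{2L_f(\frac{n}{2L_f^2}+930)},\ \tfrac{1}{\frac{2+18n}{L_f}+576},\ \tfrac{1}{\frac{2+72nr_0}{L_f}+576+1024r_0},\ \tfrac{1}{\frac{2}{L_f}+144r_0},\ \tfrac{1}{2\varphi_1+176}\Big\}.$$ Then for every integer $T\ge1$, $$\frac1T\sum_{k=0}^{T}\Big(\mathbb{E}\big[\|\nabla f(\bar x_k)\|^2\big]+\mathbb{E}\big[\|\mathbf{x}_k-\bar{\mathbf{x}}_k\|^2\big]\Big)\le\frac{\bar\kappa_1M_1}{T}+\frac4n\,\mathbb{E}\Big[\Big\|\sum_{t=0}^\infty\xi_{y,t}\Big\|^2\Big],$$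 where $\bar\kappa_1=\frac4\eta$ and $M_1=V_0+\sum_{k=0}^\infty b_1\bar q^{2k}\bar s_\xi^2$.
   Context: Network. $\mathcal G=(\mathcal V,\mathcal E)$, $\mathcal V=\{1,\dots,n\}$, is an undirected graph; $W=[w_{ij}]\in\mathbb{R}^{n\times n}$ is its symmetric weighted adjacency matrix: $w_{ij}>0$ if $(i,j)\in\mathcal E$, $w_{ij}=0$ otherwise, $w_{ii}=0$. $\bar\lambda_A$ denotes the spectral radius of a matrix $A$; $\bar\lambda_{W-I}$ is the spectral radius of $W-I_n$. Noise. $\mathrm{Lap}(\theta)$ has density $\frac1{2\theta}e^{-|x|/\theta}$; $\xi\sim\mathrm{Lap}_d(\theta)$ means that all $d$ components of $\xi$ are $\mathrm{Lap}(\theta)$. For $i\in\mathcal V$, $k\ge0$: $\xi_{x_i,k}\sim\mathrm{Lap}_d(s_{\xi_{x_i}}q_i^k)$ and $\xi_{y_i,k}\sim\mathrm{Lap}_d(s_{\xi_{y_i}}q_i^k)$ with $s_{\xi_{x_i}},s_{\xi_{y_i}}>0$, $0<q_i<1$. All noise components are mutually independent, and the internal randomness of the compressor is drawn afresh at each use, independently of everything else. $\mathbb{E}_C$ is expectation over the internal randomness of $C$. Algorithm PGTC, with positive parameters $\eta,\gamma,\alpha_x,\alpha_y$: choose $x_{i,0}\in\mathbb{R}^d$ arbitrarily, $x^c_{i,0}=y^c_{i,0}=\mathbf 0$, $y_{i,0}=\nabla f_i(x_{i,0})$. For $k\ge0$ and all $i\in\mathcal V$: $x^a_{i,k}=x_{i,k}+\xi_{x_i,k}$,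 $\ y^a_{i,k}=y_{i,k}+\xi_{y_i,k}$; $\hat x_{i,k}=x^c_{i,k}+C(x^a_{i,k}-x^c_{i,k})$, $\ \hat y_{i,k}=y^c_{i,k}+C(y^a_{i,k}-y^c_{i,k})$; $x^c_{i,k+1}=(1-\alpha_x)x^c_{i,k}+\alpha_x\hat x_{i,k}$, $\ y^c_{i,k+1}=(1-\alpha_y)y^c_{i,k}+\alpha_y\hat y_{i,k}$; $x_{i,k+1}=x^a_{i,k}+\gamma\sum_{j=1}^nw_{ij}(\hat x_{j,k}-\hat x_{i,k})-\eta y_{i,k}$; $y_{i,k+1}=y^a_{i,k}+\gamma\sum_{j=1}^nw_{ij}(\hat y_{j,k}-\hat y_{i,k})+\nabla f_i(x_{i,k+1})-\nabla f_i(x_{i,k})$. Stacked notation. $\mathbf x_k,\mathbf y_k,\xi_{x,k},\xi_{y,k}\in\mathbb{R}^{nd}$ stack the vectors $x_{i,k},y_{i,k},\xi_{x_i,k},\xi_{y_i,k}$ over $i$; $\bar x_k=\frac1n\sum_ix_{i,k}$, $\bar{\mathbf x}_k=\mathbf 1_n\otimes\bar x_k$, and similarly $\bar{\mathbf y}_k$. $\sigma_{x,k}$ and $\sigma_{y,k}$ stack $x^c_{i,k}-x^a_{i,k}$ and $y^c_{i,k}-y^a_{i,k}$. $\Theta_k=[\|\mathbf x_k-\bar{\mathbf x}_k\|^2,\|\mathbf y_k-\bar{\mathbf y}_k\|^2,\|\sigma_{x,k}\|^2,\|\sigma_{y,k}\|^2]^\top$. Constants. $r_0=2r^2(1-\varphi)+2(1-r)^2$;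 $\varphi_1=\min\{\alpha_xr\varphi,\alpha_yr\varphi\}$; $\rho=1-\bar\lambda_{W-\mathbf 1\mathbf 1^\top/n}$; $\hat\lambda=1-\gamma\rho$; $\bar q=\max_iq_i$; $\bar s_\xi=\max_i\{s_{\xi_{x_i}},s_{\xi_{y_i}}\}$; $\zeta_1=\frac{n}{2L_f}$, $\zeta_3=1$, $\zeta_2=\zeta_4=\zeta_\eta$; $\mathbf s=\big[\frac{\zeta_1L_f}{n},\frac{\zeta_2\rho^2}{nL_f},\frac{\zeta_3L_f}{n},\frac{\zeta_4\rho^2}{nL_f}\big]^\top$; $V_k=\mathbb{E}[f(\bar x_k)]-f^*+\mathbf s^\top\mathbb{E}[\Theta_k]$; $\vartheta_2=2nd\Big[\frac{9\hat\lambda^2}{\gamma\rho},\ \frac{36\hat\lambda^2L_f^2}{\gamma\rho}+\frac{9\hat\lambda^2}{\gamma\rho},\ \frac{16(\hat\lambda^2+1)}{\varphi_1},\ \frac{64\bar\lambda_{W-I}^2+16(\bar\lambda_{W-I}^2+1)}{\varphi_1}\Big]^\top$; $b_1=\mathbf s^\top\vartheta_2+(\frac1\eta+L_f)n$. A term with zero denominator in the minimum defining $\bar\zeta_1$ (which occurs when $r_0=0$) is read as $+\infty$. *)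

(* Defs.v *)
From mathcomp Require Import all_boot all_order all_algebra.
From mathcomp Require Import all_classical all_reals all_analysis.
From mathcomp Require Import complex.

Set Implicit Arguments.
Unset Strict Implicit.
Unset Printing Implicit Defensive.

Import Order.TTheory GRing.Theory Num.Theory.
Import numFieldNormedType.Exports.

Local Open Scope classical_set_scope.
Local Open Scope ring_scope.

(* The library norm on matrices is the sup norm; this is the Euclidean norm of
   a row vector, and of a stacked vector of R^(n d) stored as an n x d matrix. *)
Definition enorm (R : realType) (m n : nat) (A : 'M[R]_(m, n)) : R :=
  Num.sqrt (\sum_i \sum_j A i j ^+ 2).

Definition stack (R : realType) (n d : nat) (v : 'I_n -> 'rV[R]_d) :
  'M[R]_(n, d) := \matrix_(i, j) v i 0 j.

Definition mean (R : realType) (n d : nat) (v : 'I_n -> 'rV[R]_d) : 'rV[R]_d :=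
  n%:R^-1 *: \sum_i v i.

Definition gradient (R : realType) (d : nat) (f : 'rV[R]_d -> R) (x : 'rV[R]_d) :
  'rV[R]_d := \row_j 'D_(delta_mx 0 j) f x.

Definition smooth (R : realType) (d : nat) (L : R) (f : 'rV[R]_d -> R) : Prop :=
  (forall x, differentiable f x) /\
  (forall x y, enorm (gradient f x - gradient f y) <= L * enorm (x - y)).

Definition average (R : realType) (n d : nat) (f : 'I_n -> 'rV[R]_d -> R) :
  'rV[R]_d -> R := fun x => n%:R^-1 * \sum_i f i x.

(* Infimum in the extended reals; it need not be attained. *)
Definition optimal_value (R : realType) (d : nat) (f : 'rV[R]_d -> R) : \bar R :=
  ereal_inf (range (fun x => (f x)%:E)).

(* The eigenvalues of a real matrix are taken in the complex field R[i]. *)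
Definition spectral_radius (R : realType) (n : nat) (A : 'M[R]_n) : R :=
  sup [set t | exists2 z : R[i],
         eigenvalue (map_mx (real_complex R) A) z & t = ComplexField.Normc.normc z].

Definition weighted_adjacency (R : realType) (n : nat) (e : rel 'I_n)
  (W : 'M[R]_n) : Prop :=
  W^T = W /\ forall i j, (e i j -> 0 < W i j) /\ (~~ e i j -> W i j = 0).

Definition connected_graph (n : nat) (e : rel 'I_n) : Prop :=
  forall i j, connect e i j.

Definition doubly_stochastic (R : realType) (n : nat) (W : 'M[R]_n) : Prop :=
  [/\ forall i j, 0 <= W i j,
      forall i, \sum_j W i j = 1 &
      forall j, \sum_i W i j = 1].

Definition laplace_density (R : realType) (theta x : R) : R :=
  (2 * theta)^-1 * expR (- `|x| / theta).

Definition laplace_distributed (R : realType) (dO : measure_display)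
  (Omega : measurableType dO) (P : probability Omega R) (X : {RV P >-> R})
  (theta : R) : Prop :=
  forall A : set R, measurable A ->
    distribution P X A
    = (\int[lebesgue_measure]_(x in A) (laplace_density theta x)%:E)%E.

(* F i is the class of events observable from the i-th source. *)
Definition mutually_independent (R : realType) (dO : measure_display)
  (Omega : measurableType dO) (P : probability Omega R) (I : eqType)
  (F : I -> set_system Omega) : Prop :=
  forall (s : seq I) (A : I -> set Omega), uniq s ->
    (forall i, i \in s -> F i (A i)) ->
    P (\big[setI/setT]_(i <- s) A i) = (\prod_(i <- s) P (A i))%E.

Definition events_of (dO dS : measure_display) (Omega : measurableType dO)
  (S : measurableType dS) (X : Omega -> S) : set_system Omega :=
  preimage_set_system setT X measurable.

(* The index (k, i, j) stands for the j-th component of the noise of agent i at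
   iteration k, the index (k, i) for a use of the compressor by agent i. *)
Definition source (n d : nat) : Type :=
  ((nat * 'I_n * 'I_d + nat * 'I_n * 'I_d) + (nat * 'I_n + nat * 'I_n))%type.

Definition source_events (R : realType) (dO dS : measure_display)
  (Omega : measurableType dO) (S : measurableType dS) (n d : nat)
  (xi_x xi_y : nat -> 'I_n -> 'I_d -> Omega -> R)
  (u_x u_y : nat -> 'I_n -> Omega -> S) (a : source n d) : set_system Omega :=
  match a with
  | inl (inl (k, i, j)) => events_of (xi_x k i j)
  | inl (inr (k, i, j)) => events_of (xi_y k i j)
  | inr (inl (k, i)) => events_of (u_x k i)
  | inr (inr (k, i)) => events_of (u_y k i)
  end.

(* The compressor: C u x is the output on input x when the internal randomness
   is u; u has law Q.  Tuples carry the product sigma-algebra of R^d, which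
   row vectors lack in the library. *)
Definition measurable_compressor (R : realType) (dS : measure_display)
  (S : measurableType dS) (d : nat) (C : S -> 'rV[R]_d -> 'rV[R]_d) : Prop :=
  forall j, measurable_fun setT
    (fun p : S * d.-tuple R => C p.1 (\row_l tnth p.2 l) 0 j).

Definition contractive_compressor (R : realType) (dS : measure_display)
  (S : measurableType dS) (Q : probability S R) (d : nat)
  (C : S -> 'rV[R]_d -> 'rV[R]_d) (r phi : R) : Prop :=
  forall x, ('E_Q[(fun u => enorm (r^-1 *: C u x - x) ^+ 2)%R]
             <= ((1 - phi) * enorm x ^+ 2)%:E)%E.

(* One sample path: the four state components are x, y, x^c and y^c at a given
   iteration; the inputs of an iteration are the noise and compressor draws. *)
Record pgtc_state (R : realType) (n d : nat) := PgtcState {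
  st_x  : 'I_n -> 'rV[R]_d;
  st_y  : 'I_n -> 'rV[R]_d;
  st_xc : 'I_n -> 'rV[R]_d;
  st_yc : 'I_n -> 'rV[R]_d }.

Record pgtc_input (R : realType) (n d : nat) (S : Type) := PgtcInput {
  in_xi_x : 'I_n -> 'rV[R]_d;
  in_xi_y : 'I_n -> 'rV[R]_d;
  in_u_x  : 'I_n -> S;
  in_u_y  : 'I_n -> S }.

Definition pgtc_step (R : realType) (n d : nat) (S : Type)
  (f : 'I_n -> 'rV[R]_d -> R) (W : 'M[R]_n) (C : S -> 'rV[R]_d -> 'rV[R]_d)
  (eta gamma alpha_x alpha_y : R)
  (w : pgtc_input R n d S) (st : pgtc_state R n d) : pgtc_state R n d :=
  let xa i := st_x st i + in_xi_x w i in
  let ya i := st_y st i + in_xi_y w i in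
  let xh i := st_xc st i + C (in_u_x w i) (xa i - st_xc st i) in
  let yh i := st_yc st i + C (in_u_y w i) (ya i - st_yc st i) in
  let x' i := xa i + gamma *: (\sum_j W i j *: (xh j - xh i))
              - eta *: st_y st i in
  PgtcState
    x'
    (fun i => ya i + gamma *: (\sum_j W i j *: (yh j - yh i))
              + gradient (f i) (x' i) - gradient (f i) (st_x st i))
    (fun i => (1 - alpha_x) *: st_xc st i + alpha_x *: xh i)
    (fun i => (1 - alpha_y) *: st_yc st i + alpha_y *: yh i).

Fixpoint pgtc (R : realType) (n d : nat) (S : Type)
  (f : 'I_n -> 'rV[R]_d -> R) (W : 'M[R]_n) (C : S -> 'rV[R]_d -> 'rV[R]_d)
  (eta gamma alpha_x alpha_y : R) (x0 : 'I_n -> 'rV[R]_d)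
  (w : nat -> pgtc_input R n d S) (k : nat) : pgtc_state R n d :=
  if k is k'.+1 then
    pgtc_step f W C eta gamma alpha_x alpha_y (w k')
      (pgtc f W C eta gamma alpha_x alpha_y x0 w k')
  else PgtcState x0 (fun i => gradient (f i) (x0 i)) (fun=> 0) (fun=> 0).

Definition inputs_at (R : realType) (n d : nat) (Omega S : Type)
  (xi_x xi_y : nat -> 'I_n -> 'I_d -> Omega -> R)
  (u_x u_y : nat -> 'I_n -> Omega -> S) (omega : Omega) (k : nat) :
  pgtc_input R n d S :=
  PgtcInput (fun i => \row_j xi_x k i j omega) (fun i => \row_j xi_y k i j omega)
            (fun i => u_x k i omega) (fun i => u_y k i omega).

Definition col4 (R : realType) (a b c e : R) : 'cV[R]_4 :=
  \col_i [:: a; b; c; e]`_i.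

Definition consensus_error (R : realType) (n d : nat) (v : 'I_n -> 'rV[R]_d) : R :=
  enorm (stack v - stack (fun=> mean v)).

Definition Theta (R : realType) (n d : nat) (S : Type)
  (w : pgtc_input R n d S) (st : pgtc_state R n d) : 'cV[R]_4 :=
  let xa i := st_x st i + in_xi_x w i in
  let ya i := st_y st i + in_xi_y w i in
  col4 (consensus_error (st_x st) ^+ 2)
       (consensus_error (st_y st) ^+ 2)
       (enorm (stack (fun i => st_xc st i - xa i)) ^+ 2)
       (enorm (stack (fun i => st_yc st i - ya i)) ^+ 2).

Definition lyapunov (R : realType) (dO : measure_display)
  (Omega : measurableType dO) (P : probability Omega R) (n d : nat) (S : Type)
  (f : 'I_n -> 'rV[R]_d -> R) (s : 'cV[R]_4)
  (w : Omega -> nat -> pgtc_input R n d S)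
  (st : Omega -> nat -> pgtc_state R n d) (k : nat) : \bar R :=
  ('E_P[(fun omega => average f (mean (st_x (st omega k))))%R]
   - optimal_value (average f)
   + \sum_(i < 4) (s i 0)%:E *
       'E_P[(fun omega => Theta (w omega k) (st omega k) i 0)%R])%E.

Definition spectral_gap (R : realType) (n : nat) (W : 'M[R]_n) : R :=
  1 - spectral_radius (W - const_mx n%:R^-1).

Definition r0_const (R : realType) (r phi : R) : R :=
  2 * r ^+ 2 * (1 - phi) + 2 * (1 - r) ^+ 2.

Definition phi1_const (R : realType) (alpha_x alpha_y r phi : R) : R :=
  Num.min (alpha_x * r * phi) (alpha_y * r * phi).

(* Here and below, lambda stands for the spectral radius of W - I.
   In the extended reals 1 / 0 = +oo, the intended reading when r0 = 0. *)
Definition zeta_bar1 (R : realType) (n : nat) (L lambda r0 phi1 : R) : \bar R :=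
  (\big[mine/+oo]_(a <- [::
     1%:E / (8 * lambda * Num.sqrt r0)%:E;
     n%:R%:E / (2 * L * (n%:R / (2 * L ^+ 2) + 930))%:E;
     1%:E / ((2 + 18 * n%:R) / L + 576)%:E;
     1%:E / ((2 + 72 * n%:R * r0) / L + 576 + 1024 * r0)%:E;
     1%:E / (2 / L + 144 * r0)%:E;
     1%:E / (2 * phi1 + 176)%:E]) a)%E.

Definition s_const (R : realType) (n : nat) (L rho zeta_eta : R) : 'cV[R]_4 :=
  let zeta1 := n%:R / (2 * L) in
  let zeta2 := zeta_eta in
  let zeta3 := 1 in
  let zeta4 := zeta_eta in
  col4 (zeta1 * L / n%:R) (zeta2 * rho ^+ 2 / (n%:R * L))
       (zeta3 * L / n%:R) (zeta4 * rho ^+ 2 / (n%:R * L)).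

Definition vartheta2 (R : realType) (n d : nat) (L lambda rho gamma phi1 : R) :
  'cV[R]_4 :=
  let lhat := 1 - gamma * rho in
  (2 * n%:R * d%:R) *:
  col4 (9 * lhat ^+ 2 / (gamma * rho))
       (36 * lhat ^+ 2 * L ^+ 2 / (gamma * rho) + 9 * lhat ^+ 2 / (gamma * rho))
       (16 * (lhat ^+ 2 + 1) / phi1)
       ((64 * lambda ^+ 2 + 16 * (lambda ^+ 2 + 1)) / phi1).

Definition b1_const (R : realType) (n d : nat)
  (L lambda rho gamma eta phi1 zeta_eta : R) : R :=
  ((s_const n L rho zeta_eta)^T *m vartheta2 n d L lambda rho gamma phi1) 0 0
  + (eta^-1 + L) * n%:R.

Definition q_bar (R : realType) (n : nat) (q : 'I_n -> R) : R :=
  \big[Num.max/0]_(i < n) q i.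

Definition s_bar (R : realType) (n : nat) (s_x s_y : 'I_n -> R) : R :=
  \big[Num.max/0]_(i < n) Num.max (s_x i) (s_y i).

(* Main.v *)
From HB Require Import structures.
Require Import Defs.
From mathcomp Require Import all_boot all_order all_algebra.
From mathcomp Require Import all_classical all_reals all_analysis.
From mathcomp Require Import measurable_realfun complex ring lra.

Set Implicit Arguments.
Unset Strict Implicit.
Unset Printing Implicit Defensive.

Import Order.TTheory GRing.Theory Num.Theory.
Import numFieldNormedType.Exports.

Local Open Scope classical_set_scope.
Local Open Scope ring_scope.

(* A Lyapunov argument. On vectors of mean zero, W - 1 1^T / n contracts by
   1 - rho, so that by Young's inequality each consensus error is contracted by
   1 - gamma rho at every iteration; likewise the variance bound on C contracts
   each compression error by 1 - phi1 / 2. The couplings between the four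
   errors are of order gamma^2 and eta^2, and each iteration adds the variance
   of the injected noise. The mean of the y_i minus the mean of the
   grad f_i(x_i) is the mean of the accumulated noise sum_(t < k) xi_(y, t),
   hence the descent lemma along the mean of the x_i loses at most eta / n times
   the second moment of that sum; the noise xi_x enters the first-order term and
   disappears in expectation, being centered and independent of the past. With
   the given weights and step sizes, V_k then decreases by
   eta / 4 (|grad f|^2 + consensus error), up to the noise terms. When summing
   over k <= T, the accumulated noise is 0 at k = 0, and its second moment is
   nondecreasing in k since its increments are orthogonal: the total is at most
   T times the second moment of the series. *)

(** * Euclidean inequalities and mixing matrices *)

(** The hypothesis on [C] controls the mean error at a fixed input, whereas the inputs along the
    trajectory are random; likewise the first-order noise term vanishes only through independence.
    Both uses rest on one device: the quantity at hand is measurable for the sigma-algebra generated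
    by all sources other than a given one, hence independent of that source, which is then
    integrated out by Tonelli. Nothing being bounded, integrability comes first: square-integrable
    functions form a vector space stable under one iteration, because the bound on [C] also makes
    the compressed messages square integrable. The limit of the noise series has a default value
    where the series diverges, but only a lower bound on its second moment is required, and
    dominated convergence on an event of probability one provides it. As for the constants, once
    [gamma] and [eta] are expressed through [zeta], the coefficient of each error in the weighted
    sum of the recursions is a positive factor times terms that vanish with [zeta], minus [1] or
    [1/2]; the bounds on [zeta] make it nonpositive. *)

Section SquaredNorm.
Context {R : realFieldType}.

Definition sqn m n (A : 'M[R]_(m, n)) : R := \sum_i \sum_j A i j ^+ 2.

Definition dotm m n (A B : 'M[R]_(m, n)) : R := \sum_i \sum_j A i j * B i j.

Lemma sqn_ge0 m n (A : 'M[R]_(m, n)) : 0 <= sqn A.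
Proof. by apply: sumr_ge0 => i _; apply: sumr_ge0 => j _; exact: sqr_ge0. Qed.

Lemma sqn0 m n : sqn (0 : 'M[R]_(m, n)) = 0.
Proof.
by rewrite /sqn big1// => i _; rewrite big1// => j _; rewrite mxE expr0n.
Qed.

Lemma sqn_le0 m n (A : 'M[R]_(m, n)) : sqn A <= 0 -> A = 0.
Proof.
move=> A0; have /eqP : sqn A = 0 by apply/eqP; rewrite eq_le A0 sqn_ge0.
rewrite /sqn pair_big/= psumr_eq0 => [/allP A0'|[i j] _]; last exact: sqr_ge0.
apply/matrixP => i j; have := A0' (i, j) (mem_index_enum _).
by rewrite /= sqrf_eq0 mxE => /eqP.
Qed.

Lemma sqnZ m n (c : R) (A : 'M[R]_(m, n)) : sqn (c *: A) = c ^+ 2 * sqn A.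
Proof.
rewrite /sqn mulr_sumr; apply: eq_bigr => i _; rewrite mulr_sumr.
by apply: eq_bigr => j _; rewrite mxE exprMn.
Qed.

Lemma sqnN m n (A : 'M[R]_(m, n)) : sqn (- A) = sqn A.
Proof. by rewrite -scaleN1r sqnZ sqrrN expr1n mul1r. Qed.

Lemma sqnD m n (A B : 'M[R]_(m, n)) :
  sqn (A + B) = sqn A + 2 * dotm A B + sqn B.
Proof.
rewrite /sqn /dotm mulr_sumr -!big_split; apply: eq_bigr => i _ /=.
rewrite mulr_sumr -!big_split; apply: eq_bigr => j _ /=.
by rewrite mxE; ring.
Qed.

Lemma dotmDr m n (A B1 B2 : 'M[R]_(m, n)) :
  dotm A (B1 + B2) = dotm A B1 + dotm A B2.
Proof.
rewrite /dotm -big_split; apply: eq_bigr => i _ /=.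
by rewrite -big_split; apply: eq_bigr => j _ /=; rewrite mxE mulrDr.
Qed.

Lemma dotmZr m n c (A B : 'M[R]_(m, n)) : dotm A (c *: B) = c * dotm A B.
Proof.
rewrite /dotm mulr_sumr; apply: eq_bigr => i _ /=.
by rewrite mulr_sumr; apply: eq_bigr => j _ /=; rewrite mxE; ring.
Qed.

Lemma dotmBr m n (A B1 B2 : 'M[R]_(m, n)) :
  dotm A (B1 - B2) = dotm A B1 - dotm A B2.
Proof. by rewrite dotmDr -scaleN1r dotmZr mulN1r. Qed.

Lemma young_sqn m n (t : R) (A B : 'M[R]_(m, n)) : 0 < t ->
  sqn (A + B) <= (1 + t) * sqn A + (1 + t^-1) * sqn B.
Proof.
move=> t0; rewrite /sqn !mulr_sumr -big_split ler_sum// => i _ /=.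
rewrite !mulr_sumr -big_split ler_sum// => j _ /=; rewrite mxE.
rewrite -subr_ge0; set a := A i j; set b := B i j.
have -> : (1 + t) * a ^+ 2 + (1 + t^-1) * b ^+ 2 - (a + b) ^+ 2 =
  t^-1 * (t * a - b) ^+ 2 by field; exact: lt0r_neq0.
by rewrite mulr_ge0 ?sqr_ge0// invr_ge0 ltW.
Qed.

(* Young's inequality with the weights for which a [l]-contraction followed
   by a perturbation still contracts the square by [l]. *)
Lemma young_contraction m n (l s : R) (A B : 'M[R]_(m, n)) :
  0 < l -> l < 1 -> sqn A <= l ^+ 2 * s ->
  sqn (A + B) <= l * s + (1 - l)^-1 * sqn B.
Proof.
move=> l0 l1 As.
have l1' : 0 < 1 - l by rewrite subr_gt0.
have t0 : 0 < (1 - l) / l by rewrite divr_gt0.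
apply: (le_trans (young_sqn A B t0)).
have -> : 1 + ((1 - l) / l)^-1 = (1 - l)^-1.
  by field; rewrite !lt0r_neq0.
rewrite lerD2r.
have -> : 1 + (1 - l) / l = l^-1 by field; exact: lt0r_neq0.
by rewrite mulrC ler_pdivrMr//; apply: (le_trans As); have -> : l * s * l = l ^+ 2 * s by ring.
Qed.

Lemma sqnD2 m n (A B : 'M[R]_(m, n)) : sqn (A + B) <= 2 * sqn A + 2 * sqn B.
Proof. by have := @young_sqn _ _ 1 A B ltr01; rewrite invr1. Qed.

Lemma sqnD3 m n (A B C : 'M[R]_(m, n)) :
  sqn (A + B + C) <= 3 * (sqn A + sqn B + sqn C).
Proof.
rewrite /sqn -!big_split mulr_sumr ler_sum// => i _ /=.
rewrite -!big_split mulr_sumr ler_sum// => j _ /=; rewrite !mxE.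
move: (A i j) (B i j) (C i j) => a b c.
have := sqr_ge0 (a - b); have := sqr_ge0 (a - c); have := sqr_ge0 (b - c).
by lra.
Qed.

Lemma sqnD4 m n (A B C D : 'M[R]_(m, n)) :
  sqn (A + B + C + D) <= 4 * (sqn A + sqn B + sqn C + sqn D).
Proof.
rewrite /sqn -!big_split mulr_sumr ler_sum// => i _ /=.
rewrite -!big_split mulr_sumr ler_sum// => j _ /=; rewrite !mxE.
move: (A i j) (B i j) (C i j) (D i j) => a b c d.
have := sqr_ge0 (a - b); have := sqr_ge0 (a - c); have := sqr_ge0 (a - d).
have := sqr_ge0 (b - c); have := sqr_ge0 (b - d); have := sqr_ge0 (c - d).
by lra.
Qed.

Lemma sqnD5 m n (A B C D E : 'M[R]_(m, n)) :
  sqn (A + B + C + D + E) <= 5 * (sqn A + sqn B + sqn C + sqn D + sqn E).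
Proof.
rewrite /sqn -!big_split mulr_sumr ler_sum// => i _ /=.
rewrite -!big_split mulr_sumr ler_sum// => j _ /=; rewrite !mxE.
move: (A i j) (B i j) (C i j) (D i j) (E i j) => a b c d e.
have := sqr_ge0 (a - b); have := sqr_ge0 (a - c); have := sqr_ge0 (a - d).
have := sqr_ge0 (b - c); have := sqr_ge0 (b - d); have := sqr_ge0 (c - d).
have := sqr_ge0 (a - e); have := sqr_ge0 (b - e); have := sqr_ge0 (c - e).
have := sqr_ge0 (d - e); by lra.
Qed.

Lemma sqn_convex m n (t : R) (A B : 'M[R]_(m, n)) : 0 <= t <= 1 ->
  sqn (t *: A + (1 - t) *: B) <= t * sqn A + (1 - t) * sqn B.
Proof.
move=> /andP[t0 t1]; rewrite /sqn !mulr_sumr -big_split ler_sum// => i _ /=.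
rewrite !mulr_sumr -big_split ler_sum// => j _ /=; rewrite !mxE.
rewrite -subr_ge0; set a := A i j; set b := B i j.
have -> : t * a ^+ 2 + (1 - t) * b ^+ 2 - (t * a + (1 - t) * b) ^+ 2 =
  t * (1 - t) * (a - b) ^+ 2 by ring.
rewrite mulr_ge0 ?sqr_ge0//; apply: mulr_ge0 => //; lra.
Qed.

(* Minkowski's inequality for two matrices, without square roots. *)
Lemma sqn_triangle m n (s t u : R) (A B : 'M[R]_(m, n)) :
  0 <= s -> 0 <= t -> sqn A <= s ^+ 2 * u -> sqn B <= t ^+ 2 * u ->
  sqn (A + B) <= (s + t) ^+ 2 * u.
Proof.
rewrite le_eqVlt => /predU1P[<-|s0].
  by rewrite expr0n mul0r add0r => _ /sqn_le0 ->; rewrite add0r.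
rewrite le_eqVlt => /predU1P[<-|t0].
  by rewrite expr0n mul0r addr0 => As /sqn_le0 ->; rewrite addr0.
move=> As Bt; apply: (le_trans (@young_sqn _ _ (t / s) A B _)).
  by rewrite divr_gt0.
have -> : (s + t) ^+ 2 * u =
   (1 + t / s) * (s ^+ 2 * u) + (1 + (t / s)^-1) * (t ^+ 2 * u).
  by field; rewrite !lt0r_neq0.
by apply: lerD; rewrite ler_pM2l// addr_gt0// ?invr_gt0 divr_gt0.
Qed.

End SquaredNorm.

(** * Operator norm of a real symmetric matrix *)

Section SpectralRadius.
Context {R : realType}.

Local Notation toC := (real_complex R).
Local Notation nC := (@ComplexField.Normc.normc R).

Let normc_ge0 z : 0 <= nC z. Proof. by case: z => a b; exact: sqrtr_ge0. Qed.

Definition sqnC m n (B : 'M[R[i]]_(m, n)) : R := \sum_i \sum_j nC (B i j) ^+ 2.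

Let sqnCE m n (B : 'M[R[i]]_(m, n)) :
  toC (sqnC B) = \tr ((map_mx Num.conj B)^T *m B).
Proof.
rewrite /sqnC exchange_big rmorph_sum; apply: eq_bigr => j _ /=.
rewrite rmorph_sum mxE; apply: eq_bigr => i _ /=.
by rewrite rmorphXn /= !mxE mulrC -normCK.
Qed.

Let sqnC_unitary n d (U : 'M[R[i]]_n) (B : 'M[R[i]]_(n, d)) :
  U \is unitarymx -> sqnC (U *m B) = sqnC B.
Proof.
move=> Uu; apply: (@complexI R); rewrite !sqnCE map_mxM trmx_mul.
have U1 : (map_mx Num.conj U)^T *m U = 1%:M.
  by rewrite map_trmx -invmx_unitary// mulVmx// unitarymx_unit.
by rewrite mulmxA -(mulmxA (map_mx Num.conj B)^T) U1 mulmx1.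
Qed.

Let sqnC_toC m n (A : 'M[R]_(m, n)) : sqnC (map_mx toC A) = sqn A.
Proof.
rewrite /sqnC /sqn; apply: eq_bigr => i _; apply: eq_bigr => j _.
by rewrite mxE /= expr0n addr0 sqrtr_sqr real_normK ?num_real.
Qed.

(** [sup] is [0] on a set without supremum, so this case split replaces a bound on the spectrum. *)
Lemma spectral_radius_ge0 n (A : 'M[R]_n) : 0 <= spectral_radius A.
Proof.
rewrite /spectral_radius; set E := [set t | _].
have [E0|E0] := pselect (has_sup E); last by rewrite sup_out.
have [[t Et] ubE] := E0.
apply: (@le_trans _ _ t); last exact: sup_upper_bound.
by case: Et => z _ ->; exact: normc_ge0.
Qed.

(** A real symmetric matrix is unitarily diagonalizable over [R[i]]: in that basis [A] rescales each
    row by an eigenvalue, and unitary changes of basis preserve the norm. *)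
Lemma sqn_mulmx_sym n d (A : 'M[R]_n) (B : 'M[R]_(n, d)) : A^T = A ->
  sqn (A *m B) <= spectral_radius A ^+ 2 * sqn B.
Proof.
move=> As; pose Ac := map_mx toC A.
have Ah : Ac \is hermsymmx.
  apply: realsym_hermsym.
    by apply/is_hermitianmxP; rewrite expr0 scale1r map_mx_id // /Ac map_trmx As.
  apply/mxOverP => i j; rewrite mxE.
  by have := num_real (A i j); rewrite !realE -[0 <= _](lecR 0) -[_ <= 0](lecR _ 0).
have /orthomx_spectralP := hermitian_normalmx Ah.
set U := spectralmx Ac; set D := spectral_diag Ac => AcE.
have Uu : U \is unitarymx by exact: spectral_unitarymx.
have Uunit : U \in unitmx by exact: unitarymx_unit.
have UA : U *m Ac = diag_mx D *m U by rewrite AcE !mulmxA mulmxV// mul1mx.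
have Deig j : eigenvalue Ac (D 0 j).
  apply/eigenvalueP; exists (row j U).
    rewrite -row_mul UA; apply/rowP => k; rewrite !mxE (bigD1 j)//= big1.
      by rewrite !mxE eqxx mulr1n addr0.
    by move=> i ij; rewrite !mxE eq_sym (negbTE ij) mulr0n mul0r.
  (* A zero row [j] contradicts the invertibility of [U]: the [(j, j)] entry of [U *m V = 1] would
     be [0]. *)
  apply/eqP => Uj0.
  have /row_freeP[V /(congr1 (fun M => row j M))] : row_free U.
    by rewrite row_free_unit.
  rewrite row_mul Uj0 mul0mx => /rowP/(_ j)/eqP.
  by rewrite !mxE eqxx eq_sym oner_eq0.
have Dsup j : nC (D 0 j) <= spectral_radius A.
  apply: sup_upper_bound; last by exists (D 0 j).
  (* [sup] bounds its set only when the set is nonempty and bounded. Every eigenvalue turns out to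
     be a diagonal entry, so the sum of their moduli is an upper bound. *)
  split; first by exists (nC (D 0 j)); exists (D 0 j).
  exists (\sum_k nC (D 0 k)) => t [z /eigenvalueP[v vz v0] ->].
  pose u := v *m invmx U.
  have uz : u *m diag_mx D = z *: u.
    rewrite /u scalemxAl -vz -/Ac [in RHS]AcE !mulmxA.
    by rewrite mulmxK.
  have : u != 0.
    apply: contra v0 => /eqP u0.
    by rewrite -(mulmxKV Uunit v) -/u u0 mul0mx.
  case/matrix0Pn => i [k uk].
  have zD : z = D 0 k.
    apply: (mulIf uk); move/matrixP/(_ i k) : uz; rewrite mul_mx_diag.
    by rewrite [in LHS]mxE [in RHS]mxE => <-; rewrite mulrC.
  rewrite zD (bigD1 k)//= lerDl sumr_ge0//.
rewrite -!sqnC_toC map_mxM -/Ac -(sqnC_unitary _ Uu) mulmxA UA -mulmxA.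
rewrite -(sqnC_unitary (map_mx toC B) Uu).
move: (U *m _) => V; rewrite /sqnC mulr_sumr ler_sum// => i _.
rewrite mulr_sumr ler_sum// => j _; rewrite mul_diag_mx mxE.
rewrite ComplexField.Normc.normcM exprMn ler_wpM2r ?sqr_ge0//.
rewrite lerXn2r ?nnegrE ?spectral_radius_ge0//.
Qed.

End SpectralRadius.

(** * Stochastic matrices and orthogonal averaging *)

Section Averaging.
Context {R : realType} {n : nat}.
Implicit Types W : 'M[R]_n.

Lemma enorm_sqn m d (A : 'M[R]_(m, d)) : enorm A ^+ 2 = sqn A.
Proof. by rewrite /enorm sqr_sqrtr//; exact: sqn_ge0. Qed.

(** Jensen's inequality for the square: the weighted variance around the mean [m] is nonnegative. *)
Lemma sqr_sum_le (I : finType) (w a : I -> R) :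
  (forall k, 0 <= w k) -> \sum_k w k = 1 ->
  (\sum_k w k * a k) ^+ 2 <= \sum_k w k * a k ^+ 2.
Proof.
move=> w0 w1; have [m mE] : exists m, m = \sum_k w k * a k by eexists.
rewrite -mE.
have : 0 <= \sum_k w k * (a k - m) ^+ 2.
  by apply: sumr_ge0 => k _; rewrite mulr_ge0 ?sqr_ge0.
have -> : \sum_k w k * (a k - m) ^+ 2 =
    \sum_k w k * a k ^+ 2 - 2 * m * (\sum_k w k * a k) + m ^+ 2 * \sum_k w k.
  rewrite !mulr_sumr -sumrB -big_split; apply: eq_bigr => k _ /=; ring.
by rewrite w1 -mE; lra.
Qed.

(** Jensen's inequality in each row uses the row sums; after exchanging the sums, the column sums
    remove the weights. *)
Lemma sqn_stochastic W d (A : 'M[R]_(n, d)) :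
  doubly_stochastic W -> sqn (W *m A) <= sqn A.
Proof.
move=> [W0 Wr Wc].
apply: (@le_trans _ _ (\sum_i \sum_j \sum_k W i k * A k j ^+ 2)).
  apply: ler_sum => i _; apply: ler_sum => j _; rewrite mxE.
  exact: sqr_sum_le.
under eq_bigr do rewrite exchange_big /=.
rewrite exchange_big /= /sqn le_eqVlt; apply/orP/or_introl/eqP.
apply: eq_bigr => k _; rewrite exchange_big /=; apply: eq_bigr => j _.
by rewrite -mulr_suml Wc mul1r.
Qed.

Lemma sqn_stochastic_sub W d (A : 'M[R]_(n, d)) :
  doubly_stochastic W -> sqn (W *m A - A) <= 4 * sqn A.
Proof.
move=> Wds; apply: (le_trans (sqnD2 _ _)); rewrite sqnN.
by have := sqn_stochastic A Wds; lra.
Qed.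

Definition avgmx : 'M[R]_n := const_mx n%:R^-1.

(** Orthogonal projection onto the matrices whose columns have mean zero; its squared norm is the
    squared consensus error of the rows. *)
Definition centered d (A : 'M[R]_(n, d)) := A - avgmx *m A.

Lemma stack_mean d (v : 'I_n -> 'rV[R]_d) :
  stack (fun=> mean v) = avgmx *m stack v.
Proof.
apply/matrixP => i j; rewrite !mxE.
by rewrite summxE mulr_sumr; apply: eq_bigr => k _; rewrite !mxE.
Qed.

Lemma consensus_error_center d (v : 'I_n -> 'rV[R]_d) :
  consensus_error v ^+ 2 = sqn (centered (stack v)).
Proof. by rewrite /consensus_error enorm_sqn stack_mean. Qed.

Lemma dotm_mulmxl d (M : 'M[R]_n) (A B : 'M[R]_(n, d)) :
  dotm (M *m A) B = dotm A (M^T *m B).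
Proof.
have dotE (C D : 'M[R]_(n, d)) : dotm C D = \tr (C^T *m D).
  rewrite /dotm exchange_big; apply: eq_bigr => j _ /=; rewrite mxE.
  by apply: eq_bigr => i _; rewrite mxE.
by rewrite !dotE trmx_mul mulmxA.
Qed.

Lemma trmx_avgmx : avgmx^T = avgmx. Proof. exact: trmx_const. Qed.

Hypothesis n_gt0 : (0 < n)%N.

Lemma avgmx_row (W : 'M[R]_n) : (forall j, \sum_i W i j = 1) -> avgmx *m W = avgmx.
Proof.
move=> Wc; apply/matrixP => i j; rewrite !mxE -[RHS]mulr1 -[X in _ = _ * X](Wc j) mulr_sumr.
by apply: eq_bigr => k _; rewrite mxE.
Qed.

Lemma mul_avgmx (W : 'M[R]_n) : (forall i, \sum_j W i j = 1) -> W *m avgmx = avgmx.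
Proof.
move=> Wr; apply/matrixP => i j; rewrite !mxE -[RHS]mul1r -[X in _ = X * _](Wr i) mulr_suml.
by apply: eq_bigr => k _; rewrite /avgmx mxE.
Qed.

Lemma avgmx_idem : avgmx *m avgmx = avgmx.
Proof.
apply: avgmx_row => j; under eq_bigr do rewrite mxE.
rewrite sumr_const card_ord -[_ *+ n]mulr_natr mulVf// pnatr_eq0.
by rewrite -lt0n.
Qed.

Lemma avgmx_center d (A : 'M[R]_(n, d)) : avgmx *m centered A = 0.
Proof. by rewrite mulmxBr mulmxA avgmx_idem subrr. Qed.

(** Pythagoras: [avgmx] is a symmetric idempotent, so [centered A] and [avgmx *m A] are
    orthogonal. *)
Lemma sqn_center d (A : 'M[R]_(n, d)) :
  sqn A = sqn (centered A) + sqn (avgmx *m A).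
Proof.
rewrite -[A in LHS](subrK (avgmx *m A)) -/(centered A) sqnD.
have -> : dotm (centered A) (avgmx *m A) = dotm (avgmx *m centered A) A.
  by rewrite dotm_mulmxl trmx_avgmx.
rewrite avgmx_center [dotm 0 A]big1 ?mulr0 ?addr0// => i _.
by rewrite big1// => j _; rewrite mxE mul0r.
Qed.

Lemma sqn_center_le d (A : 'M[R]_(n, d)) : sqn (centered A) <= sqn A.
Proof. by rewrite [leRHS]sqn_center lerDl sqn_ge0. Qed.

Lemma sqn_avgmx_stack d (v : 'I_n -> 'rV[R]_d) :
  sqn (avgmx *m stack v) = n%:R * sqn (mean v).
Proof.
rewrite -stack_mean /sqn big_ord1 [RHS]mulrC.
under eq_bigr do under eq_bigr do rewrite mxE.
by rewrite sumr_const card_ord mulr_natr.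
Qed.

Lemma sqn_mean_le d (v : 'I_n -> 'rV[R]_d) :
  sqn (mean v) <= n%:R^-1 * sqn (stack v).
Proof.
rewrite mulrC ler_pdivlMr ?ltr0n// mulrC -sqn_avgmx_stack.
by rewrite [leRHS]sqn_center lerDr sqn_ge0.
Qed.

End Averaging.

(** * Contraction of consensus and compression errors *)

Section Mixing.
Context {R : realType} {n d : nat} (W : 'M[R]_n).
Hypotheses (n_gt0 : (0 < n)%N) (W_sym : W^T = W) (W_ds : doubly_stochastic W).
Context {gamma : R}.
Hypotheses (gamma_gt0 : 0 < gamma) (gamma_le1 : gamma <= 1).
Implicit Types A V xi E U : 'M[R]_(n, d).

Local Notation rho := (spectral_gap W).
Hypothesis rho_gt0 : 0 < rho.

(** The consensus update without compression. The actual update differs by [gamma *: (W *m E - E)],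
    with [E] the deviation of the transmitted messages. *)
Definition mixing A := A + gamma *: (W *m A - A).

Lemma mixingE A : mixing A = (1 - gamma) *: A + gamma *: (W *m A).
Proof. by rewrite /mixing scalerBr scalerBl scale1r addrCA addrC. Qed.

Lemma mixingD A B : mixing (A + B) = mixing A + mixing B.
Proof. by rewrite !mixingE mulmxDr !scalerDr addrACA. Qed.

Lemma center_mixing A : centered (mixing A) = mixing (centered A).
Proof.
have [W0 Wr Wc] := W_ds.
rewrite /centered !mixingE !mulmxDr -!scalemxAr !mulmxN !mulmxA.
rewrite (avgmx_row Wc) (mul_avgmx Wr) !scalerDr !scalerN.
by rewrite opprD addrACA.
Qed.

Lemma center_laplacian A : centered (W *m A - A) = W *m A - A.
Proof.
have [W0 Wr Wc] := W_ds.
by rewrite /centered mulmxBr !mulmxA (avgmx_row Wc) subrr subr0.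
Qed.

(** [W - 1] kills consensus vectors. This is why increments involve the consensus error of [V] and
    never its full norm. *)
Lemma laplacian_center A : W *m centered A - centered A = W *m A - A.
Proof.
have [W0 Wr Wc] := W_ds.
rewrite /centered mulmxBr !mulmxA (mul_avgmx Wr).
by rewrite opprB addrA subrK.
Qed.

Lemma sqn_mixing A : sqn (mixing A) <= sqn A.
Proof.
rewrite mixingE -[X in _ + X *: _](subKr 1).
have [g0 g1] := (gamma_gt0, gamma_le1).
apply: (le_trans (@sqn_convex _ _ _ (1 - gamma) A (W *m A) _)); first by apply/andP; split; lra.
by have := sqn_stochastic A W_ds; nra.
Qed.

(** On columns of mean zero [W] acts as [W - avgmx], of norm at most [1 - rho]; the triangle
    inequality gives the factor [(1 - gamma) + gamma (1 - rho)]. *)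
Lemma sqn_mixing_center A :
  sqn (mixing (centered A)) <= (1 - gamma * rho) ^+ 2 * sqn (centered A).
Proof.
have -> : mixing (centered A) =
    (1 - gamma) *: centered A + gamma *: ((W - avgmx) *m centered A).
  by rewrite mulmxBl avgmx_center// subr0 mixingE.
have -> : 1 - gamma * rho = (1 - gamma) + gamma * spectral_radius (W - avgmx).
  by rewrite /spectral_gap -/avgmx; ring.
apply: sqn_triangle.
- by rewrite subr_ge0.
- by rewrite mulr_ge0 ?spectral_radius_ge0 // ltW.
- by rewrite sqnZ.
  rewrite sqnZ exprMn -[leRHS]mulrA ler_pM2l ?exprn_gt0//.
  by apply: sqn_mulmx_sym; rewrite linearB /= W_sym trmx_avgmx.
Qed.

Lemma spectral_gap_le1 : rho <= 1.
Proof. by rewrite /spectral_gap gerBl spectral_radius_ge0. Qed.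

(** Only [V] has to keep a sharp factor. The three perturbations are lumped together, hence the [3],
    and pay the Young factor [1 / (gamma rho)]; the [4] bounds the squared norm of [W - 1]. *)
Lemma consensus_step V xi E U : gamma * rho < 1 ->
  sqn (centered (mixing (V + xi) + gamma *: (W *m E - E) + U)) <=
  (1 - gamma * rho) * sqn (centered V) +
  3 / (gamma * rho) * ((1 - gamma * rho) ^+ 2 * sqn xi
                       + 4 * gamma ^+ 2 * sqn E + sqn (centered U)).
Proof.
move=> gr1.
have gr0 : 0 < gamma * rho by rewrite mulr_gt0.
have [g0 g1] := (gamma_gt0, gamma_le1).
have centerD A B : centered (A + B) = centered A + centered B.
  by rewrite /centered mulmxDr opprD addrACA.
rewrite 2!centerD center_mixing centerD mixingD.
have centerZ c A : centered (c *: A) = c *: centered A.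
  by rewrite /centered -scalemxAr scalerBr.
have addE (A B F G : 'M[R]_(n, d)) : A + B + F + G = A + (B + F + G).
  by rewrite -!addrA.
rewrite centerZ center_laplacian addE.
have l0 : 0 < 1 - gamma * rho by rewrite subr_gt0.
have l1 : 1 - gamma * rho < 1 by rewrite ltrBlDr ltrDl.
apply: (le_trans (young_contraction _ l0 l1 (sqn_mixing_center V))).
rewrite lerD2l subKr -[3 / _]mulrC -[leRHS]mulrA ler_pM2l ?invr_gt0//.
apply: (le_trans (sqnD3 _ _ _)); rewrite ler_pM2l//.
rewrite lerD2r sqnZ; apply: lerD.
  apply: (le_trans (sqn_mixing_center xi)).
  by rewrite ler_wpM2l ?sqr_ge0// sqn_center_le.
have := sqn_stochastic_sub E W_ds; have := sqr_ge0 gamma; nra.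
Qed.

Lemma increment_step V xi E U :
  sqn (mixing (V + xi) + gamma *: (W *m E - E) + U - V) <=
  4 * (4 * gamma ^+ 2 * sqn (centered V) + sqn xi
       + 4 * gamma ^+ 2 * sqn E + sqn U).
Proof.
have -> : mixing (V + xi) + gamma *: (W *m E - E) + U - V =
    gamma *: (W *m centered V - centered V) + mixing xi
    + gamma *: (W *m E - E) + U.
  rewrite laplacian_center mixingD /mixing; apply/matrixP => i j.
  by rewrite !mxE; ring.
apply: (le_trans (sqnD4 _ _ _ _)); rewrite ler_pM2l//.
rewrite lerD2r !sqnZ.
have := sqn_stochastic_sub E W_ds; have := sqn_stochastic_sub (centered V) W_ds.
have := sqn_mixing xi; have := sqr_ge0 gamma; nra.
Qed.

(** The new [x^c] minus the old [x^a] is [alpha r (Q / r - z) - (1 - alpha r) z]. As [alpha r < 1],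
    convexity applies and leaves the relative error of the compressor. The other five terms make up
    the move of [x^a] between two iterations. *)
Lemma compression_step (r alpha p : R) (Vc V xi E U xi' Q z : 'M[R]_(n, d)) :
  0 < r -> 0 < alpha < r^-1 -> 0 < p ->
  z = V + xi - Vc ->
  sqn ((1 - alpha) *: Vc + alpha *: (Vc + Q)
       - (mixing (V + xi) + gamma *: (W *m E - E) + U + xi')) <=
  (1 + p / 2) * (alpha * r * sqn (r^-1 *: Q - z) + (1 - alpha * r) * sqn z) +
  (1 + 2 / p) * 5 * (4 * gamma ^+ 2 * sqn (centered V) + 4 * gamma ^+ 2 * sqn xi
       + 4 * gamma ^+ 2 * sqn E + sqn U + sqn xi').
Proof.
move=> r0 /andP[a0 ar] p0 zE.
have ar0 : 0 < alpha * r by rewrite mulr_gt0.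
have ar1 : alpha * r < 1 by rewrite -ltr_pdivlMr// mul1r.
have -> : (1 - alpha) *: Vc + alpha *: (Vc + Q)
       - (mixing (V + xi) + gamma *: (W *m E - E) + U + xi') =
  ((alpha * r) *: (r^-1 *: Q - z) + (1 - alpha * r) *: (- z))
  + (- (gamma *: (W *m centered V - centered V)) - gamma *: (W *m xi - xi)
     - gamma *: (W *m E - E) - U - xi').
  rewrite laplacian_center /mixing mulmxDr zE; apply/matrixP => i j; rewrite !mxE.
  have r_neq0 : r != 0 by exact: lt0r_neq0.
  by field.
apply: (le_trans (young_sqn _ _ (_ : 0 < p / 2))); first by rewrite divr_gt0.
rewrite invf_div -[(_ + 2 / p) * _ * _]mulrA; apply: lerD.
  rewrite ler_pM2l; last by rewrite addr_gt0// divr_gt0.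
  apply: (le_trans (sqn_convex _ _ _)); first by apply/andP; split; lra.
  by rewrite sqnN.
rewrite ler_pM2l; last by rewrite addr_gt0// divr_gt0.
apply: (le_trans (sqnD5 _ _ _ _ _)); rewrite !sqnN ler_pM2l// !lerD2r !sqnZ.
have := sqn_stochastic_sub E W_ds; have := sqn_stochastic_sub (centered V) W_ds.
have := sqn_stochastic_sub xi W_ds; have := sqr_ge0 gamma; nra.
Qed.

End Mixing.

(** * Smooth functions *)

Section Smoothness.
Context {R : realType} {d : nat}.
Implicit Types (f : 'rV[R]_d -> R) (x y v : 'rV[R]_d).

Lemma diff_gradient f x v : differentiable f x ->
  'd f x v = dotm (gradient f x) v.
Proof.
move=> dfx; rewrite {1}[v]row_sum_delta linear_sum /dotm big_ord1 /=.
by apply: eq_bigr => j _; rewrite linearZ/= mxE -deriveE// mulrC.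
Qed.

Lemma is_derive_line f x v (t : R) : differentiable f (x + t *: v) ->
  is_derive t 1 (fun s => f (x + s *: v)) (dotm (gradient f (x + t *: v)) v).
Proof.
move=> df; rewrite -diff_gradient// -deriveE//.
have dE : (fun h => h^-1 *: (((fun s => f (x + s *: v)) \o shift t) (h *: 1)
                              - f (x + t *: v))) =
          (fun h => h^-1 *: ((f \o shift (x + t *: v)) (h *: v)
                              - f (x + t *: v))).
  apply/funext => h /=; congr (_ *: (f _ - _)).
  by rewrite [h *: 1]mulr1 scalerDl addrCA.
apply: DeriveDef; last by rewrite /derive dE.
by rewrite /derivable dE; exact: diff_derivable.
Qed.

Lemma dotm_young m n (c : R) (A B : 'M[R]_(m, n)) : 0 < c ->
  2 * dotm A B <= c^-1 * sqn A + c * sqn B.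
Proof.
move=> c0; rewrite /dotm /sqn !mulr_sumr -big_split ler_sum// => i _ /=.
rewrite !mulr_sumr -big_split ler_sum// => j _ /=.
rewrite -subr_ge0; set a := A i j; set b := B i j.
have -> : c^-1 * a ^+ 2 + c * b ^+ 2 - 2 * (a * b) = c^-1 * (a - c * b) ^+ 2.
  by field; exact: lt0r_neq0.
by rewrite mulr_ge0 ?sqr_ge0// invr_ge0 ltW.
Qed.

Lemma smooth_sqn (L : R) f x y : 0 < L -> smooth L f ->
  sqn (gradient f x - gradient f y) <= L ^+ 2 * sqn (x - y).
Proof.
move=> L0 [_ /(_ x y)] h; rewrite -!enorm_sqn -exprMn.
by rewrite lerXn2r// nnegrE ?mulr_ge0 ?sqrtr_ge0// ltW.
Qed.

(** The mean value theorem is applied to [g], the function along the segment minus the linear and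
    quadratic terms of the bound: its derivative is nonpositive at the intermediate point, so
    [g 1 <= g 0]. *)
Lemma descent_lemma (L : R) f x y : 0 < L -> smooth L f ->
  f y <= f x + dotm (gradient f x) (y - x) + L / 2 * sqn (y - x).
Proof.
move=> L0 fL; have [df _] := fL; set v := y - x.
pose g (t : R) := f (x + t *: v) - t * dotm (gradient f x) v
                  - t ^+ 2 * (L / 2 * sqn v).
pose dg (t : R) := dotm (gradient f (x + t *: v)) v - dotm (gradient f x) v
                   - 2 * t * (L / 2 * sqn v).
have g' (t : R) : is_derive t 1 g (dg t).
  have h := @is_derive_line f x v t (df _).
  rewrite /g; apply: is_derive_eq; rewrite /dg /GRing.scale/=.
  by ring.
have gc : {within `[0, 1], continuous g}.
  apply: continuous_subspaceT => t; apply: differentiable_continuous.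
  by apply/derivable1_diffP; have [] := g' t.
have [c /andP[c0 c1] gE] := MVT ltr01 (fun t _ => g' t) gc.
have : dg c <= 0.
  set D := gradient f (x + c *: v) - gradient f x.
  have DE : dotm D v = dotm (gradient f (x + c *: v)) v - dotm (gradient f x) v.
    by rewrite /dotm !big_ord1 -sumrB; apply: eq_bigr => j _; rewrite !mxE mulrBl.
  rewrite /dg -DE.
  (* The weight [L c] balances Young's inequality: [D] compares gradients at two points that differ
     by [c v], so both resulting terms are at most [L c |v|^2]. *)
  have Lc : 0 < L * c by rewrite mulr_gt0.
  have Dle : (L * c)^-1 * sqn D <= L * c * sqn v.
    rewrite mulrC ler_pdivrMr//.
    apply: (le_trans (smooth_sqn _ _ L0 fL)).
    rewrite [x + _]addrC addrK sqnZ; nra.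
  by have := dotm_young D v Lc; lra.
move: gE; rewrite /g /v !(scale1r, scale0r, addr0, subr0, mulr1, mul0r, expr1n, expr0n, mul1r).
rewrite [x + _]addrC subrK; lra.
Qed.

End Smoothness.

(** * Measurability of compositions with continuous functions *)

Section MeasurableComposition.
Context {R : realType} {d : nat} {dO : measure_display} {T : measurableType dO}.

Lemma measurable_fun_countable d' (U : measurableType d') (I : countType)
    (z : T -> I) (h : I -> U) :
  (forall i, measurable (z @^-1` [set i])) ->
  measurable_fun setT (h \o z).
Proof.
move=> mz _ B mB; rewrite setTI.
have -> : (h \o z) @^-1` B = \bigcup_(i in [set i | B (h i)]) (z @^-1` [set i]).
  apply/seteqP; split => [w /= Bw|w [i /= Bi ->]//]; first by exists (z w).
rewrite bigcup_mkcond; apply: countable_bigcupT_measurable => // i.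
by case: ifP.
Qed.

(** Rounding [X] down to the grid of mesh [1 / m.+1] makes the map factor through a countable type,
    where measurability is automatic; continuity of [g] then gives pointwise convergence as [m]
    grows. *)
Lemma measurable_continuous_row (X : 'I_d -> T -> R) (g : 'rV[R]_d -> R) :
  continuous g -> (forall j, measurable_fun setT (X j)) ->
  measurable_fun setT (fun w => g (\row_j X j w)).
Proof.
move=> gc mX.
pose z (m : nat) (w : T) := [ffun j => Num.floor (m.+1%:R * X j w)].
pose h (m : nat) (k : {ffun 'I_d -> int}) : 'rV[R]_d :=
  \row_j ((k j)%:~R / m.+1%:R).
apply: (@measurable_fun_cvg _ _ _ _ (fun m w => g (h m (z m w)))) => [m|w _].
  apply: (@measurable_fun_countable _ _ _ (z m) (fun k => g (h m k))) => k.
  have -> : z m @^-1` [set k] = \bigcap_(j in [set: 'I_d])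
      ((fun w => m.+1%:R * X j w) @^-1` `[(k j)%:~R, (k j + 1)%:~R[%classic).
    apply/seteqP; split => [w /= <- j _|w /= kw].
      by rewrite /= in_itv/= ffunE floor_itv.
    apply/ffunP => j; rewrite ffunE; apply/eqP; rewrite floor_eq.
    by have := kw j I; rewrite /= in_itv.
  apply: fin_bigcap_measurable => // j _; rewrite -[X in measurable X]setTI.
  have mmX : measurable_fun setT (fun w => m.+1%:R * X j w).
    by apply: measurable_funM => //; exact: mX.
  by apply: mmX => //; exact: measurable_itv.
apply/cvgrPdist_lt => e e0.
have /cvgrPdist_lt/(_ e e0)/nbhs_ballP[del /= del0 hdel] := gc (\row_j X j w).
near=> m; apply: hdel; split => // i j; rewrite /ball/= !mxE ffunE.
have m0 : 0 < m.+1%:R :> R by [].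
apply: (@le_lt_trans _ _ m.+1%:R^-1); last by near: m; exact: near_infty_natSinv_lt (PosNum del0).
have /andP[fl1 fl2] := floor_itv (m.+1%:R * X j w).
have -> : X j w - (Num.floor (m.+1%:R * X j w))%:~R / m.+1%:R =
    m.+1%:R^-1 * (m.+1%:R * X j w - (Num.floor (m.+1%:R * X j w))%:~R).
  by rewrite mulrBr mulKf ?lt0r_neq0// [_ / _]mulrC.
rewrite ger0_norm; last by rewrite mulr_ge0// subr_ge0.
rewrite ler_piMr//; rewrite intrD in fl2; lra.
Unshelve. all: by end_near.
Qed.

End MeasurableComposition.

Section SmoothMeasurable.
Context {R : realType} {d : nat}.

Lemma smooth_continuous (L : R) (f : 'rV[R]_d -> R) : smooth L f -> continuous f.
Proof. by move=> [df _] x; exact: differentiable_continuous. Qed.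

Lemma smooth_gradient_continuous (L : R) (f : 'rV[R]_d -> R) (j : 'I_d) :
  0 < L -> smooth L f -> continuous (fun x => gradient f x 0 j).
Proof.
move=> L0 fL x; apply/(@cvgrPdist_lt _ _ _ (nbhs x) (nbhs_filter x)) => e e0.
(* Balls are taken in the sup norm, hence the factor [d]. The [+ 1] ensures [K >= 1], so that the
   radius [e / K] works without square roots. *)
pose K := L ^+ 2 * d%:R + 1.
have K1 : 1 <= K by rewrite lerDr mulr_ge0 ?sqr_ge0.
have K0 : 0 < K by rewrite (lt_le_trans _ K1).
apply/nbhs_ballP; exists (e / K) => [/=|y [_ xy]]; first exact: divr_gt0.
rewrite -(@ltr_pXn2r _ 2)// ?nnegrE ?(ltW e0)// real_normK ?num_real//.
have h1 : (gradient f x 0 j - gradient f y 0 j) ^+ 2 <= L ^+ 2 * sqn (x - y).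
  apply: le_trans (smooth_sqn x y L0 fL).
  rewrite /sqn big_ord1 (bigD1 j)//= !mxE lerDl sumr_ge0// => k _.
  exact: sqr_ge0.
have h2 : sqn (x - y) <= d%:R * (e / K) ^+ 2.
  rewrite /sqn big_ord1 -[d in d%:R]card_ord -sum1_card natr_sum mulr_suml.
  apply: ler_sum => k _; rewrite mul1r !mxE -[leLHS]real_normK ?num_real//.
  rewrite lerXn2r ?nnegrE ?divr_ge0 ?(ltW e0) ?(ltW K0)//.
  by apply/ltW; have := xy 0 k; rewrite /ball/=.
apply: (le_lt_trans h1).
apply: (@le_lt_trans _ _ ((K - 1) * (e / K) ^+ 2)).
  by rewrite /K addrK -mulrA ler_wpM2l ?sqr_ge0.
rewrite expr_div_n mulrCA gtr_pMr ?exprn_gt0// ltr_pdivrMr ?exprn_gt0// mul1r.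
by rewrite expr2; nra.
Qed.

Context {dO : measure_display} {T : measurableType dO}.

Lemma measurable_smooth (L : R) (f : 'rV[R]_d -> R) (X : T -> 'rV[R]_d) :
  smooth L f -> (forall j, measurable_fun setT (fun w => X w 0 j)) ->
  measurable_fun setT (fun w => f (X w)).
Proof.
move=> fL mX.
have := measurable_continuous_row (smooth_continuous fL) mX.
by apply: eq_measurable_fun => w _; congr f; apply/rowP => j; rewrite mxE.
Qed.

Lemma measurable_gradient (L : R) (f : 'rV[R]_d -> R) (X : T -> 'rV[R]_d) j :
  0 < L -> smooth L f -> (forall j, measurable_fun setT (fun w => X w 0 j)) ->
  measurable_fun setT (fun w => gradient f (X w) 0 j).
Proof.
move=> L0 fL mX.
have := measurable_continuous_row (smooth_gradient_continuous (j := j) L0 fL) mX.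
apply: eq_measurable_fun => w _; congr (gradient f _ 0 j).
by apply/rowP => k; rewrite mxE.
Qed.

End SmoothMeasurable.

Section AverageObjective.
Context {R : realType} {n d : nat}.
Implicit Types (f : 'I_n -> 'rV[R]_d -> R) (x : 'rV[R]_d).

Lemma sqn_stack (v : 'I_n -> 'rV[R]_d) : sqn (stack v) = \sum_i sqn (v i).
Proof.
rewrite /sqn; apply: eq_bigr => i _; rewrite big_ord1.
by apply: eq_bigr => j _; rewrite mxE.
Qed.

Lemma meanB (u v : 'I_n -> 'rV[R]_d) :
  mean (fun i => u i - v i) = mean u - mean v.
Proof. by rewrite /mean sumrB scalerBr. Qed.

Lemma averageE f : average f = n%:R^-1 \*: (\sum_i f i).
Proof. by apply/funext => x; rewrite /average fct_sumE. Qed.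

Lemma differentiable_average f x : (forall i, differentiable (f i) x) ->
  differentiable (average f) x.
Proof.
move=> df; rewrite averageE; apply: differentiableZ.
exact: differentiable_sum.
Qed.

Lemma gradient_average f x : (forall i, differentiable (f i) x) ->
  gradient (average f) x = mean (fun i => gradient (f i) x).
Proof.
move=> df; apply/rowP => j; rewrite !mxE summxE averageE.
rewrite deriveZ; last exact/diff_derivable/differentiable_sum.
rewrite derive_sum; last by move=> i; exact: diff_derivable.
by congr (_ * _); apply: eq_bigr => i _; rewrite mxE.
Qed.

Hypothesis n_gt0 : (0 < n)%N.
Context {L : R} {f : 'I_n -> 'rV[R]_d -> R}.
Hypotheses (L_gt0 : 0 < L) (f_smooth : forall i, smooth L (f i)).

Lemma gradient_averageE x : gradient (average f) x = mean (fun i => gradient (f i) x).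
Proof. by apply: gradient_average => i; have [] := f_smooth i. Qed.

(** Used twice: with all [v i] equal it gives smoothness of the average, and with [v i] the agents'
    states it bounds the gradient disagreement by the consensus error. *)
Lemma sqn_gradient_mean (x : 'rV[R]_d) (v : 'I_n -> 'rV[R]_d) :
  sqn (gradient (average f) x - mean (fun i => gradient (f i) (v i))) <=
  L ^+ 2 / n%:R * sqn (stack (fun i => x - v i)).
Proof.
rewrite gradient_averageE -meanB; apply: (le_trans (sqn_mean_le n_gt0 _)).
rewrite [L ^+ 2 / _]mulrC -mulrA ler_pM2l ?invr_gt0 ?ltr0n//.
rewrite !sqn_stack mulr_sumr; apply: ler_sum => i _.
exact: smooth_sqn.
Qed.

Lemma smooth_average : smooth L (average f).
Proof.
split=> [x|x y].
  by apply: differentiable_average => i; have [] := f_smooth i.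
rewrite -(@ler_pXn2r _ 2)// ?nnegrE ?mulr_ge0 ?sqrtr_ge0 ?(ltW L_gt0)//.
rewrite exprMn !enorm_sqn [in X in _ - X]gradient_averageE.
apply: (le_trans (sqn_gradient_mean _ _)).
rewrite sqn_stack sumr_const card_ord -[X in _ * X <= _]mulr_natl mulrA divfK//.
by rewrite pnatr_eq0 -lt0n.
Qed.

Lemma sqn_gradient_stack (u v : 'I_n -> 'rV[R]_d) :
  sqn (stack (fun i => gradient (f i) (u i)) - stack (fun i => gradient (f i) (v i)))
  <= L ^+ 2 * sqn (stack u - stack v).
Proof.
have stackB (p q : 'I_n -> 'rV[R]_d) : stack p - stack q = stack (fun i => p i - q i).
  by apply/matrixP => i j; rewrite !mxE.
rewrite !stackB !sqn_stack mulr_sumr; apply: ler_sum => i _.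
exact: smooth_sqn.
Qed.

End AverageObjective.

(** * Expectation, independence and the Laplace law *)

Section Expectation.
Context {R : realType} {dO : measure_display} {Omega : measurableType dO}.
Variable P : probability Omega R.
Implicit Types X Y : Omega -> R.

Definition int1 X := P.-integrable setT (EFin \o X).

(* [fine] sends infinite values to 0: [Ex] is meaningful under [int1] only. *)
Definition Ex X : R := fine 'E_P[X]%E.

Lemma int1_Ex X : int1 X -> 'E_P[X]%E = (Ex X)%:E.
Proof. by move=> iX; rewrite /Ex unlock fineK// integrable_fin_num. Qed.

Lemma Ex_Rintegral X : Ex X = \int[P]_w X w.
Proof. by rewrite /Ex unlock. Qed.

Lemma le_int1 X Y : measurable_fun setT X -> (forall w, `|X w| <= Y w) ->
  int1 Y -> int1 X.
Proof.
move=> mX XY; apply: le_integrable => //; first exact/measurable_EFinP.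
by move=> w _; rewrite /= lee_fin (le_trans (XY w))// ler_norm.
Qed.

Lemma int1D X Y : int1 X -> int1 Y -> int1 (fun w => X w + Y w).
Proof. by move=> iX iY; have := integrableD measurableT iX iY. Qed.

Lemma int1Z c X : int1 X -> int1 (fun w => c * X w).
Proof. by move=> iX; have := integrableZl measurableT c iX. Qed.

Lemma int1_cst c : int1 (fun=> c).
Proof. exact: finite_measure_integrable_cst. Qed.

Lemma int1_sum (I : Type) (s : seq I) (X : I -> Omega -> R) :
  (forall i, int1 (X i)) -> int1 (fun w => \sum_(i <- s) X i w).
Proof.
move=> iX; elim: s => [|i s ih].
  by under eq_fun do rewrite big_nil; exact: int1_cst.
by under eq_fun do rewrite big_cons; exact: int1D.
Qed.

Lemma ExD X Y : int1 X -> int1 Y -> Ex (fun w => X w + Y w) = Ex X + Ex Y.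
Proof. by move=> iX iY; rewrite !Ex_Rintegral RintegralD. Qed.

Lemma ExZ c X : int1 X -> Ex (fun w => c * X w) = c * Ex X.
Proof. by move=> iX; rewrite !Ex_Rintegral RintegralZl. Qed.

Lemma Ex_cst c : Ex (fun=> c) = c.
Proof. by rewrite /Ex expectation_cst. Qed.

Lemma Ex_sum (I : Type) (s : seq I) (X : I -> Omega -> R) :
  (forall i, int1 (X i)) ->
  Ex (fun w => \sum_(i <- s) X i w) = \sum_(i <- s) Ex (X i).
Proof.
move=> iX; elim: s => [|i s ih].
  by rewrite big_nil; under eq_fun do rewrite big_nil; exact: Ex_cst.
rewrite big_cons -ih -ExD//; last exact: int1_sum.
by congr Ex; apply/funext => w; rewrite big_cons.
Qed.

Lemma Ex_le X Y : int1 X -> int1 Y -> (forall w, X w <= Y w) -> Ex X <= Ex Y.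
Proof. by move=> iX iY XY; rewrite !Ex_Rintegral le_Rintegral. Qed.

Lemma Ex_ge0 X : (forall w, 0 <= X w) -> 0 <= Ex X.
Proof. by move=> X0; rewrite Ex_Rintegral Rintegral_ge0. Qed.

(** An explicit list of coefficients and functions: taking expectations in a long pointwise bound
    then costs one integrability proof per entry, and the resulting sum unfolds by rewriting. *)
Definition lincomb (l : seq (R * (Omega -> R))) (w : Omega) : R :=
  \sum_(p <- l) p.1 * p.2 w.

Lemma int1_lincomb (l : seq (R * (Omega -> R))) :
  foldr (fun p => and (int1 p.2)) True l -> int1 (lincomb l).
Proof.
elim: l => [_|p l ih /= [ip il]].
  by rewrite /lincomb; under eq_fun do rewrite big_nil; exact: int1_cst.
rewrite /lincomb; under eq_fun do rewrite big_cons.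
by apply: int1D; [exact: int1Z|exact: ih].
Qed.

Lemma Ex_lincomb (l : seq (R * (Omega -> R))) :
  foldr (fun p => and (int1 p.2)) True l ->
  Ex (lincomb l) = \sum_(p <- l) p.1 * Ex p.2.
Proof.
elim: l => [_|p l ih /= [ip il]].
  rewrite big_nil /lincomb; under eq_fun do rewrite big_nil.
  exact: Ex_cst.
rewrite big_cons -ih// -ExZ// -ExD; [|exact: int1Z|exact: int1_lincomb].
by congr Ex; apply/funext => w; rewrite /lincomb big_cons.
Qed.

Lemma Ex_le_lincomb X (l : seq (R * (Omega -> R))) :
  int1 X -> foldr (fun p => and (int1 p.2)) True l ->
  (forall w, X w <= \sum_(p <- l) p.1 * p.2 w) ->
  Ex X <= \sum_(p <- l) p.1 * Ex p.2.
Proof.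
by move=> iX il Xl; rewrite -Ex_lincomb//; apply: Ex_le => //; exact: int1_lincomb.
Qed.

Definition L2 X := measurable_fun setT X /\ int1 (fun w => X w ^+ 2).

Lemma le_L2 X Y : measurable_fun setT X -> (forall w, X w ^+ 2 <= Y w) ->
  int1 Y -> L2 X.
Proof.
move=> mX XY iY; split=> //; apply: le_int1 iY; first exact: measurable_funX.
by move=> w; rewrite ger0_norm ?sqr_ge0.
Qed.

Lemma L2D X Y : L2 X -> L2 Y -> L2 (fun w => X w + Y w).
Proof.
move=> [mX iX] [mY iY].
apply: (@le_L2 _ (fun w => 2 * X w ^+ 2 + 2 * Y w ^+ 2)).
- exact: measurable_funD.
- by move=> w; have := sqr_ge0 (X w - Y w); nra.
- by apply: int1D; exact: int1Z.
Qed.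

Lemma L2Z c X : L2 X -> L2 (fun w => c * X w).
Proof.
move=> [mX iX]; split; first exact: measurable_funM.
by under eq_fun do rewrite exprMn; exact: int1Z.
Qed.

Lemma L2_cst c : L2 (fun=> c).
Proof. by split; [exact: measurable_cst|exact: int1_cst]. Qed.

Lemma L2M_int1 X Y : L2 X -> L2 Y -> int1 (fun w => X w * Y w).
Proof.
move=> [mX iX] [mY iY]; apply: le_int1 (int1D iX iY).
  exact: measurable_funM.
move=> w; rewrite ler_norml; apply/andP; split.
- by have := sqr_ge0 (X w + Y w); have := sqr_ge0 (X w); have := sqr_ge0 (Y w); nra.
- by have := sqr_ge0 (X w - Y w); have := sqr_ge0 (X w); have := sqr_ge0 (Y w); nra.
Qed.

Lemma L2_int1 X : L2 X -> int1 X.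
Proof.
by move=> lX; have := L2M_int1 lX (L2_cst 1); under eq_fun do rewrite mulr1.
Qed.

End Expectation.

(** * Independence and generated sigma-algebras *)

Section IndependentPair.
Context {R : realType} {dO d1 d2 : measure_display} {Omega : measurableType dO}
  {S1 : measurableType d1} {S2 : measurableType d2}.
Variable P : probability Omega R.

Definition independent_pair (X : Omega -> S1) (Y : Omega -> S2) :=
  forall A B, measurable A -> measurable B ->
    P (X @^-1` A `&` Y @^-1` B) = (P (X @^-1` A) * P (Y @^-1` B))%E.

(** The law of the pair agrees with the product of the laws on rectangles, hence everywhere;
    Tonelli's theorem then integrates [X] with [Y] frozen. *)
Lemma ge0_integral_independent (X : {mfun Omega >-> S1}) (Y : {mfun Omega >-> S2})
    (h : S1 * S2 -> \bar R) :
  independent_pair X Y -> measurable_fun setT h -> (forall z, 0 <= h z)%E ->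
  (\int[P]_w h (X w, Y w) =
   \int[P]_w \int[distribution P X]_u h (u, Y w))%E.
Proof.
move=> XY mh h0.
have mXY : measurable_fun setT (fun w => (X w, Y w)).
  by apply/measurable_fun_pairP; split; exact: measurable_funPT.
pose Z : {mfun Omega >-> (S1 * S2)%type} := HB.pack (fun w => (X w, Y w))
  (isMeasurableFun.Build _ _ _ _ _ mXY).
transitivity (\int[distribution P Z]_z h z)%E.
  by rewrite ge0_integral_distribution.
transitivity (\int[(distribution P X \x distribution P Y)%E]_z h z)%E.
  apply: eq_measure_integral => A mA _; apply/esym.
  apply: (@product_measure_unique _ _ _ _ _ (distribution P X)
    (distribution P Y) (distribution P Z)) => //.
rewrite fubini_tonelli1// fubini_tonelli//.
by rewrite (@ge0_integral_distribution _ _ _ _ _ P Y (fun y => \int[distribution P X]_u h (u, y))%E)//;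
  [exact: measurable_fun_fubini_tonelli_G|move=> y; exact: integral_ge0].
Qed.

End IndependentPair.

Section Independence.
Context {R : realType} {dO : measure_display} {Omega : measurableType dO}.
Variable P : probability Omega R.

Context {I : eqType} (F : I -> set_system Omega).

(** A pi-system generating the events observable from the sources in [J]; its lists have the form
    required by [mutually_independent]. *)
Definition cylinders (J : set I) : set_system Omega :=
  [set B | exists s A, [/\ uniq s, forall i, i \in s -> J i /\ F i (A i) &
                        B = \big[setI/setT]_(i <- s) A i]].

Lemma in_bigsetI (s : seq I) (A : I -> set Omega) w :
  (\big[setI/setT]_(i <- s) A i) w <-> (forall i, i \in s -> A i w).
Proof.
elim: s => [|i s ih]; first by rewrite big_nil; split.
rewrite big_cons; split => [[Ai /ih As] j|As].
  by rewrite inE => /predU1P[->//|/As].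
split; first by apply: As; rewrite mem_head.
by apply/ih => j js; apply: As; rewrite inE js orbT.
Qed.

Hypotheses (FT : forall i, F i setT) (FI : forall i, setI_closed (F i)).

Lemma cylinders_setI_closed J : setI_closed (cylinders J).
Proof.
move=> _ _ [s [A [us As ->]]] [t [B [ut Bt ->]]].
pose A' i := if i \in s then A i else setT.
pose B' i := if i \in t then B i else setT.
(* A source present in only one of the two lists contributes [setT] on the other side. *)
exists (undup (s ++ t)), (fun i => A' i `&` B' i); split.
- exact: undup_uniq.
- move=> i; rewrite mem_undup mem_cat => ist; split.
    by case/orP : ist => [/As[]|/Bt[]].
  apply: FI; first by rewrite /A'; case: ifP => // /As[].
  by rewrite /B'; case: ifP => // /Bt[].
apply/seteqP; split => w.
  move=> [/in_bigsetI wA /in_bigsetI wB]; apply/in_bigsetI => i _.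
  by split; [rewrite /A'; case: ifP => // /wA|rewrite /B'; case: ifP => // /wB].
move/in_bigsetI => w'; split; apply/in_bigsetI => i iin.
  have [|+ _] := w' i; first by rewrite mem_undup mem_cat iin.
  by rewrite /A' iin.
have [|_] := w' i; first by rewrite mem_undup mem_cat iin orbT.
by rewrite /B' iin.
Qed.

Hypothesis Fm : forall i A, F i A -> measurable A.
Hypothesis F_indep : mutually_independent P F.

Lemma cylinders_measurable J B : cylinders J B -> measurable B.
Proof.
move=> [s [A [_ As ->]]]; elim: s As => [|i s ih] As; first by rewrite big_nil.
rewrite big_cons; apply: measurableI.
  by apply: (Fm (i := i)); have [] := As i (mem_head _ _).
by apply: ih => j js; apply: As; rewrite inE js orbT.
Qed.

Lemma independent_cylinders J a E B : ~ J a -> F a E -> cylinders J B ->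
  P (E `&` B) = (P E * P B)%E.
Proof.
move=> Ja FE [s [A [us As BE]]].
have as_ : a \notin s by apply/negP => /As[].
pose A' i := if i == a then E else A i.
have A'E : \big[setI/setT]_(i <- s) A' i = B.
  rewrite BE; apply: eq_big_seq => i si; rewrite /A'; case: eqP => // ia.
  by move: as_; rewrite -ia si.
have PB : P B = (\prod_(i <- s) P (A i))%E.
  by rewrite BE F_indep// => i /As[].
have := F_indep (s := a :: s) (A := A').
rewrite /= as_ us => /(_ isT); rewrite !big_cons A'E /A' eqxx.
rewrite PB => -> //.
  congr (_ * _)%E; apply: eq_big_seq => i si; case: eqP => // ia.
  by move: as_; rewrite -ia si.
move=> i; rewrite inE; case: eqP => [->//|_ /= /As[]//].
Qed.

Definition generated (J : set I) := g_sigma_algebraType (cylinders J).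

(** With [E] fixed, [m1] and [m2] are finite measures of equal total mass that agree on the
    pi-system of cylinders, hence on the sigma-algebra it generates. *)
Lemma independent_generated J a E B : ~ J a -> F a E ->
  <<s cylinders J>> B -> P (E `&` B) = (P E * P B)%E.
Proof.
move=> Ja FE.
have mE := Fm FE.
pose m1 := mrestr P mE.
have PEfin : P E \is a fin_num by exact: fin_num_measure.
pose c : {nonneg R} := NngNum (fine_ge0 (measure_ge0 P E)).
pose m2 := mscale c P.
have m2E A : m2 A = (P E * P A)%E.
  by rewrite /m2 /mscale /= fineK.
have m1E A : m1 A = P (A `&` E) by [].
move=> GB; rewrite setIC -m1E -m2E.
apply: (@g_sigma_algebra_measure_unique_trace _ _ _ (cylinders J) setT _ _ _ m1 m2) => //.
- by move=> A [/cylinders_measurable].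
- by move=> A1 A2 [c1 _] [c2 _]; split=> //; exact: cylinders_setI_closed.
- transitivity (P (setT `&` E)); first by [].
  by rewrite setTI; apply/esym; rewrite -[RHS]mule1 -(probability_setT P); exact: m2E.
- move=> A [cA _]; transitivity (P E * P A)%E; last exact/esym/m2E.
  by rewrite -(independent_cylinders Ja FE cA) setIC.
- apply: (@le_lt_trans _ _ (P (setT `&` E))); first by [].
  by rewrite setTI ltey_eq PEfin.
- by have -> : [set X | cylinders J X /\ X `<=` setT] = cylinders J
    by apply/seteqP; split => X //= [].
Qed.

Lemma sub_generated J d (S : measurableType d) (X : Omega -> S) a :
  J a -> F a = events_of X -> measurable_fun setT (X : generated J -> S).
Proof.
move=> Ja FX _ B mB; apply: sub_sigma_algebra.
exists [:: a], (fun=> setT `&` X @^-1` B); split => //.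
- move=> i; rewrite inE => /eqP ->; split=> //; rewrite FX.
  by exists B.
- by rewrite big_seq1.
Qed.

Lemma independent_source J a d1 d2 (S1 : measurableType d1)
    (S2 : measurableType d2) (X : Omega -> S1) (Y : Omega -> S2) :
  ~ J a -> F a = events_of X ->
  measurable_fun setT (Y : generated J -> S2) ->
  independent_pair P X Y.
Proof.
move=> Ja FX mY A B mA mB; apply: (independent_generated Ja).
  by rewrite FX; exists A => //; rewrite setTI.
by have := mY measurableT _ mB; rewrite setTI.
Qed.

End Independence.

(** * Densities and moments of the Laplace law *)

Section Density.
Context {R : realType} {d : measure_display} {T : measurableType d}.
Variables (mu nu : {measure set T -> \bar R}) (p : T -> R).
Hypotheses (mp : measurable_fun setT p) (p_ge0 : forall x, 0 <= p x).
Hypothesis nuE : forall A, measurable A -> nu A = (\int[mu]_(x in A) (p x)%:E)%E.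

Import HBNNSimple.

Let integral_density_nnsfun (g : {nnsfun T >-> R}) :
  (\int[nu]_x (g x)%:E = \int[mu]_x (g x * p x)%:E)%E.
Proof.
rewrite integralT_nnsfun sintegralE.
have mr r : measurable (g @^-1` [set r]).
  by rewrite -[X in measurable X]setTI; exact: measurable_funPT.
transitivity (\sum_(r \in range g)
    \int[mu]_x (r * \1_(g @^-1` [set r]) x * p x)%:E)%E; last first.
  rewrite -ge0_integral_fsum//.
  - apply: eq_integral => x _; rewrite fsumEFin//; congr EFin.
    by rewrite (fimfunE g) !fsbig_finite//= mulr_suml.
  - move=> r; apply/measurable_EFinP; apply: measurable_funM => //.
    exact: measurable_funM.
  - move=> r x _; rewrite lee_fin mulr_ge0//.
    by have := nnfun_muleindic_ge0 g r x; rewrite -EFinM lee_fin.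
apply: eq_fsbigr => r; rewrite inE => -[t _ <-].
rewrite nuE// -ge0_integralZl//; first last.
- by rewrite lee_fin.
- by move=> x _; rewrite lee_fin.
- exact/measurable_EFinP/measurable_funTS.
rewrite integral_mkcond; apply: eq_integral => x _.
rewrite patchE indicE; case: ifP => _; first by rewrite mulr1.
by rewrite mulr0 mul0r.
Qed.

(** From simple functions by monotone convergence, along the same approximation of [h] on both
    sides. *)
Lemma ge0_integral_density (h : T -> \bar R) :
  measurable_fun setT h -> (forall x, (0 <= h x)%E) ->
  (\int[nu]_x h x = \int[mu]_x (h x * (p x)%:E))%E.
Proof.
move=> mh h0; pose g := nnsfun_approx measurableT mh.
have gh x : (g n x)%:E @[n --> \oo] --> h x by exact: cvg_nnsfun_approx.
have ndg x : {homo (fun n => g n x) : a b / (a <= b)%N >-> a <= b}.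
  by move=> a b ab; exact/lefP/nd_nnsfun_approx.
have cvgl : (\int[nu]_x (g n x)%:E @[n --> \oo] --> \int[nu]_x h x)%E.
  rewrite [X in _ --> X](_ : _ = (\int[nu]_x limn (fun n => (g n x)%:E))%E);
    last by apply: eq_integral => x _; exact/esym/cvg_lim.
  apply: cvg_monotone_convergence => //.
  - by move=> n; exact/measurable_EFinP/measurable_funPT.
  - by move=> n x _; rewrite lee_fin.
  - by move=> x _ a b ab; rewrite lee_fin ndg.
have cvgr : (\int[mu]_x (g n x * p x)%:E @[n --> \oo]
             --> \int[mu]_x (h x * (p x)%:E))%E.
  rewrite [X in _ --> X](_ : _ = (\int[mu]_x limn (fun n => (g n x * p x)%:E))%E);
    last first.
    apply: eq_integral => x _; apply/esym/cvg_lim => //.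
    by under eq_fun do rewrite EFinM; exact: cvgeZr.
  apply: cvg_monotone_convergence => //.
  - by move=> n; apply/measurable_EFinP; apply: measurable_funM.
  - by move=> n x _; rewrite lee_fin mulr_ge0.
  - by move=> x _ a b ab; rewrite lee_fin ler_wpM2r// ndg.
rewrite -(cvg_lim _ cvgl)// -(cvg_lim _ cvgr)//.
by under eq_fun do rewrite integral_density_nnsfun.
Qed.

End Density.

Section Laplace.
Context {R : realType} {theta : R}.
Hypothesis theta_gt0 : 0 < theta.
Local Notation mu := lebesgue_measure.

Lemma laplace_density_ge0 x : 0 <= laplace_density theta x.
Proof.
by rewrite /laplace_density mulr_ge0 ?expR_ge0// invr_ge0 mulr_ge0// ltW.
Qed.

Lemma laplace_density_continuous : continuous (laplace_density theta).
Proof.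
move=> x; apply: cvgMr; apply: (@continuous_comp _ _ _ (fun x => - `|x| / theta) expR).
  by apply: cvgMl; apply: cvgN; exact: norm_continuous.
exact: continuous_expR.
Qed.

Lemma measurable_laplace_density : measurable_fun setT (laplace_density theta).
Proof. by apply: continuous_measurable_fun; exact: laplace_density_continuous. Qed.

(** Antiderivative, on the half-line [x >= 0], of [x ^+ 2] times the density, as obtained by
    repeated integration by parts. *)
Let prim x : R := - (x ^+ 2 + 2 * theta * x + 2 * theta ^+ 2) / 2 * expR (- x / theta).

Let prim_derive (x : R) : is_derive x 1 prim (x ^+ 2 * ((2 * theta)^-1 * expR (- x / theta))).
Proof.
have theta_neq0 : theta != 0 by exact: lt0r_neq0.
have dexp : is_derive x 1 (fun x => expR (- x / theta)) (- theta^-1 * expR (- x / theta)).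
  have dlin : is_derive x 1 (fun x => - x / theta) (- theta^-1).
    by apply: is_derive_eq; rewrite /GRing.scale/=; ring.
  have := @is_derive1_comp R expR (fun x => - x / theta) x _ _
    (is_derive_expR (- x / theta)) dlin.
  by rewrite mulrC.
rewrite /prim; apply: is_derive_eq; rewrite /GRing.scale/=.
by field.
Qed.

Let prim_lim : prim x @[x --> +oo] --> 0.
Proof.
(* For [x >= 1] the quadratic in [prim] is at most [x^2 (1 + 2 theta + 2 theta^2)], while
   [expR (x / theta) >= x^3 / (6 theta^3)]; with the factor [1/2] this bounds [prim x] by [K / x] in
   absolute value. *)
pose K := 3 * theta ^+ 3 * (1 + 2 * theta + 2 * theta ^+ 2).
have K0 : 0 < K by rewrite /K !(mulr_gt0, addr_gt0) ?exprn_gt0.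
apply/cvgrPdist_le => e e0; near=> x.
have x1 : 1 <= x by near: x; apply: nbhs_pinfty_ge; exact: num_real.
have xKe : K / e <= x by near: x; apply: nbhs_pinfty_ge; exact: num_real.
have x0 : 0 < x by rewrite (lt_le_trans _ x1).
have t3 : 0 < theta ^+ 3 by rewrite exprn_gt0.
have expx : x ^+ 3 / (6 * theta ^+ 3) <= expR (x / theta).
  apply: (@le_trans _ _ (1 + (x / theta) ^+ 3 / 3`!%:R)).
    rewrite expr_div_n -[3`!]/6%N invfM mulrA mulrAC.
    by rewrite lerDr.
  by apply: expR_ge1Dxn; rewrite divr_ge0// ltW.
have S0 : 0 <= x ^+ 2 + 2 * theta * x + 2 * theta ^+ 2.
  by rewrite !addr_ge0 ?mulr_ge0 ?sqr_ge0 ?(ltW theta_gt0) ?(ltW x0).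
have E0 : 0 < expR (- x / theta) by exact: expR_gt0.
have EG : expR (x / theta) * expR (- x / theta) = 1.
  by rewrite mulNr -expRD subrr expR0.
rewrite sub0r normrN /prim normrM (gtr0_norm E0) mulNr normrN ger0_norm; last first.
  by rewrite divr_ge0.
apply: (@le_trans _ _ (e * expR (x / theta) * expR (- x / theta))); last first.
  by rewrite -mulrA EG mulr1.
rewrite ler_pM2r//; apply: (@le_trans _ _ (e * (x ^+ 3 / (6 * theta ^+ 3)))); last first.
  by rewrite ler_pM2l.
rewrite [leRHS]mulrA ler_pdivlMr ?mulr_gt0//.
have Kex : K <= x * e by rewrite -ler_pdivrMr.
have Sx : x ^+ 2 + 2 * theta * x + 2 * theta ^+ 2 <= x ^+ 2 * (1 + 2 * theta + 2 * theta ^+ 2).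
  have t0 := theta_gt0; have xx : x <= x ^+ 2 by nra.
  have xx1 : 1 <= x ^+ 2 by nra.
  have := ler_wpM2l (ltW t0) xx; have := ler_wpM2l (sqr_ge0 theta) xx1; nra.
apply: (@le_trans _ _ (x ^+ 2 * K)); last first.
  have := ler_wpM2l (sqr_ge0 x) Kex; have -> : e * x ^+ 3 = x ^+ 2 * (x * e) by ring.
  by [].
rewrite /K; have := ler_wpM2r (ltW t3) Sx; nra.
Unshelve. all: by end_near.
Qed.

Lemma laplace_second_moment :
  (\int[mu]_x (x ^+ 2 * laplace_density theta x)%:E = (2 * theta ^+ 2)%:E)%E.
Proof.
rewrite ge0_symfun_integralT; last 3 first.
- by move=> x; rewrite mulr_ge0 ?sqr_ge0 ?laplace_density_ge0.
- move=> x; apply: cvgM; last exact: laplace_density_continuous.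
  exact: exprn_continuous.
- by move=> x /=; rewrite sqrrN /laplace_density normrN.
rewrite -set_itvcy.
transitivity (2%:E * \int[mu]_(x in `[0%R, +oo[)
    (x ^+ 2 * ((2 * theta)^-1 * expR (- x / theta)))%:E)%E.
  congr (_ * _)%E; apply: eq_integral => x; rewrite inE/= in_itv/= andbT => x0.
  by rewrite /laplace_density ger0_norm.
have cexp : continuous (fun x : R => expR (- x / theta)).
  move=> x. apply: (@continuous_comp _ _ _ (fun x : R => - x / theta) expR).
    by apply: cvgMl; apply: cvgN; exact: cvg_id.
  exact: continuous_expR.
rewrite (@ge0_continuous_FTC2y _ _ prim _ 0).
- by rewrite -EFinB -EFinM; congr EFin; rewrite /prim oppr0 mul0r expR0; field.
- by move=> x x0; rewrite !mulr_ge0 ?expR_ge0 ?sqr_ge0// invr_ge0 mulr_ge0// ltW.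
- apply: continuous_subspaceT => x; apply: cvgM; first exact: exprn_continuous.
  by apply: cvgMr; exact: cexp.
- exact: prim_lim.
- by move=> x x0; have [] := prim_derive x.
- apply: cvg_at_right_filter; apply: differentiable_continuous.
  by apply/derivable1_diffP; have [] := prim_derive 0.
- by move=> x _; rewrite derive1E; have [_ ->] := prim_derive x.
Qed.

End Laplace.

Section LaplaceVariable.
Context {R : realType} {dO : measure_display} {Omega : measurableType dO}.
Variables (P : probability Omega R) (X : {RV P >-> R}) (theta : R).
Hypotheses (theta_gt0 : 0 < theta) (X_law : laplace_distributed X theta).

(** The same map, retyped so that its law and [lebesgue_measure] live on the same measurable
    type. *)
Let toR (Z : {RV P >-> R}) : {mfun Omega >-> measurableTypeR R} :=
  HB.pack (Z : Omega -> measurableTypeR R) (isMeasurableFun.Build _ _ _ _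
    (Z : Omega -> measurableTypeR R)
    (fun mT A mA => @measurable_funPT _ _ _ _ Z mT A mA)).

Let toR_law (A : set (measurableTypeR R)) : measurable A ->
  (distribution P (toR X) A =
   \int[lebesgue_measure]_(x in A) (laplace_density theta x)%:E)%E.
Proof. by move=> mA; exact: (X_law mA). Qed.

Let mdens : measurable_fun setT (laplace_density theta : measurableTypeR R -> R).
Proof. exact: measurable_laplace_density. Qed.

Let int_sqr : (\int[P]_w (X w ^+ 2)%:E = (2 * theta ^+ 2)%:E)%E.
Proof.
rewrite -(laplace_second_moment theta_gt0).
under [RHS]eq_integral do rewrite EFinM.
have msqr : measurable_fun setT
    ((fun x => (x ^+ 2)%:E) : measurableTypeR R -> \bar R).
  by apply/measurable_EFinP; exact: measurable_funX.
have sqr_ge0E (x : measurableTypeR R) : (0 <= (x ^+ 2)%:E)%E.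
  by rewrite lee_fin sqr_ge0.
rewrite -(@ge0_integral_density R _ (measurableTypeR R) lebesgue_measure _ _
  mdens (laplace_density_ge0 theta_gt0) toR_law _ msqr sqr_ge0E).
by rewrite (@ge0_integral_distribution _ _ _ _ _ P (toR X) _ msqr sqr_ge0E).
Qed.

Lemma laplace_L2 : L2 P X.
Proof.
split; first exact: measurable_funPT.
apply/integrableP; split.
  by apply/measurable_EFinP; apply: measurable_funX; exact: measurable_funPT.
under eq_integral do rewrite /= ger0_norm ?sqr_ge0//.
by rewrite int_sqr ltry.
Qed.

Lemma laplace_Ex_sqr : Ex P (fun w => X w ^+ 2) = 2 * theta ^+ 2.
Proof. by rewrite /Ex unlock int_sqr. Qed.

(* The density is even, so X and - X have the same law. *)
Lemma laplace_Ex : Ex P X = 0.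
Proof.
have iX := L2_int1 laplace_L2.
have mN : measurable_fun setT (fun w => - X w).
  by apply: measurableT_comp => //; exact: measurable_funPT.
pose Y : {RV P >-> R} := HB.pack (fun w => - X w)
  (isMeasurableFun.Build _ _ _ _ _ mN).
have mopp : measurable_fun setT (-%R : measurableTypeR R -> measurableTypeR R).
  exact: oppr_measurable.
have XY (A : set (measurableTypeR R)) : measurable A ->
    distribution P (toR X) A = distribution P (toR Y) A.
  move=> mA; have mNA : measurable ((-%R : measurableTypeR R -> measurableTypeR R) @^-1` A).
    by rewrite -[X in measurable X]setTI; exact: mopp.
  transitivity (distribution P (toR X)
     ((-%R : measurableTypeR R -> measurableTypeR R) @^-1` A)); last by [].
  rewrite (toR_law mA) (toR_law mNA).
  transitivity (\int[pushforward lebesgue_measure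
      (-%R : measurableTypeR R -> measurableTypeR R)]_(x in A)
      (laplace_density theta x)%:E)%E.
    apply: eq_measure_integral => B mB BA; apply/esym.
    exact: lebesgue_measureN.
  rewrite ge0_integral_pushforward//.
  - by apply: eq_integral => x _; rewrite /= /laplace_density normrN.
  - by apply/measurable_EFinP/measurable_funTS.
  - by move=> x _; rewrite lee_fin laplace_density_ge0.
have mE : measurable_fun setT (EFin : measurableTypeR R -> \bar R).
  by apply/measurable_EFinP; exact: measurable_id.
have ENX : Ex P (fun w => - X w) = - Ex P X.
  by rewrite -mulN1r -ExZ//; congr Ex; apply/funext => w; rewrite mulN1r.
suff : Ex P X = Ex P (fun w => - X w) by rewrite ENX; lra.
rewrite /Ex unlock; congr fine.
have iNX : P.-integrable setT (EFin \o Y).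
  have := int1Z (-1) iX; rewrite /int1.
  by congr (P.-integrable _ _); apply/funext => w; rewrite /= mulN1r.
rewrite -[LHS](@integral_distribution _ _ _ _ _ P (toR X) EFin mE iX).
rewrite -[RHS](@integral_distribution _ _ _ _ _ P (toR Y) EFin mE iNX).
by apply: eq_measure_integral => A mA _; exact: XY.
Qed.

End LaplaceVariable.

(** * The compressor at a random input *)

Section Compressor.
Context {R : realType} {d : nat} {dS : measure_display} {S : measurableType dS}.
Variables (C : S -> 'rV[R]_d -> 'rV[R]_d).
Hypothesis C_meas : measurable_compressor C.

Lemma measurable_row_tuple dT (T : measurableType dT) (Z : T -> 'rV[R]_d) :
  (forall j, measurable_fun setT (fun w => Z w 0 j)) ->
  measurable_fun setT (fun w => [tuple Z w 0 j | j < d]).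
Proof.
move=> mZ; apply/measurable_fun_tnthP => j; have := mZ j.
by apply: eq_measurable_fun => w _ /=; rewrite tnth_mktuple.
Qed.

Lemma measurable_compress dT (T : measurableType dT) (u : T -> S)
    (Z : T -> 'rV[R]_d) j :
  measurable_fun setT u -> (forall j, measurable_fun setT (fun w => Z w 0 j)) ->
  measurable_fun setT (fun w => C (u w) (Z w) 0 j).
Proof.
move=> mu mZ.
have := measurableT_comp (C_meas j) (measurable_fun_pair mu (measurable_row_tuple mZ)).
apply: eq_measurable_fun => w _ /=; congr (C _ _ 0 j).
by apply/rowP => k; rewrite mxE tnth_mktuple.
Qed.

Context {dO : measure_display} {Omega : measurableType dO}.
Variables (P : probability Omega R) (Q : probability S R) (r phi : R).
Hypothesis C_contr : contractive_compressor Q C r phi.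

Lemma int1_sqn m n (A : Omega -> 'M[R]_(m, n)) :
  (forall i j, L2 P (fun w => A w i j)) -> int1 P (fun w => sqn (A w)).
Proof.
move=> LA; apply: int1_sum => i; apply: int1_sum => j.
by have [] := LA i j.
Qed.

Let err (p : S * d.-tuple R) : R :=
  sqn (r^-1 *: C p.1 (\row_l tnth p.2 l) - \row_l tnth p.2 l).

Let measurable_err : measurable_fun setT err.
Proof.
apply: measurable_sum => i; apply: measurable_sum => j.
apply: measurable_funX.
rewrite (ord1 i); under eq_fun do rewrite !mxE.
apply: measurable_funB.
  by apply: measurable_funM => //; exact: C_meas.
exact: (measurableT_comp (measurable_tnth j) measurable_snd).
Qed.

Variables (u : {mfun Omega >-> S}) (Z : Omega -> 'rV[R]_d).
Hypothesis u_law : forall A, measurable A -> distribution P u A = Q A.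
Hypothesis LZ : forall j, L2 P (fun w => Z w 0 j).
Hypothesis uZ : independent_pair P u (fun w => [tuple Z w 0 j | j < d]).

Let cerr w := sqn (r^-1 *: C (u w) (Z w) - Z w).

Let mZ j : measurable_fun setT (fun w => Z w 0 j). Proof. by have [] := LZ j. Qed.

(** The contraction bound concerns deterministic inputs. Since [u] is independent of [Z], it can be
    applied under the integral over the law of [u], with [Z] frozen. *)
Let cerr_le : (\int[P]_w (cerr w)%:E <= ((1 - phi) * Ex P (fun w => sqn (Z w)))%:E)%E.
Proof.
pose Zt : {mfun Omega >-> (d.-tuple R)%type} :=
  HB.pack (fun w => [tuple Z w 0 j | j < d])
    (isMeasurableFun.Build _ _ _ _ _ (measurable_row_tuple mZ)).
have ZtE w : \row_l tnth (Zt w) l = Z w.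
  by apply/rowP => l; rewrite mxE tnth_mktuple.
have iZ : int1 P (fun w => sqn (Z w)) by apply: int1_sqn => i j; rewrite (ord1 i).
have -> : (\int[P]_w (cerr w)%:E = \int[P]_w (EFin \o err) (u w, Zt w))%E.
  by apply: eq_integral => w _; rewrite /= /err ZtE.
rewrite ge0_integral_independent//; last 2 first.
- exact/measurable_EFinP.
- by move=> z; rewrite lee_fin sqn_ge0.
rewrite -ExZ// -int1_Ex; last exact: int1Z.
rewrite unlock.
have Qle w : (\int[distribution P u]_s (EFin \o err) (s, Zt w) <=
              ((1 - phi) * sqn (Z w))%:E)%E.
  have := C_contr (Z w); rewrite unlock enorm_sqn; apply: le_trans.
  rewrite le_eqVlt; apply/orP; left; apply/eqP.
  transitivity (\int[Q]_s (EFin \o err) (s, Zt w))%E.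
    by apply: eq_measure_integral => A mA _; exact: u_law.
  by apply: eq_integral => s _; rewrite /= /err ZtE enorm_sqn.
apply: ge0_le_integral => //.
- by move=> w _; apply: integral_ge0 => s _; rewrite lee_fin sqn_ge0.
- have := @measurable_fun_fubini_tonelli_G _ _ _ _ _ (distribution P u) (EFin \o err).
  move=> /(_ _ _)/measurableT_comp; apply => //.
  exact/measurable_EFinP.
- by move=> z; rewrite lee_fin sqn_ge0.
- by apply: measurable_int (int1Z _ iZ).
Qed.

Lemma compressor_error :
  int1 P cerr /\ Ex P cerr <= (1 - phi) * Ex P (fun w => sqn (Z w)).
Proof.
have mcerr : measurable_fun setT cerr.
  apply: measurable_sum => i; apply: measurable_sum => j.
  apply: measurable_funX; rewrite (ord1 i); under eq_fun do rewrite !mxE.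
  apply: measurable_funB => //; apply: measurable_funM => //.
  exact: measurable_compress.
have ic : int1 P cerr.
  apply/integrableP; split; first exact/measurable_EFinP.
  under eq_integral do rewrite /= ger0_norm ?sqn_ge0//.
  by rewrite (le_lt_trans cerr_le)// ltry.
split=> //; rewrite -lee_fin -int1_Ex// unlock.
exact: cerr_le.
Qed.

End Compressor.

(** * Moments along the trajectory *)

Section VectorClass.
Context {R : realType} {T : Type}.

(** Instantiated with measurability for several sigma-algebras and with square integrability, so
    that stability under one iteration is proved once. *)
Definition linear_class (Phi : (T -> R) -> Prop) :=
  [/\ forall X Y, Phi X -> Phi Y -> Phi (fun w => X w + Y w),
      forall c X, Phi X -> Phi (fun w => c * X w) &
      Phi (fun=> 0)].

Variable Phi : (T -> R) -> Prop.
Hypothesis PhiL : linear_class Phi.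

Definition entries m d (V : T -> 'M[R]_(m, d)) := forall i j, Phi (fun w => V w i j).

Context {m d : nat}.
Implicit Types V : T -> 'M[R]_(m, d).

Lemma entriesD U V : entries U -> entries V -> entries (fun w => U w + V w).
Proof.
by move=> PU PV i j; have [D _ _] := PhiL; under eq_fun do rewrite mxE; exact: D.
Qed.

Lemma entriesZ c V : entries V -> entries (fun w => c *: V w).
Proof.
by move=> PV i j; have [_ Z _] := PhiL; under eq_fun do rewrite mxE; exact: Z.
Qed.

Lemma entriesB U V : entries U -> entries V -> entries (fun w => U w - V w).
Proof.
move=> PU PV; apply: entriesD => //.
by have := entriesZ (-1) PV; under eq_fun do rewrite scaleN1r.
Qed.

Lemma entries_sum (I : Type) (s : seq I) (V : I -> T -> 'M[R]_(m, d)) :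
  (forall i, entries (V i)) -> entries (fun w => \sum_(i <- s) V i w).
Proof.
move=> PV; elim: s => [|k s ih].
  under eq_fun do rewrite big_nil; move=> i j; under eq_fun do rewrite mxE.
  by have [] := PhiL.
by under eq_fun do rewrite big_cons; exact: entriesD.
Qed.

End VectorClass.

Section StateClass.
Context {R : realType} {n d : nat} {T S : Type}.
Variables (f : 'I_n -> 'rV[R]_d -> R) (W : 'M[R]_n) (C : S -> 'rV[R]_d -> 'rV[R]_d).
Variables (eta gamma alpha_x alpha_y : R).

(* For each agent, [zx] is the compressor input x^a - x^c, [qx] the compressed
   message C(x^a - x^c) and [err_x] the relative error C(z)/r - z; similarly for y. *)
Definition zx (v : pgtc_input R n d S) (s : pgtc_state R n d) i :=
  st_x s i + in_xi_x v i - st_xc s i.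
Definition zy (v : pgtc_input R n d S) (s : pgtc_state R n d) i :=
  st_y s i + in_xi_y v i - st_yc s i.
Definition qx v s i := C (in_u_x v i) (zx v s i).
Definition qy v s i := C (in_u_y v i) (zy v s i).
Definition err_x (r : R) v s i := r^-1 *: qx v s i - zx v s i.
Definition err_y (r : R) v s i := r^-1 *: qy v s i - zy v s i.

Variable Phi : (T -> R) -> Prop.
Hypothesis PhiL : linear_class Phi.

Definition state_class (s : T -> pgtc_state R n d) := forall i,
  [/\ entries Phi (fun w => st_x (s w) i), entries Phi (fun w => st_y (s w) i),
      entries Phi (fun w => st_xc (s w) i) & entries Phi (fun w => st_yc (s w) i)].

Definition noise_class (v : T -> pgtc_input R n d S) := forall i,
  entries Phi (fun w => in_xi_x (v w) i) /\ entries Phi (fun w => in_xi_y (v w) i).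

Variables (s : T -> pgtc_state R n d) (v : T -> pgtc_input R n d S).
Hypotheses (s_class : state_class s) (v_class : noise_class v).

Lemma zx_class i : entries Phi (fun w => zx (v w) (s w) i).
Proof.
have [sx _ sxc _] := s_class i; have [nx _] := v_class i.
by apply: entriesB => //; exact: entriesD.
Qed.

Lemma zy_class i : entries Phi (fun w => zy (v w) (s w) i).
Proof.
have [_ sy _ syc] := s_class i; have [_ ny] := v_class i.
by apply: entriesB => //; exact: entriesD.
Qed.

Let s' w := pgtc_step f W C eta gamma alpha_x alpha_y (v w) (s w).

Hypothesis C_class : forall i, entries Phi (fun w => qx (v w) (s w) i) /\
                               entries Phi (fun w => qy (v w) (s w) i).
Hypothesis grad_class : forall i X, entries Phi X ->
  entries Phi (fun w => gradient (f i) (X w)).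

Lemma step_class : state_class s'.
Proof.
have xh i : entries Phi (fun w => st_xc (s w) i + qx (v w) (s w) i).
  have [_ _ sxc _] := s_class i; have [q _] := C_class i.
  exact: entriesD.
have yh i : entries Phi (fun w => st_yc (s w) i + qy (v w) (s w) i).
  have [_ _ _ syc] := s_class i; have [_ q] := C_class i.
  exact: entriesD.
have x' i : entries Phi (fun w => st_x (s' w) i).
  have [sx sy sxc syc] := s_class i; have [nx ny] := v_class i.
  apply: entriesB => //; last exact: entriesZ.
  apply: entriesD => //; first exact: entriesD.
  apply: entriesZ => //; apply: entries_sum => // k; apply: entriesZ => //.
  by apply: entriesB => //; exact: xh.
move=> i; have [sx sy sxc syc] := s_class i; have [nx ny] := v_class i.
split=> //.
- apply: entriesB => //; last exact: grad_class.
  apply: entriesD => //; last by apply: grad_class; exact: x'.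
  apply: entriesD => //; first exact: entriesD.
  apply: entriesZ => //; apply: entries_sum => // k; apply: entriesZ => //.
  by apply: entriesB => //; exact: yh.
- by apply: entriesD => //; apply: entriesZ => //; exact: xh.
- by apply: entriesD => //; apply: entriesZ => //; exact: yh.
Qed.

End StateClass.

Section Trajectory.
Context {R : realType} {n d : nat} {L : R} {dS : measure_display}
  {S : measurableType dS}.
Variables (f : 'I_n -> 'rV[R]_d -> R) (W : 'M[R]_n) (C : S -> 'rV[R]_d -> 'rV[R]_d).
Variables (eta gamma alpha_x alpha_y : R) (x0 : 'I_n -> 'rV[R]_d).
Hypotheses (L_gt0 : 0 < L) (f_smooth : forall i, smooth L (f i)).
Hypothesis C_meas : measurable_compressor C.

Lemma measurable_linear_class dT (T : measurableType dT) :
  linear_class (fun X : T -> R => measurable_fun setT X).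
Proof.
split=> [X Y mX mY|c X mX|]; [exact: measurable_funD|exact: measurable_funM|].
exact: measurable_cst.
Qed.

(** Only draws of iterations [t < k] are assumed measurable. Over the sigma-algebra generated by all
    sources but one, this expresses that the state at [k] ignores a current or future source. *)
Lemma measurable_trajectory dT (T : measurableType dT)
    (xi_x xi_y : nat -> 'I_n -> 'I_d -> T -> R) (u_x u_y : nat -> 'I_n -> T -> S) k :
  (forall t i j, (t < k)%N -> measurable_fun setT (xi_x t i j) /\
                              measurable_fun setT (xi_y t i j)) ->
  (forall t i, (t < k)%N -> measurable_fun setT (u_x t i) /\
                            measurable_fun setT (u_y t i)) ->
  state_class (fun X : T -> R => measurable_fun setT X)
    (fun w => pgtc f W C eta gamma alpha_x alpha_y x0 (inputs_at xi_x xi_y u_x u_y w) k).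
Proof.
elim: k => [|k ih] mxi mu /=.
  by move=> i; split=> l j; exact: measurable_cst.
have {ih} ih := ih (fun t i j tk => mxi t i j (ltnW tk)) (fun t i tk => mu t i (ltnW tk)).
have mL := measurable_linear_class T.
have mnoise : noise_class (fun X : T -> R => measurable_fun setT X)
    (fun w => inputs_at xi_x xi_y u_x u_y w k).
  move=> i; have := fun j => mxi k i j (ltnSn k).
  by move=> mxik; split=> l j; under eq_fun do rewrite mxE; have [] := mxik j.
apply: step_class => //.
  move=> i; have [mux muy] := mu k i (ltnSn k); split=> l j; rewrite (ord1 l).
    apply: measurable_compress => // j'.
    exact: (zx_class mL ih mnoise).
  apply: measurable_compress => // j'.
  exact: (zy_class mL ih mnoise).
move=> i X mX l j; rewrite (ord1 l).
by apply: (measurable_gradient _ L_gt0 (f_smooth i)) => j'; exact: mX.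
Qed.

End Trajectory.

Section CenteredProduct.
Context {R : realType} {dO : measure_display} {Omega : measurableType dO}.
Variables (P : probability Omega R) (X : {RV P >-> R}) (Y : Omega -> R).

(* Only nonnegative integrands are handled by [ge0_integral_independent], so
   E[XY] is extracted from E[(X + Y)^2]. *)
Lemma Ex_mul_independent0 : L2 P X -> L2 P Y -> Ex P X = 0 ->
  independent_pair P X Y -> Ex P (fun w => Y w * X w) = 0.
Proof.
move=> LX LY X0 XY; have [mY iY] := LY; have [mX iX] := LX.
pose Y' : {RV P >-> R} := HB.pack Y (isMeasurableFun.Build _ _ _ _ _ mY).
have iXY := L2M_int1 LY LX.
have iX1 := L2_int1 LX.
have E1 : Ex P (fun w => (X w + Y w) ^+ 2) =
    Ex P (fun w => X w ^+ 2) + Ex P (fun w => Y w ^+ 2).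
  rewrite -ExD// [LHS]/Ex [RHS]/Ex unlock; congr fine.
  pose h (p : R * R) := ((p.1 + p.2) ^+ 2)%:E.
  have mh : measurable_fun setT h.
    by apply/measurable_EFinP; apply: measurable_funX; exact: measurable_funD.
  transitivity (\int[P]_w h (X w, Y' w))%E; first by [].
  rewrite ge0_integral_independent//; last first.
    by move=> z; rewrite lee_fin sqr_ge0.
  (* [X] being centered, the cross term [2 y X] integrates to [0]. *)
  have inner y : (\int[distribution P X]_u h (u, y) =
                  (Ex P (fun w => X w ^+ 2) + y ^+ 2)%:E)%E.
    have mhy : measurable_fun setT (fun u => h (u, y)).
      apply/measurable_EFinP; apply: measurable_funX.
      by apply: measurable_funD => //; exact: measurable_id.
    have hy0 u : (0 <= h (u, y))%E by rewrite lee_fin sqr_ge0.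
    rewrite (@ge0_integral_distribution _ _ _ _ _ P X _ mhy hy0).
    have i2 : int1 P (fun w => 2 * y * X w + y ^+ 2).
      by apply: int1D; [exact: int1Z|exact: int1_cst].
    have i3 := int1D iX i2.
    have -> : Ex P (fun w => X w ^+ 2) + y ^+ 2 =
        Ex P (fun w => X w ^+ 2 + (2 * y * X w + y ^+ 2)).
      rewrite ExD// ExD; [|exact: int1Z|exact: int1_cst].
      by rewrite ExZ// X0 mulr0 add0r Ex_cst.
    rewrite -int1_Ex// unlock; apply: eq_integral => w _ /=.
    by congr EFin; rewrite /h /=; ring.
  under eq_integral do rewrite inner.
  have iEY : int1 P (fun w => Ex P (fun w => X w ^+ 2) + Y w ^+ 2).
    by apply: int1D => //; exact: int1_cst.
  have := int1_Ex iEY; rewrite unlock => ->.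
  rewrite ExD//; last exact: int1_cst.
  rewrite Ex_cst -ExD//; have := int1_Ex (int1D iX iY); rewrite unlock => ->.
  by [].
have : Ex P (fun w => (X w + Y w) ^+ 2) =
    Ex P (fun w => X w ^+ 2) + Ex P (fun w => Y w ^+ 2) + 2 * Ex P (fun w => Y w * X w).
  rewrite -ExZ// -ExD// -ExD//; [|exact: int1D|exact: int1Z].
  by congr Ex; apply/funext => w; ring.
by rewrite E1; lra.
Qed.

End CenteredProduct.

Section EventsOf.
Context {R : realType} {dO dS : measure_display} {Omega : measurableType dO}
  {S : measurableType dS} {n d : nat}.

Lemma events_of_setT d' (U : measurableType d') (X : Omega -> U) : events_of X setT.
Proof. by exists setT => //; rewrite preimage_setT setTI. Qed.

Lemma events_of_setI d' (U : measurableType d') (X : Omega -> U) :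
  setI_closed (events_of X).
Proof.
move=> _ _ [A mA <-] [B mB <-]; exists (A `&` B); first exact: measurableI.
by rewrite preimage_setI !setTI.
Qed.

Lemma events_of_measurable d' (U : measurableType d') (X : Omega -> U) A :
  measurable_fun setT X -> events_of X A -> measurable A.
Proof. by move=> mX [B mB <-]; exact: mX. Qed.

Variables (xi_x xi_y : nat -> 'I_n -> 'I_d -> Omega -> R)
  (u_x u_y : nat -> 'I_n -> Omega -> S).
Local Notation F := (source_events xi_x xi_y u_x u_y).

Lemma source_events_setT a : F a setT.
Proof. by case: a => [[[[k i] j]|[[k i] j]]|[[k i]|[k i]]]; exact: events_of_setT. Qed.

Lemma source_events_setI a : setI_closed (F a).
Proof. by case: a => [[[[k i] j]|[[k i] j]]|[[k i]|[k i]]]; exact: events_of_setI. Qed.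

Hypothesis mxi : forall k i j, measurable_fun setT (xi_x k i j) /\
                               measurable_fun setT (xi_y k i j).
Hypothesis mu : forall k i, measurable_fun setT (u_x k i) /\
                            measurable_fun setT (u_y k i).

Lemma source_events_measurable a A : F a A -> measurable A.
Proof.
case: a => [[[[k i] j]|[[k i] j]]|[[k i]|[k i]]]; apply: events_of_measurable.
- by have [] := mxi k i j.
- by have [] := mxi k i j.
- by have [] := mu k i.
- by have [] := mu k i.
Qed.

Variable P : probability Omega R.
Hypothesis indep : mutually_independent P F.

(** Not only the past sources: the same family then serves for compressor draws, for noise against
    gradients and for noises of distinct iterations. *)
Definition others (a : source n d) : set (source n d) := [set b | b <> a].

Lemma independent_of_others a d1 d2 (S1 : measurableType d1)
    (S2 : measurableType d2) (X : Omega -> S1) (Y : Omega -> S2) :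
  F a = events_of X ->
  measurable_fun setT (Y : generated F (others a) -> S2) -> independent_pair P X Y.
Proof.
move=> FX mY.
apply: (@independent_source _ _ _ P _ F source_events_setT source_events_setI
  source_events_measurable indep (others a) a) => //.
Qed.

Lemma others_xi_x a k i j : a <> inl (inl (k, i, j)) ->
  measurable_fun setT (xi_x k i j : generated F (others a) -> R).
Proof. by move=> ak; apply: (sub_generated (a := inl (inl (k, i, j)))) => // /esym. Qed.

Lemma others_xi_y a k i j : a <> inl (inr (k, i, j)) ->
  measurable_fun setT (xi_y k i j : generated F (others a) -> R).
Proof. by move=> ak; apply: (sub_generated (a := inl (inr (k, i, j)))) => // /esym. Qed.

Lemma others_u_x a k i : a <> inr (inl (k, i)) ->
  measurable_fun setT (u_x k i : generated F (others a) -> S).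
Proof. by move=> ak; apply: (sub_generated (a := inr (inl (k, i)))) => // /esym. Qed.

Lemma others_u_y a k i : a <> inr (inr (k, i)) ->
  measurable_fun setT (u_y k i : generated F (others a) -> S).
Proof. by move=> ak; apply: (sub_generated (a := inr (inr (k, i)))) => // /esym. Qed.

End EventsOf.

Lemma entries_mean (R : realType) (T : Type) (Phi : (T -> R) -> Prop) n d
    (V : T -> 'I_n -> 'rV[R]_d) : linear_class Phi ->
  (forall i, entries Phi (fun w => V w i)) -> entries Phi (fun w => mean (V w)).
Proof. by move=> PhiL PV; apply: (entriesZ PhiL); exact: (entries_sum PhiL). Qed.

(** * Square integrability and moments of states and noises *)

Section Moments.
Context {R : realType} {n d : nat} {L : R} {dS : measure_display}
  {S : measurableType dS}.
Variables (f : 'I_n -> 'rV[R]_d -> R) (W : 'M[R]_n) (Q : probability S R)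
  (C : S -> 'rV[R]_d -> 'rV[R]_d) (r phi : R).
Hypotheses (n_gt0 : (0 < n)%N) (L_gt0 : 0 < L) (f_smooth : forall i, smooth L (f i))
  (C_meas : measurable_compressor C) (r_gt0 : 0 < r)
  (C_contr : contractive_compressor Q C r phi).
Context {dO : measure_display} {Omega : measurableType dO}.
Variables (P : probability Omega R) (s_x s_y q : 'I_n -> R).
Hypotheses (s_x_gt0 : forall i, 0 < s_x i) (s_y_gt0 : forall i, 0 < s_y i)
  (q_range : forall i, 0 < q i < 1).
Variables (xi_x xi_y : nat -> 'I_n -> 'I_d -> {RV P >-> R})
  (u_x u_y : nat -> 'I_n -> {mfun Omega >-> S}).
Hypotheses
  (xi_x_law : forall k i j, laplace_distributed (xi_x k i j) (s_x i * q i ^+ k))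
  (xi_y_law : forall k i j, laplace_distributed (xi_y k i j) (s_y i * q i ^+ k))
  (u_x_law : forall k i A, measurable A -> distribution P (u_x k i) A = Q A)
  (u_y_law : forall k i A, measurable A -> distribution P (u_y k i) A = Q A)
  (indep : mutually_independent P (source_events xi_x xi_y u_x u_y)).
Variables (x0 : 'I_n -> 'rV[R]_d) (eta gamma alpha_x alpha_y : R).

Local Notation w := (inputs_at xi_x xi_y u_x u_y).
Local Notation st omega := (pgtc f W C eta gamma alpha_x alpha_y x0 (w omega)).
Local Notation F := (source_events xi_x xi_y u_x u_y).

Let mxi k i j : measurable_fun setT (xi_x k i j) /\ measurable_fun setT (xi_y k i j).
Proof. by split; exact: measurable_funPT. Qed.

Let mu k i : measurable_fun setT (u_x k i) /\ measurable_fun setT (u_y k i).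
Proof. by split; exact: measurable_funPT. Qed.

Let theta_gt0 (s : 'I_n -> R) k i : (forall i, 0 < s i) -> 0 < s i * q i ^+ k.
Proof.
by move=> s0; have /andP[q0 _] := q_range i; rewrite mulr_gt0// exprn_gt0.
Qed.

Let Lxi k i j : L2 P (xi_x k i j) /\ L2 P (xi_y k i j).
Proof.
by split; [exact: laplace_L2 (theta_gt0 k i s_x_gt0) (xi_x_law k i j)
          |exact: laplace_L2 (theta_gt0 k i s_y_gt0) (xi_y_law k i j)].
Qed.

Let Exi k i j : Ex P (xi_x k i j) = 0 /\ Ex P (xi_y k i j) = 0.
Proof.
by split; [exact: laplace_Ex (theta_gt0 k i s_x_gt0) (xi_x_law k i j)
          |exact: laplace_Ex (theta_gt0 k i s_y_gt0) (xi_y_law k i j)].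
Qed.

Let indep_others a := @independent_of_others _ _ _ _ _ _ _ _ _ _ _ mxi mu P indep a.

(* At iteration [k] the state only depends on the sources of earlier
   iterations. *)
Let trajectory_others a k :
  (forall t i j, (t < k)%N -> a <> inl (inl (t, i, j)) /\ a <> inl (inr (t, i, j))) ->
  (forall t i, (t < k)%N -> a <> inr (inl (t, i)) /\ a <> inr (inr (t, i))) ->
  state_class (fun X : generated F (others a) -> R => measurable_fun setT X)
    (fun omega => st omega k).
Proof.
move=> a1 a2.
apply: (measurable_trajectory W eta gamma alpha_x alpha_y x0 L_gt0 f_smooth
  C_meas (T := generated F (others a))).
- move=> t i j tk; have [b1 b2] := a1 t i j tk.
  by split; [exact: others_xi_x|exact: others_xi_y].
- move=> t i tk; have [b1 b2] := a2 t i tk.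
  by split; [exact: others_u_x|exact: others_u_y].
Qed.

Let past_neq (t k : nat) : (t < k)%N -> k <> t.
Proof. by move=> tk kt; rewrite kt ltnn in tk. Qed.

(** The compressor input at iteration [k] is built from past sources and the current noises, but not
    from the current draw. *)
Let z_independent k i :
  independent_pair P (u_x k i)
    (fun omega => [tuple zx (w omega k) (st omega k) i 0 j | j < d]) /\
  independent_pair P (u_y k i)
    (fun omega => [tuple zy (w omega k) (st omega k) i 0 j | j < d]).
Proof.
have mnoise a : (forall i j, a <> inl (inl (k, i, j)) /\ a <> inl (inr (k, i, j))) ->
    noise_class (fun X : generated F (others a) -> R => measurable_fun setT X)
      (fun omega => w omega k).
  move=> ak i'; split=> l j; have [b1 b2] := ak i' j.
    rewrite (_ : (fun omega => _) = xi_x k i' j); first exact: others_xi_x.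
    by apply/funext => omega; rewrite mxE.
  rewrite (_ : (fun omega => _) = xi_y k i' j); first exact: others_xi_y.
  by apply/funext => omega; rewrite mxE.
split.
- apply: (indep_others (a := inr (inl (k, i)))) => //.
  apply: measurable_row_tuple => j.
  apply: (zx_class (measurable_linear_class (generated F (others _)))) => //.
    by apply: trajectory_others => // t i' tk; split=> // -[] /(past_neq tk).
  exact: mnoise.
- apply: (indep_others (a := inr (inr (k, i)))) => //.
  apply: measurable_row_tuple => j.
  apply: (zy_class (measurable_linear_class (generated F (others _)))) => //.
    by apply: trajectory_others => // t i' tk; split=> // -[] /(past_neq tk).
  exact: mnoise.
Qed.

Lemma L2_linear_class : linear_class (L2 P).
Proof. by split=> [X Y|c X|]; [exact: L2D|exact: L2Z|exact: L2_cst]. Qed.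

Lemma L2_gradient i (X : Omega -> 'rV[R]_d) : entries (L2 P) X ->
  entries (L2 P) (fun omega => gradient (f i) (X omega)).
Proof.
move=> LX l j; rewrite (ord1 l).
apply: (@le_L2 _ _ _ _ _ (fun omega =>
  2 * (L ^+ 2 * sqn (X omega)) + 2 * gradient (f i) 0 0 j ^+ 2)).
- by apply: (measurable_gradient _ L_gt0 (f_smooth i)) => k; have [] := LX 0 k.
- move=> omega; have := smooth_sqn (X omega) 0 L_gt0 (f_smooth i); rewrite subr0.
  have : (gradient (f i) (X omega) 0 j - gradient (f i) 0 0 j) ^+ 2 <=
      sqn (gradient (f i) (X omega) - gradient (f i) 0).
    rewrite /sqn big_ord1 (bigD1 j)//= !mxE lerDl sumr_ge0// => k _.
    exact: sqr_ge0.
  set A := gradient _ _ 0 j; set B := gradient _ _ 0 j => h1 h2.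
  (* Nonnegativity of this square is exactly [A^2 <= 2 (A - B)^2 + 2 B^2]. *)
  by have := sqr_ge0 (A - 2 * B); nra.
- apply: int1D; last exact: int1_cst.
  by apply/int1Z/int1Z; apply: int1_sqn.
Qed.

(** [C z] is recovered as [r (C z / r - z) + r z], where the relative error is square integrable by
    [compressor_error]. *)
Let compressed_L2 (u : {mfun Omega >-> S}) (Z : Omega -> 'rV[R]_d) :
  (forall A, measurable A -> distribution P u A = Q A) ->
  entries (L2 P) Z ->
  independent_pair P u (fun omega => [tuple Z omega 0 j | j < d]) ->
  entries (L2 P) (fun omega => C (u omega) (Z omega)).
Proof.
move=> uQ LZ uZ.
have [ie _] := compressor_error C_meas C_contr uQ (fun j => LZ 0 j) uZ.
have LE : entries (L2 P) (fun omega => r^-1 *: C (u omega) (Z omega) - Z omega).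
  move=> l j; rewrite (ord1 l); apply: le_L2 ie => [|omega].
    under eq_fun do rewrite !mxE.
    apply: measurable_funB; last by have [] := LZ 0 j.
    apply: measurable_funM => //; apply: measurable_compress => // k.
    by have [] := LZ 0 k.
  rewrite /sqn big_ord1 (bigD1 j)//= lerDl sumr_ge0// => k _.
  exact: sqr_ge0.
have := entriesD L2_linear_class (entriesZ L2_linear_class r LE)
  (entriesZ L2_linear_class r LZ).
under eq_fun do rewrite scalerBr subrK scalerA mulfV ?lt0r_neq0// scale1r.
by [].
Qed.

Lemma L2_noise k : noise_class (L2 P) (fun omega => w omega k).
Proof.
by move=> i; split=> l j; under eq_fun do rewrite mxE; have [] := Lxi k i j.
Qed.

Lemma L2_trajectory k : state_class (L2 P) (fun omega => st omega k).
Proof.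
elim: k => [|k ih]; first by move=> i; split=> l j; exact: L2_cst.
apply: (@step_class R n d Omega S f W C eta gamma alpha_x alpha_y (L2 P)
  L2_linear_class _ _ ih (L2_noise k)).
  move=> i; have [ix iy] := z_independent k i; split.
  - apply: compressed_L2 => //; first exact: u_x_law.
    exact: (zx_class L2_linear_class ih (L2_noise k)).
  - apply: compressed_L2 => //; first exact: u_y_law.
    exact: (zy_class L2_linear_class ih (L2_noise k)).
exact: L2_gradient.
Qed.

Lemma L2_zx k i : entries (L2 P) (fun omega => zx (w omega k) (st omega k) i).
Proof. exact: (zx_class L2_linear_class (L2_trajectory k) (L2_noise k)). Qed.

Lemma L2_zy k i : entries (L2 P) (fun omega => zy (w omega k) (st omega k) i).
Proof. exact: (zy_class L2_linear_class (L2_trajectory k) (L2_noise k)). Qed.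

Lemma Ex_sqn_stack (V : Omega -> 'I_n -> 'rV[R]_d) :
  (forall i, int1 P (fun omega => sqn (V omega i))) ->
  int1 P (fun omega => sqn (stack (V omega))) /\
  Ex P (fun omega => sqn (stack (V omega))) =
    \sum_i Ex P (fun omega => sqn (V omega i)).
Proof.
move=> iV; under eq_fun do rewrite sqn_stack; split; first exact: int1_sum.
exact: Ex_sum.
Qed.

Lemma Ex_err_x k :
  int1 P (fun omega => sqn (stack (err_x C r (w omega k) (st omega k)))) /\
  Ex P (fun omega => sqn (stack (err_x C r (w omega k) (st omega k)))) <=
  (1 - phi) * Ex P (fun omega => sqn (stack (zx (w omega k) (st omega k)))).
Proof.
have ce i := compressor_error C_meas C_contr (u_x_law k i)
  (fun j => L2_zx k i 0 j) (proj1 (z_independent k i)).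
have [|i1 E1] := @Ex_sqn_stack (fun omega => err_x C r (w omega k) (st omega k)).
  by move=> i; have [] := ce i.
have [|i2 E2] := @Ex_sqn_stack (fun omega => zx (w omega k) (st omega k)).
  by move=> i; apply: int1_sqn; exact: L2_zx.
split=> //; rewrite E1 E2 mulr_sumr; apply: ler_sum => i _.
by have [] := ce i.
Qed.

Lemma Ex_err_y k :
  int1 P (fun omega => sqn (stack (err_y C r (w omega k) (st omega k)))) /\
  Ex P (fun omega => sqn (stack (err_y C r (w omega k) (st omega k)))) <=
  (1 - phi) * Ex P (fun omega => sqn (stack (zy (w omega k) (st omega k)))).
Proof.
have ce i := compressor_error C_meas C_contr (u_y_law k i)
  (fun j => L2_zy k i 0 j) (proj2 (z_independent k i)).
have [|i1 E1] := @Ex_sqn_stack (fun omega => err_y C r (w omega k) (st omega k)).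
  by move=> i; have [] := ce i.
have [|i2 E2] := @Ex_sqn_stack (fun omega => zy (w omega k) (st omega k)).
  by move=> i; apply: int1_sqn; exact: L2_zy.
split=> //; rewrite E1 E2 mulr_sumr; apply: ler_sum => i _.
by have [] := ce i.
Qed.

Lemma L2_mean_x k : entries (L2 P) (fun omega => mean (st_x (st omega k))).
Proof. by apply: (entries_mean L2_linear_class) => i; have [] := L2_trajectory k i. Qed.

Lemma L2_grad_mean k :
  entries (L2 P) (fun omega => gradient (average f) (mean (st_x (st omega k)))).
Proof.
under eq_fun do rewrite (gradient_averageE f_smooth).
by apply: (entries_mean L2_linear_class) => i; apply: L2_gradient; exact: L2_mean_x.
Qed.

Lemma Ex_grad_noise k :
  int1 P (fun omega => dotm (gradient (average f) (mean (st_x (st omega k))))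
                            (mean (in_xi_x (w omega k)))) /\
  Ex P (fun omega => dotm (gradient (average f) (mean (st_x (st omega k))))
                          (mean (in_xi_x (w omega k)))) = 0.
Proof.
pose g omega := gradient (average f) (mean (st_x (st omega k))).
have meanE (v : 'I_n -> 'rV[R]_d) j : mean v 0 j = n%:R^-1 * \sum_i v i 0 j.
  by rewrite mxE summxE.
have gE omega : dotm (g omega) (mean (in_xi_x (w omega k))) =
    \sum_j \sum_i n%:R^-1 * (g omega 0 j * xi_x k i j omega).
  rewrite /dotm big_ord1; apply: eq_bigr => j _.
  rewrite meanE mulrCA !mulr_sumr; apply: eq_bigr => i _.
  by congr (_ * (_ * _)); rewrite mxE.
rewrite -/g; under eq_fun do rewrite gE.
have ig i j : int1 P (fun omega => g omega 0 j * xi_x k i j omega).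
  by apply: L2M_int1; [exact: L2_grad_mean|have [] := Lxi k i j].
split; first by do 2 (apply: int1_sum => ?); exact: int1Z.
rewrite Ex_sum => [|j]; last by apply: int1_sum => ?; exact: int1Z.
rewrite big1// => j _; rewrite Ex_sum => [|i]; last exact: int1Z.
rewrite big1// => i _; rewrite ExZ// Ex_mul_independent0 ?mulr0//.
- by have [] := Lxi k i j.
- exact: L2_grad_mean.
- by have [] := Exi k i j.
- apply: (indep_others (a := inl (inl (k, i, j)))) => //.
  pose a : source n d := inl (inl (k, i, j)).
  have mL := @measurable_linear_class R _ (generated F (others a)).
  have mx : state_class (fun X : generated F (others a) -> R => measurable_fun setT X)
      (fun omega => st omega k).
    by apply: trajectory_others => // t i1 j1 tk; split=> // -[] /(past_neq tk).
  have mmean : entries (fun X : generated F (others a) -> R => measurable_fun setT X)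
      (fun omega => mean (st_x (st omega k))).
    by apply: (entries_mean mL) => i'; have [] := mx i'.
  apply: (measurable_gradient (T := generated F (others a)) _ L_gt0
    (smooth_average n_gt0 L_gt0 f_smooth)) => j'.
  exact: mmean.
Qed.

Local Notation qb := (q_bar q).
Local Notation sb := (s_bar s_x s_y).

Lemma q_bar_range : 0 < qb < 1.
Proof.
pose i0 := Ordinal n_gt0; have /andP[q0 _] := q_range i0; apply/andP; split.
  by apply: (lt_le_trans q0); exact: le_bigmax.
by apply: bigmax_lt => // i _; have /andP[] := q_range i.
Qed.

Lemma s_bar_ge i : s_x i <= sb /\ s_y i <= sb.
Proof.
have : Num.max (s_x i) (s_y i) <= sb
  by exact: (le_bigmax 0 (fun i => Num.max (s_x i) (s_y i)) i).
by rewrite ge_max => /andP.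
Qed.

Let noise_moment (xi : 'I_n -> 'I_d -> {RV P >-> R}) (s : 'I_n -> R) k :
  (forall i, 0 < s i <= sb) ->
  (forall i j, laplace_distributed (xi i j) (s i * q i ^+ k)) ->
  int1 P (fun omega => sqn (stack (fun i => \row_j xi i j omega))) /\
  Ex P (fun omega => sqn (stack (fun i => \row_j xi i j omega))) <=
    2 * n%:R * d%:R * (qb ^+ (2 * k) * sb ^+ 2).
Proof.
move=> s_range laws.
have [q0 q1] := andP q_bar_range.
have s0 i : 0 < s i by have /andP[] := s_range i.
have Lx i j := laplace_L2 (theta_gt0 k i s0) (laws i j).
have sqnE omega : sqn (stack (fun i => \row_j xi i j omega)) =
    \sum_i \sum_j xi i j omega ^+ 2.
  by apply: eq_bigr => i _; apply: eq_bigr => j _; rewrite !mxE.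
under eq_fun do rewrite sqnE.
have i2 i : int1 P (fun omega => \sum_j xi i j omega ^+ 2).
  by apply: int1_sum => j; have [] := Lx i j.
split; first exact: int1_sum.
rewrite Ex_sum//.
have -> : 2 * n%:R * d%:R * (qb ^+ (2 * k) * sb ^+ 2) =
    \sum_(i < n) \sum_(j < d) 2 * (sb * qb ^+ k) ^+ 2.
  rewrite !sumr_const !card_ord -mulrnA -[RHS]mulr_natl natrM [(2 * k)%N]mulnC exprM.
  by ring.
apply: ler_sum => i _; rewrite Ex_sum => [|j]; last by have [] := Lx i j.
apply: ler_sum => j _; rewrite (laplace_Ex_sqr (theta_gt0 k i s0) (laws i j)).
have /andP[_ sle] := s_range i; have /andP[qi0 _] := q_range i.
rewrite ler_pM2l// lerXn2r ?nnegrE ?mulr_ge0 ?exprn_ge0 ?(ltW q0) ?(ltW qi0) ?(ltW (s0 i))//.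
  by rewrite (le_trans _ sle)// ltW.
apply: ler_pM; rewrite ?exprn_ge0 ?(ltW qi0) ?(ltW (s0 i))//.
by rewrite lerXn2r ?nnegrE ?(ltW q0) ?(ltW qi0)//; exact: le_bigmax.
Qed.

Lemma Ex_noise_x k :
  int1 P (fun omega => sqn (stack (in_xi_x (w omega k)))) /\
  Ex P (fun omega => sqn (stack (in_xi_x (w omega k)))) <=
    2 * n%:R * d%:R * (qb ^+ (2 * k) * sb ^+ 2).
Proof.
apply: (@noise_moment (xi_x k) s_x) => // i.
by rewrite s_x_gt0; have [] := s_bar_ge i.
Qed.

Lemma Ex_noise_y k :
  int1 P (fun omega => sqn (stack (in_xi_y (w omega k)))) /\
  Ex P (fun omega => sqn (stack (in_xi_y (w omega k)))) <=
    2 * n%:R * d%:R * (qb ^+ (2 * k) * sb ^+ 2).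
Proof.
apply: (@noise_moment (xi_y k) s_y) => // i.
by rewrite s_y_gt0; have [] := s_bar_ge i.
Qed.

Local Notation noise_y t := (fun omega => stack (in_xi_y (w omega t))).

Lemma L2_noise_y t : entries (L2 P) (noise_y t).
Proof. by move=> i j; under eq_fun do rewrite !mxE; have [] := Lxi t i j. Qed.

Lemma L2_noise_sum k : entries (L2 P) (fun omega => \sum_(0 <= t < k) noise_y t omega).
Proof. by apply: (entries_sum L2_linear_class) => t; exact: L2_noise_y. Qed.

(* Noises of distinct iterations are independent and centered, hence
   orthogonal. *)
Lemma Ex_noise_sum_le k N : (k <= N)%N ->
  Ex P (fun omega => sqn (\sum_(0 <= t < k) noise_y t omega)) <=
  Ex P (fun omega => sqn (\sum_(0 <= t < N) noise_y t omega)).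
Proof.
move=> kN; rewrite -(subnKC kN); elim: (N - k)%N => [|m ih]; first by rewrite addn0.
apply: (le_trans ih); rewrite addnS; set K := (k + m)%N.
pose X omega := \sum_(0 <= t < K) noise_y t omega.
have LX := L2_noise_sum K; rewrite -/X in LX.
have iX : int1 P (fun omega => sqn (X omega)) by exact: int1_sqn.
have iN : int1 P (fun omega => sqn (noise_y K omega)).
  by apply: int1_sqn; exact: L2_noise_y.
have iXN i j : int1 P (fun omega => X omega i j * noise_y K omega i j).
  by apply: L2M_int1 => //; exact: L2_noise_y.
have iXN' i : int1 P (fun omega => \sum_j X omega i j * noise_y K omega i j).
  exact: int1_sum.
have idot : int1 P (fun omega => dotm (X omega) (noise_y K omega)).
  exact: int1_sum.
have dot0 : Ex P (fun omega => dotm (X omega) (noise_y K omega)) = 0.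
  rewrite Ex_sum// big1// => i _; rewrite Ex_sum// big1// => j _.
  have XE omega : X omega i j * noise_y K omega i j =
      \sum_(0 <= t < K) xi_y t i j omega * xi_y K i j omega.
    rewrite /X summxE mulr_suml; apply: eq_bigr => t _.
    by rewrite !mxE.
  under eq_fun do rewrite XE.
  have ixx t : int1 P (fun omega => xi_y t i j omega * xi_y K i j omega).
    by apply: L2M_int1; [have [] := Lxi t i j|have [] := Lxi K i j].
  rewrite Ex_sum//; apply: big1_seq => t /andP[_].
  rewrite mem_index_iota => /andP[_ tK].
  apply: Ex_mul_independent0; [by have [] := Lxi K i j|by have [] := Lxi t i j
    |by have [] := Exi K i j|].
  apply: (indep_others (a := inl (inr (K, i, j)))) => //.
  by apply: others_xi_y => -[] /(past_neq tK).
have -> : (fun omega => sqn (\sum_(0 <= t < K.+1) noise_y t omega)) =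
    (fun omega => sqn (X omega) + (2 * dotm (X omega) (noise_y K omega) + sqn (noise_y K omega))).
  by apply/funext => omega; rewrite big_nat_recr//= sqnD addrA.
rewrite ExD//; last by apply: int1D => //; exact: int1Z.
rewrite ExD//; last exact: int1Z.
rewrite ExZ// dot0 mulr0 add0r lerDl.
by apply: Ex_ge0 => omega; exact: sqn_ge0.
Qed.

End Moments.

(** * The noise series *)

Section NonmeasurableBound.
Context {R : realType} {dO : measure_display} {Omega : measurableType dO}.
Variable P : {measure set Omega -> \bar R}.

Import HBNNSimple.

(* No measurability is required: for a nonnegative integrand the library
   integral is a supremum over the simple functions below it. *)
Lemma ge0_le_integral_nonmeasurable (f g : Omega -> \bar R) :
  (forall x, (0 <= f x)%E) -> (forall x, (f x <= g x)%E) ->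
  (\int[P]_x f x <= \int[P]_x g x)%E.
Proof.
move=> f0 fg; rewrite !ge0_integralTE//; last first.
  by move=> x; rewrite (le_trans (f0 x)).
apply: ereal_sup_le => _ [h hf <-]; exists h => // x.
by rewrite (le_trans (hf x)).
Qed.

End NonmeasurableBound.

Section SeriesOfMatrices.
Context {R : realType} {n d : nat}.

Lemma cvg_matrix (u : nat -> 'M[R]_(n, d)) (l : 'M[R]_(n, d)) :
  (forall i j, u k i j @[k --> \oo] --> l i j) -> u @ \oo --> l.
Proof.
move=> ul; apply/cvg_ballP => e e0.
have : \forall k \near \oo, forall i j, ball (l i j) e (u k i j).
  apply: filter_forall => i; apply: filter_forall => j.
  by have /cvg_ballP/(_ e e0) := ul i j.
by apply: filterS => k uk; split.
Qed.

Lemma cvg_series_bounded (u : nat -> R) M :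
  (forall N, \sum_(0 <= t < N) `|u t| <= M) -> cvgn (series u).
Proof.
move=> uM; apply: normed_cvg; apply: nondecreasing_is_cvgn.
  by apply: nondecreasing_series => k _ _; exact: normr_ge0.
by exists M => _ [N _ <-]; exact: uM.
Qed.

(* Cauchy-Schwarz against the weights [p ^+ t]. *)
Lemma sqn_sum_weighted (p : R) (A : nat -> 'M[R]_(n, d)) N : 0 < p ->
  sqn (\sum_(0 <= t < N) A t) <=
  (\sum_(0 <= t < N) p ^+ t) * \sum_(0 <= t < N) sqn (A t) / p ^+ t.
Proof.
move=> p0; elim: N => [|N ih]; first by rewrite !big_geq// sqn0 mul0r.
rewrite !big_nat_recr//=.
move: ih; set X := \sum_(0 <= t < N) A t; set G := \sum_(0 <= t < N) p ^+ t.
set H := \sum_(0 <= t < N) _ => ih.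
have pN : 0 < p ^+ N by rewrite exprn_gt0.
have G0 : 0 <= G by apply: sumr_ge0 => t _; rewrite exprn_ge0// ltW.
have H0 : 0 <= H.
  by apply: sumr_ge0 => t _; rewrite divr_ge0 ?sqn_ge0// exprn_ge0// ltW.
move: G0; rewrite le_eqVlt => /predU1P[G0|G0].
  move: ih; rewrite -G0 mul0r => /sqn_le0 ->; rewrite !add0r mulrC mulrDl.
  by rewrite divfK ?lt0r_neq0// lerDr mulr_ge0// ltW.
(* With this Young weight the bound collapses to exactly [(G + p ^+ N) (H + sqn (A N) / p ^+ N)]. *)
have t0 : 0 < p ^+ N / G by rewrite divr_gt0.
apply: (le_trans (young_sqn X (A N) t0)).
apply: (@le_trans _ _ ((1 + p ^+ N / G) * (G * H) + (1 + (p ^+ N / G)^-1) * sqn (A N))).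
  by rewrite lerD2r ler_pM2l// addr_gt0.
rewrite le_eqVlt; apply/orP; left; apply/eqP.
by field; rewrite !lt0r_neq0.
Qed.

End SeriesOfMatrices.

Section LimitMoment.
Context {R : realType} {n d : nat} {dO : measure_display}
  {Omega : measurableType dO}.
Variables (P : probability Omega R) (A : nat -> Omega -> 'M[R]_(n, d)) (p K : R).
Hypotheses (p_gt0 : 0 < p) (p_lt1 : p < 1).
Hypothesis A_L2 : forall t, entries (L2 P) (A t).
Hypothesis A_moment : forall t, Ex P (fun w => sqn (A t w)) <= K * p ^+ t ^+ 2.

(** Weighted energy of the series. Dividing by [p ^+ t] still leaves a geometric decay in
    expectation, so the limit [D] of [H] has a finite integral and is finite almost surely; up to
    the factor [1 / (1 - p)] it dominates every squared partial sum. *)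
Let H N w := \sum_(0 <= t < N) sqn (A t w) / p ^+ t.

Let iA t : int1 P (fun w => sqn (A t w)).
Proof. by apply: int1_sqn; exact: A_L2. Qed.

Let iAp t : int1 P (fun w => sqn (A t w) / p ^+ t).
Proof. by under eq_fun do rewrite mulrC; exact: int1Z. Qed.

Let geo N : \sum_(0 <= t < N) p ^+ t <= (1 - p)^-1.
Proof.
have p1 : 0 < 1 - p by rewrite subr_gt0.
rewrite -[leRHS]mul1r ler_pdivlMr// big_mkord mulrC -opprB mulNr -subrX1 opprB.
by rewrite gerBl exprn_ge0// ltW.
Qed.

Let K_ge0 : 0 <= K.
Proof.
have := A_moment 0; rewrite expr0 expr1n mulr1; apply: le_trans.
by apply: Ex_ge0 => w; exact: sqn_ge0.
Qed.

Let term_ge0 t w : 0 <= sqn (A t w) / p ^+ t.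
Proof. by rewrite divr_ge0 ?sqn_ge0// exprn_ge0// ltW. Qed.

Let H_ge0 N w : 0 <= H N w. Proof. by apply: sumr_ge0 => t _. Qed.

Let ndH w : {homo (fun N => (H N w)%:E) : a b / (a <= b)%N >-> (a <= b)%E}.
Proof.
move=> a b ab; rewrite lee_fin /H (big_cat_nat (leq0n a) ab)//= lerDl.
by apply: sumr_ge0.
Qed.

Let iH N : int1 P (H N). Proof. exact: int1_sum. Qed.

Let D w := limn (fun N => (H N w)%:E).

Let HD N w : ((H N w)%:E <= D w)%E.
Proof.
have nd : nondecreasing_seq (fun N => (H N w)%:E) by move=> a b; exact: ndH.
rewrite /D (cvg_lim _ (ereal_nondecreasing_cvgn nd))//.
by apply: ereal_sup_ubound; exists N.
Qed.

Let cvgH w : (H N w)%:E @[N --> \oo] --> D w.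
Proof. by apply: ereal_nondecreasing_is_cvgn; exact: ndH. Qed.

Let mD : measurable_fun setT D.
Proof.
apply: (emeasurable_fun_cvg (fun N w => (H N w)%:E)) => [N|w _]; last exact: cvgH.
exact: measurable_int (iH N).
Qed.

Let D_ge0 w : (0 <= D w)%E.
Proof. by rewrite (le_trans _ (HD 0 w))// lee_fin. Qed.

Let int_D : (\int[P]_w D w <= (K / (1 - p))%:E)%E.
Proof.
have c : (\int[P]_w (H N w)%:E @[N --> \oo] --> \int[P]_w D w)%E.
  apply: cvg_monotone_convergence => //.
  - by move=> N; exact: measurable_int (iH N).
  - by move=> N w _; rewrite lee_fin.
rewrite -(cvg_lim _ c)//; apply: lime_le; first by apply/cvg_ex; eexists; exact: c.
apply: nearW => N; have := int1_Ex (iH N); rewrite unlock => ->.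
rewrite lee_fin /H Ex_sum//.
apply: (@le_trans _ _ (K * \sum_(0 <= t < N) p ^+ t)); last by rewrite ler_wpM2l.
rewrite mulr_sumr; apply: ler_sum => t _.
under eq_fun do rewrite mulrC.
rewrite ExZ// mulrC ler_pdivrMr ?exprn_gt0// -mulrA -expr2.
exact: A_moment.
Qed.

(** Event of probability one on which the series converges. *)
Let G := [set w | D w \is a fin_num].

Let mG : measurable G.
Proof. by rewrite -[G]setTI; exact: emeasurable_fin_num. Qed.

Let iD : P.-integrable setT D.
Proof.
apply/integrableP; split => //; under eq_integral do rewrite gee0_abs//.
by rewrite (le_lt_trans int_D)// ltry.
Qed.

Let PG : P (~` G) = 0%E.
Proof.
have [N [mN PN sN]] := integrable_ae measurableT iD.
apply/eqP; rewrite eq_le measure_ge0 andbT -PN.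
apply: le_measure; rewrite ?inE//; first exact: measurableC.
by apply: subset_trans sN => w /= Gw /(_ I).
Qed.

Let X N w := \sum_(0 <= t < N) A t w.

Let XE N w i j : X N w i j = series (fun t => A t w i j) N.
Proof. by rewrite /X summxE. Qed.

Let X_le N w : sqn (X N w) <= (1 - p)^-1 * H N w.
Proof.
apply: (le_trans (sqn_sum_weighted _ _ p_gt0)).
by rewrite ler_wpM2r// H_ge0.
Qed.

Let G_cvg w : G w -> forall i j, cvgn (series (fun t => A t w i j)).
Proof.
move=> Gw i j; apply: (@cvg_series_bounded _ _ ((1 - p)^-1 + fine (D w))) => N.
(* Each term obeys [|a| <= b + a^2 / b] with [b = p ^+ t], and both resulting series have bounded
   partial sums on [G]. *)
apply: (@le_trans _ _ (\sum_(0 <= t < N) (p ^+ t + sqn (A t w) / p ^+ t))).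
  apply: ler_sum => t _.
  have pt : 0 < p ^+ t by rewrite exprn_gt0.
  have : A t w i j ^+ 2 <= sqn (A t w).
    rewrite /sqn (bigD1 i)//= (bigD1 j)//= -addrA lerDl addr_ge0//.
      by apply: sumr_ge0 => ? _; exact: sqr_ge0.
    by do 2 (apply: sumr_ge0 => ? _); exact: sqr_ge0.
  rewrite -(ler_pM2r pt) mulrDl divfK ?lt0r_neq0//.
  have := normr_ge0 (A t w i j).
  rewrite -(real_normK (num_real (A t w i j))).
  by move: `|_| => a; have := sqr_ge0 (a - p ^+ t); nra.
rewrite big_split/=; apply: lerD => //.
by rewrite -lee_fin fineK//; exact: HD.
Qed.

(** Dominated convergence on [G] sends the second moments of the partial sums to that of the
    entrywise limit [Y]. The integral over [G] bounds the full one from below, with no claim on the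
    measurability of the latter's integrand; monotonicity in [N] brings the bound back to [k]. *)
Lemma limit_second_moment (k : nat) :
  (forall N, (k <= N)%N -> Ex P (fun w => sqn (X k w)) <= Ex P (fun w => sqn (X N w))) ->
  ((Ex P (fun w => sqn (X k w)))%:E <=
   \int[P]_w (enorm (limn (series (fun t => A t w))) ^+ 2)%:E)%E.
Proof.
move=> mono.
have iX N : int1 P (fun w => sqn (X N w)).
  by apply: int1_sqn; apply: (entries_sum (L2_linear_class P)).
pose Y w : 'M[R]_(n, d) := \matrix_(i, j) limn (series (fun t => A t w i j)).
have XY w : G w -> (fun N => X N w) @ \oo --> Y w.
  move=> Gw; apply: cvg_matrix => i j; rewrite mxE.
  by under eq_fun do rewrite XE; exact: G_cvg.
have sXY w : G w -> (sqn (X N w))%:E @[N --> \oo] --> (sqn (Y w))%:E.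
  move=> Gw; apply: cvg_EFin; first exact: nearW.
  rewrite /sqn; apply: cvg_big => [|i _]; first exact: add_continuous.
  apply: cvg_big => [|j _]; first exact: add_continuous.
  rewrite mxE expr2; under eq_fun do rewrite expr2 XE.
  by apply: cvgM; exact: G_cvg.
have c : (\int[P]_(w in G) (sqn (X N w))%:E @[N --> \oo] -->
          \int[P]_(w in G) (sqn (Y w))%:E)%E.
  apply: (@dominated_cvg _ _ _ P G mG _ _ (fun w => (1 - p)^-1%:E * D w)%E).
  - by move=> N; apply/measurable_funTS/measurable_int/iX.
  - exact: sXY.
  - by move=> w Gw; rewrite fin_numM.
  - by apply: integrableZl => //; apply: (integrableS measurableT).
  - move=> N w Gw; rewrite gee0_abs ?lee_fin ?sqn_ge0//.
    apply: (@le_trans _ _ ((1 - p)^-1%:E * (H N w)%:E)%E).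
      by rewrite -EFinM lee_fin.
    by rewrite lee_wpmul2l// lee_fin invr_ge0 subr_ge0 ltW.
apply: (@le_trans _ _ (\int[P]_(w in G) (sqn (Y w))%:E)%E); last first.
  rewrite integral_mkcond; apply: ge0_le_integral_nonmeasurable => w.
    by rewrite patchE; case: ifP => // _; rewrite lee_fin sqn_ge0.
  rewrite patchE; case: ifPn => [|_]; last by rewrite lee_fin sqr_ge0.
  rewrite inE => Gw; rewrite lee_fin enorm_sqn.
  have -> // : limn (series (fun t => A t w)) = Y w.
  by apply/cvg_lim => //; exact: XY.
rewrite -(cvg_lim _ c)//; apply: lime_ge; first by apply/cvg_ex; eexists; exact: c.
near=> N.
have -> : (\int[P]_(w in G) (sqn (X N w))%:E = (Ex P (fun w => sqn (X N w)))%:E)%E.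
  rewrite -int1_Ex// unlock.
  rewrite (@ge0_negligible_integral _ _ _ P setT (~` G))//; last 3 first.
  - exact: measurableC.
  - exact: measurable_int (iX N).
  - by move=> w _; rewrite lee_fin sqn_ge0.
  by rewrite setTD setCK.
by rewrite lee_fin; apply: mono; near: N; exact: nbhs_infty_ge.
Unshelve. all: by end_near.
Qed.

End LimitMoment.

(** * One iteration *)

Section Step.
Context {R : realType} {n d : nat} {S : Type} {L : R}.
Variables (f : 'I_n -> 'rV[R]_d -> R) (W : 'M[R]_n) (C : S -> 'rV[R]_d -> 'rV[R]_d)
  (r eta gamma alpha_x alpha_y p : R).
Hypotheses (n_gt0 : (0 < n)%N) (L_gt0 : 0 < L) (f_smooth : forall i, smooth L (f i))
  (W_sym : W^T = W) (W_ds : doubly_stochastic W) (r_gt0 : 0 < r)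
  (eta_gt0 : 0 < eta) (gamma_gt0 : 0 < gamma) (gamma_le1 : gamma <= 1)
  (alpha_x_range : 0 < alpha_x < r^-1) (alpha_y_range : 0 < alpha_y < r^-1)
  (p_gt0 : 0 < p).

Local Notation rho := (spectral_gap W).
Hypotheses (rho_gt0 : 0 < rho) (grho_lt1 : gamma * rho < 1).

Variables (v v' : pgtc_input R n d S) (s : pgtc_state R n d).
Local Notation s' := (pgtc_step f W C eta gamma alpha_x alpha_y v s).

(** The transmitted value is [x^c + C z] and [x^a = x^c + z], so this is the deviation of the former
    from [x^a]. *)
Let dev_x := stack (qx C v s) - stack (zx v s).
Let dev_y := stack (qy C v s) - stack (zy v s).
Let G t := stack (fun i => gradient (f i) (st_x t i)).

Let laplacian_stack (u : 'I_n -> 'rV[R]_d) :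
  stack (fun i => \sum_j W i j *: (u j - u i)) = W *m stack u - stack u.
Proof.
have [_ Wr _] := W_ds.
apply/matrixP => i j; rewrite !mxE summxE -[u i 0 j]mul1r -(Wr i) mulr_suml -sumrB.
by apply: eq_bigr => k _; rewrite !mxE mulrBr.
Qed.

Let stack_x' : stack (st_x s') =
  mixing W (gamma := gamma) (stack (st_x s) + stack (in_xi_x v))
  + gamma *: (W *m dev_x - dev_x) - eta *: stack (st_y s).
Proof.
have -> : stack (st_x s') = stack (st_x s) + stack (in_xi_x v)
   + gamma *: stack (fun i => \sum_j W i j *:
       ((st_xc s j + qx C v s j) - (st_xc s i + qx C v s i))) - eta *: stack (st_y s).
  by apply/matrixP => i j; rewrite !mxE.
rewrite (laplacian_stack (fun i => st_xc s i + qx C v s i)).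
have -> : stack (fun i => st_xc s i + qx C v s i) =
    stack (st_x s) + stack (in_xi_x v) + dev_x.
  by apply/matrixP => i j; rewrite !mxE; ring.
rewrite /mixing; move: (stack (st_x s) + _) => A.
by rewrite mulmxDr; apply/matrixP => i j; rewrite !mxE; ring.
Qed.

Let stack_y' : stack (st_y s') =
  mixing W (gamma := gamma) (stack (st_y s) + stack (in_xi_y v))
  + gamma *: (W *m dev_y - dev_y) + (G s' - G s).
Proof.
have -> : stack (st_y s') = stack (st_y s) + stack (in_xi_y v)
   + gamma *: stack (fun i => \sum_j W i j *:
       ((st_yc s j + qy C v s j) - (st_yc s i + qy C v s i))) + (G s' - G s).
  by apply/matrixP => i j; rewrite !mxE addrA.
rewrite (laplacian_stack (fun i => st_yc s i + qy C v s i)).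
have -> : stack (fun i => st_yc s i + qy C v s i) =
    stack (st_y s) + stack (in_xi_y v) + dev_y.
  by apply/matrixP => i j; rewrite !mxE; ring.
rewrite /mixing; move: (stack (st_y s) + _) => A.
by rewrite mulmxDr; apply/matrixP => i j; rewrite !mxE; ring.
Qed.

(** The splitting [Q - Z = r (Q / r - Z) - (1 - r) Z] is the origin of [r0]: in expectation the
    first part brings in [1 - phi]. *)
Let sqn_dev (Q Z : 'M[R]_(n, d)) :
  sqn (Q - Z) <= 2 * r ^+ 2 * sqn (r^-1 *: Q - Z) + 2 * (1 - r) ^+ 2 * sqn Z.
Proof.
have -> : Q - Z = r *: (r^-1 *: Q - Z) + (- (1 - r)) *: Z.
  rewrite scalerBr scalerA mulfV ?lt0r_neq0// scale1r -addrA; congr (_ + _).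
  by rewrite opprB scalerBl scale1r addrA addNr add0r.
apply: (le_trans (sqnD2 _ _)); rewrite !sqnZ sqrrN.
by rewrite !mulrA.
Qed.

(** Pathwise precursor of [r0] times the squared norm of [z]: the relative error is bounded by [z]
    only in expectation. *)
Definition distortion_x : R :=
  2 * r ^+ 2 * sqn (stack (err_x C r v s)) + 2 * (1 - r) ^+ 2 * sqn (stack (zx v s)).
Definition distortion_y : R :=
  2 * r ^+ 2 * sqn (stack (err_y C r v s)) + 2 * (1 - r) ^+ 2 * sqn (stack (zy v s)).

Let err_xE : stack (err_x C r v s) = r^-1 *: stack (qx C v s) - stack (zx v s).
Proof. by apply/matrixP => i j; rewrite !mxE. Qed.

Let err_yE : stack (err_y C r v s) = r^-1 *: stack (qy C v s) - stack (zy v s).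
Proof. by apply/matrixP => i j; rewrite !mxE. Qed.

Let dev_x_le : sqn dev_x <= distortion_x.
Proof. by rewrite /distortion_x err_xE; exact: sqn_dev. Qed.

Let dev_y_le : sqn dev_y <= distortion_y.
Proof. by rewrite /distortion_y err_yE; exact: sqn_dev. Qed.

(** The consensus part belongs to the Lyapunov function; the mean part will be paid for by the
    negative multiple of it in [objective_step]. *)
Let sqnU : sqn (- (eta *: stack (st_y s))) =
  eta ^+ 2 * (sqn (centered (stack (st_y s))) + n%:R * sqn (mean (st_y s))).
Proof.
by rewrite sqnN sqnZ [in LHS](sqn_center n_gt0) sqn_avgmx_stack.
Qed.

Let g4_ge0 : 0 <= 4 * gamma ^+ 2. Proof. by rewrite mulr_ge0// sqr_ge0. Qed.

Let lam_ge0 : 0 <= 3 / (gamma * rho). Proof. by rewrite divr_ge0// ltW// mulr_gt0. Qed.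

Lemma consensus_x_step :
  sqn (centered (stack (st_x s'))) <=
  (1 - gamma * rho) * sqn (centered (stack (st_x s))) +
  3 / (gamma * rho) * ((1 - gamma * rho) ^+ 2 * sqn (stack (in_xi_x v))
    + 4 * gamma ^+ 2 * distortion_x + eta ^+ 2 * sqn (centered (stack (st_y s)))).
Proof.
rewrite stack_x'.
apply: (le_trans (consensus_step n_gt0 W_sym W_ds gamma_gt0 gamma_le1 rho_gt0 _ _ _ _ grho_lt1)).
rewrite lerD2l ler_wpM2l// lerD//.
  by rewrite lerD2l ler_wpM2l.
have -> : centered (- (eta *: stack (st_y s))) = - eta *: centered (stack (st_y s)).
  by rewrite /centered -scaleNr -scalemxAr scalerBr.
by rewrite sqnZ sqrrN.
Qed.

Lemma increment_x_step :
  sqn (stack (st_x s') - stack (st_x s)) <=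
  4 * (4 * gamma ^+ 2 * sqn (centered (stack (st_x s))) + sqn (stack (in_xi_x v))
    + 4 * gamma ^+ 2 * distortion_x
    + eta ^+ 2 * (sqn (centered (stack (st_y s))) + n%:R * sqn (mean (st_y s)))).
Proof.
rewrite stack_x'; apply: (le_trans (increment_step W_ds gamma_gt0 gamma_le1 _ _ _ _)).
by rewrite ler_pM2l// -sqnU lerD2r lerD2l ler_wpM2l.
Qed.

Let G_le : sqn (G s' - G s) <= L ^+ 2 * sqn (stack (st_x s') - stack (st_x s)).
Proof. exact: (sqn_gradient_stack L_gt0 f_smooth (st_x s') (st_x s)). Qed.

Lemma consensus_y_step :
  sqn (centered (stack (st_y s'))) <=
  (1 - gamma * rho) * sqn (centered (stack (st_y s))) +
  3 / (gamma * rho) * ((1 - gamma * rho) ^+ 2 * sqn (stack (in_xi_y v))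
    + 4 * gamma ^+ 2 * distortion_y
    + L ^+ 2 * sqn (stack (st_x s') - stack (st_x s))).
Proof.
rewrite stack_y'.
apply: (le_trans (consensus_step n_gt0 W_sym W_ds gamma_gt0 gamma_le1 rho_gt0 _ _ _ _ grho_lt1)).
rewrite lerD2l ler_wpM2l// lerD//.
  by rewrite lerD2l ler_wpM2l.
exact: (le_trans (sqn_center_le n_gt0 _) G_le).
Qed.

Let c5_ge0 : 0 <= (1 + 2 / p) * 5.
Proof. by rewrite mulr_ge0// addr_ge0// divr_ge0// ltW. Qed.

Lemma compression_x_step :
  sqn (stack (zx v' s')) <=
  (1 + p / 2) * (alpha_x * r * sqn (stack (err_x C r v s))
                 + (1 - alpha_x * r) * sqn (stack (zx v s))) +
  (1 + 2 / p) * 5 * (4 * gamma ^+ 2 * sqn (centered (stack (st_x s)))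
    + 4 * gamma ^+ 2 * sqn (stack (in_xi_x v)) + 4 * gamma ^+ 2 * distortion_x
    + eta ^+ 2 * (sqn (centered (stack (st_y s))) + n%:R * sqn (mean (st_y s)))
    + sqn (stack (in_xi_x v'))).
Proof.
have -> : stack (zx v' s') = - ((1 - alpha_x) *: stack (st_xc s)
    + alpha_x *: (stack (st_xc s) + stack (qx C v s))
    - (stack (st_x s') + stack (in_xi_x v'))).
  by apply/matrixP => i j; rewrite !mxE; ring.
rewrite sqnN stack_x' err_xE.
have zE : stack (zx v s) = stack (st_x s) + stack (in_xi_x v) - stack (st_xc s).
  by apply/matrixP => i j; rewrite !mxE.
apply: (le_trans (compression_step W_ds dev_x _ _ _ r_gt0 alpha_x_range p_gt0 zE)).
rewrite lerD2l ler_wpM2l// -sqnU lerD2r lerD2r lerD2l ler_wpM2l//.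
Qed.

Lemma compression_y_step :
  sqn (stack (zy v' s')) <=
  (1 + p / 2) * (alpha_y * r * sqn (stack (err_y C r v s))
                 + (1 - alpha_y * r) * sqn (stack (zy v s))) +
  (1 + 2 / p) * 5 * (4 * gamma ^+ 2 * sqn (centered (stack (st_y s)))
    + 4 * gamma ^+ 2 * sqn (stack (in_xi_y v)) + 4 * gamma ^+ 2 * distortion_y
    + L ^+ 2 * sqn (stack (st_x s') - stack (st_x s))
    + sqn (stack (in_xi_y v'))).
Proof.
have -> : stack (zy v' s') = - ((1 - alpha_y) *: stack (st_yc s)
    + alpha_y *: (stack (st_yc s) + stack (qy C v s))
    - (stack (st_y s') + stack (in_xi_y v'))).
  by apply/matrixP => i j; rewrite !mxE; ring.
rewrite sqnN stack_y' err_yE.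
have zE : stack (zy v s) = stack (st_y s) + stack (in_xi_y v) - stack (st_yc s).
  by apply/matrixP => i j; rewrite !mxE.
apply: (le_trans (compression_step W_ds dev_y _ _ _ r_gt0 alpha_y_range p_gt0 zE)).
rewrite lerD2l ler_wpM2l// lerD2r lerD//.
by rewrite lerD2l ler_wpM2l.
Qed.

(** Row and column sums equal to [1] make mixing preserve means, so compression errors never reach
    the averages. *)
Let mean_laplacian (u : 'I_n -> 'rV[R]_d) :
  mean (fun i => \sum_j W i j *: (u j - u i)) = 0.
Proof.
have [_ Wr Wc] := W_ds; rewrite /mean.
have -> : \sum_i \sum_j W i j *: (u j - u i) =
    \sum_i (\sum_j W i j *: u j) - \sum_i u i.
  rewrite -sumrB; apply: eq_bigr => i _.
  rewrite -[u i in RHS]scale1r -(Wr i) scaler_suml -sumrB.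
  by apply: eq_bigr => j _; rewrite scalerBr.
rewrite exchange_big/= -sumrB big1 ?scaler0// => j _.
by rewrite -scaler_suml Wc scale1r subrr.
Qed.

Let meanD (a b : 'I_n -> 'rV[R]_d) : mean (fun i => a i + b i) = mean a + mean b.
Proof. by rewrite /mean big_split scalerDr. Qed.

Let meanZ c (a : 'I_n -> 'rV[R]_d) : mean (fun i => c *: a i) = c *: mean a.
Proof. by rewrite /mean -scaler_sumr !scalerA mulrC. Qed.

Lemma mean_x_step :
  mean (st_x s') = mean (st_x s) + mean (in_xi_x v) - eta *: mean (st_y s).
Proof.
rewrite [LHS](@meanB _ _ _ _ (fun i => eta *: st_y s i)) meanZ meanD meanD meanZ.
by rewrite mean_laplacian scaler0 addr0.
Qed.

Lemma mean_y_step :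
  mean (st_y s') - mean (fun i => gradient (f i) (st_x s' i)) =
  mean (st_y s) - mean (fun i => gradient (f i) (st_x s i)) + mean (in_xi_y v).
Proof.
rewrite [mean (st_y s')](@meanB _ _ _ _ (fun i => gradient (f i) (st_x s i))).
rewrite meanD meanD meanD meanZ mean_laplacian scaler0 addr0.
have addE (a b c e : 'rV[R]_d) : a + b + c - e - c = a - e + b.
  by apply/matrixP => i j; rewrite !mxE; ring.
exact: addE.
Qed.

(** Writing [- 2 <g, y> = |g - y|^2 - |g|^2 - |y|^2], with [y] the mean of the [y_i], produces both
    negative squares. The gap [g - y] splits into the gradient disagreement and the mean of the
    accumulated noise, for which [X] stands. *)
Lemma objective_step (X : 'M[R]_(n, d)) :
  mean (st_y s) - mean (fun i => gradient (f i) (st_x s i)) = mean (fun i => row i X) ->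
  average f (mean (st_x s')) <= average f (mean (st_x s))
    + dotm (gradient (average f) (mean (st_x s))) (mean (in_xi_x v))
    - eta / 2 * sqn (gradient (average f) (mean (st_x s)))
    - eta / 2 * sqn (mean (st_y s))
    + eta * (L ^+ 2 / n%:R * sqn (centered (stack (st_x s))) + n%:R^-1 * sqn X)
    + L * (n%:R^-1 * sqn (stack (in_xi_x v)) + eta ^+ 2 * sqn (mean (st_y s))).
Proof.
move=> yE.
have fL := smooth_average n_gt0 L_gt0 f_smooth.
apply: (le_trans (descent_lemma (mean (st_x s)) _ L_gt0 fL)).
set g := gradient (average f) (mean (st_x s)).
set xm := mean (in_xi_x v); set ym := mean (st_y s).
rewrite mean_x_step -/xm -/ym.
have -> : mean (st_x s) + xm - eta *: ym - mean (st_x s) = xm - eta *: ym.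
  by rewrite addrAC [mean _ + _]addrC addrK.
rewrite dotmBr [dotm g (eta *: _)]dotmZr.
have h1 : sqn (xm - eta *: ym) <= 2 * (n%:R^-1 * sqn (stack (in_xi_x v))) + 2 * (eta ^+ 2 * sqn ym).
  apply: (le_trans (sqnD2 _ _)); rewrite sqnN [sqn (eta *: _)]sqnZ lerD2r ler_pM2l//.
  exact: sqn_mean_le.
have h2 : - 2 * dotm g ym <= - sqn g - sqn ym
    + 2 * (L ^+ 2 / n%:R * sqn (centered (stack (st_x s)))) + 2 * (n%:R^-1 * sqn X).
  have -> : - 2 * dotm g ym = - sqn g - sqn ym + sqn (g - ym).
    have dN : dotm g (- ym) = - dotm g ym by rewrite -scaleN1r dotmZr mulN1r.
    by rewrite sqnD sqnN dN; ring.
  rewrite -[leRHS]addrA lerD2l.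
  have -> : g - ym = (g - mean (fun i => gradient (f i) (st_x s i))) - mean (fun i => row i X).
    by rewrite -yE opprB addrA subrK.
  apply: (le_trans (sqnD2 _ _)); rewrite sqnN; apply: lerD; rewrite ler_pM2l//.
    apply: (le_trans (sqn_gradient_mean n_gt0 L_gt0 f_smooth _ _)).
    have -> : stack (fun i => mean (st_x s) - st_x s i) = - centered (stack (st_x s)).
      by rewrite /centered -stack_mean; apply/matrixP => i j; rewrite !mxE opprB.
    by rewrite sqnN.
  apply: (le_trans (sqn_mean_le n_gt0 _)).
  have -> : stack (fun i => row i X) = X by apply/matrixP => i j; rewrite !mxE.
  by [].
have e0 := eta_gt0; have l0 := L_gt0.
move: h1 h2; set sx := n%:R^-1 * sqn (stack _); set cx := L ^+ 2 / _ * _.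
set xx := n%:R^-1 * sqn X; set sq := sqn (_ - _).
set gy := dotm g ym; set gx := dotm g xm; set sg := sqn g; set sy := sqn ym.
move=> h1 h2.
have h1' := ler_wpM2l (ltW l0) h1; have h2' := ler_wpM2l (ltW e0) h2.
lra.
Qed.

End Step.

(** * Step-size inequalities *)

Ltac nonneg := repeat first
  [ exact: ler0n | exact: ler01 | assumption | apply: ltW; assumption | exact: sqr_ge0
  | rewrite subr_ge0; assumption | apply: addr_ge0 | apply: divr_ge0 | apply: mulr_ge0
  | apply: exprn_ge0 ].

Section StepSizes.
Context {R : realFieldType} {n L rho p zeta r0 : R}.
Hypotheses (n_ge1 : 1 <= n) (L_gt0 : 0 < L) (rho_gt0 : 0 < rho) (rho_le1 : rho <= 1)
  (p_gt0 : 0 < p) (p_le1 : p <= 1) (zeta_gt0 : 0 < zeta) (r0_ge0 : 0 <= r0).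
Hypotheses (zeta_L : zeta * (n / L + 1860 * L) <= n)
  (zeta_n : zeta * ((2 + 18 * n) / L + 576) <= 1)
  (zeta_r0 : zeta * ((2 + 72 * n * r0) / L + 576 + 1024 * r0) <= 1).

Let gamma := zeta * rho * p.
Let eta := zeta * gamma * rho ^+ 2 / L.
Let s2 := zeta * rho ^+ 2 / (n * L).
Let gr := gamma * rho.
Let u := zeta * L / n.

Let n_gt0 : 0 < n. Proof. exact: lt_le_trans n_ge1. Qed.
Let n_neq0 : n != 0. Proof. exact: lt0r_neq0. Qed.
Let L_neq0 : L != 0. Proof. exact: lt0r_neq0. Qed.
Let p_neq0 : p != 0. Proof. exact: lt0r_neq0. Qed.
Let rho_neq0 : rho != 0. Proof. exact: lt0r_neq0. Qed.
Let zeta_neq0 : zeta != 0. Proof. exact: lt0r_neq0. Qed.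

Let gamma_gt0 : 0 < gamma. Proof. by rewrite /gamma !mulr_gt0. Qed.
Let gr_gt0 : 0 < gr. Proof. by rewrite /gr mulr_gt0. Qed.
Let eta_gt0 : 0 < eta. Proof. by rewrite /eta divr_gt0// !mulr_gt0// exprn_gt0. Qed.
Let s2_gt0 : 0 < s2. Proof. by rewrite /s2 divr_gt0// mulr_gt0// exprn_gt0. Qed.

Let u_ge0 : 0 <= u. Proof. by rewrite /u; nonneg. Qed.

Let u_le : 1860 * u <= 1.
Proof.
rewrite /u mulrA ler_pdivrMr// mul1r; apply: le_trans zeta_L.
have : 0 <= zeta * (n / L) by nonneg.
by lra.
Qed.

Let zeta_nL : 18 * (zeta * n / L) <= 1.
Proof.
apply: le_trans zeta_n.
have -> : zeta * ((2 + 18 * n) / L + 576) =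
    18 * (zeta * n / L) + (2 * (zeta / L) + 576 * zeta) by field.
by rewrite lerDl; nonneg.
Qed.

Let zeta_1L : 20 * (zeta / L) <= 1.
Proof.
apply: le_trans zeta_n.
have -> : zeta * ((2 + 18 * n) / L + 576) =
    20 * (zeta / L) + (18 * (zeta * (n - 1) / L) + 576 * zeta) by field.
by rewrite lerDl; nonneg.
Qed.

Let zeta_le : 576 * zeta <= 1.
Proof.
apply: le_trans zeta_n; rewrite mulrDr [576 * _]mulrC lerDr.
by nonneg.
Qed.

Let zeta_nr0L : 72 * (zeta * n * r0 / L) <= 1.
Proof.
apply: le_trans zeta_r0.
have -> : zeta * ((2 + 72 * n * r0) / L + 576 + 1024 * r0) =
    72 * (zeta * n * r0 / L) + (2 * (zeta / L) + 576 * zeta + 1024 * (zeta * r0)) by field.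
by rewrite lerDl; nonneg.
Qed.

Let zeta_0r0 : 1024 * (zeta * r0) <= 1.
Proof.
apply: le_trans zeta_r0.
have -> : zeta * ((2 + 72 * n * r0) / L + 576 + 1024 * r0) =
    1024 * (zeta * r0) + (72 * (zeta * n * r0 / L) + (2 * (zeta / L) + 576 * zeta)) by field.
by rewrite lerDl; nonneg.
Qed.

Let rho_exp k x : 0 <= x -> rho ^+ k * x <= x.
Proof. by move=> x0; rewrite ler_piMl// exprn_ile1// ltW. Qed.

Let zeta_exp k x : 0 <= x -> zeta ^+ k * x <= x.
Proof.
move=> x0; rewrite ler_piMl// exprn_ile1// ltW// .
by have := zeta_le; have := zeta_gt0; lra.
Qed.

(** [KA], [KB], [KC], [KE] and [KH] concern the coefficients of [A], [B], [C], [E] and [H] in the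
    weighted sum of [lyapunov_decrease]. Substituting the step sizes factors out a positive quantity
    and leaves small terms to compare with [1/2] or [1]. The final [eta / 4] reserves the decrease
    claimed for [A]. *)
Let KA : eta * L ^+ 2 / n - gr / 2 + s2 * (3 / gr) * L ^+ 2 * (16 * gamma ^+ 2)
  + L / n * (15 / p) * (4 * gamma ^+ 2) + s2 * (15 / p) * L ^+ 2 * (16 * gamma ^+ 2)
  + eta / 4 <= 0.
Proof.
have -> : eta * L ^+ 2 / n - gr / 2 + s2 * (3 / gr) * L ^+ 2 * (16 * gamma ^+ 2)
  + L / n * (15 / p) * (4 * gamma ^+ 2) + s2 * (15 / p) * L ^+ 2 * (16 * gamma ^+ 2)
  + eta / 4 = gr * (rho ^+ 1 * u + 108 * u + 240 * (zeta ^+ 1 * (rho ^+ 2 * u))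
                    + rho ^+ 1 * (zeta / L) / 4 - 1 / 2).
  rewrite /eta /s2 /gr /gamma /u; field.
  by rewrite n_neq0 L_neq0 p_neq0 rho_neq0 zeta_neq0.
rewrite pmulr_rle0//.
have h1 := rho_exp 1 u_ge0; have h2 := rho_exp 2 u_ge0.
have u2 : 0 <= rho ^+ 2 * u by rewrite mulr_ge0// exprn_ge0// ltW.
have h3 := zeta_exp 1 u2.
have zL0 : 0 <= zeta / L by rewrite divr_ge0 ?ltW.
have h4 := rho_exp 1 zL0.
by have := u_le; have := zeta_1L; lra.
Qed.

Let KB : 2^-1 * (3 / gr) * eta ^+ 2 - s2 * gr + s2 * (3 / gr) * L ^+ 2 * (4 * eta ^+ 2)
  + L / n * (15 / p) * eta ^+ 2
  + s2 * (15 / p) * (4 * gamma ^+ 2 + L ^+ 2 * (4 * eta ^+ 2)) <= 0.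
Proof.
have -> : 2^-1 * (3 / gr) * eta ^+ 2 - s2 * gr + s2 * (3 / gr) * L ^+ 2 * (4 * eta ^+ 2)
  + L / n * (15 / p) * eta ^+ 2
  + s2 * (15 / p) * (4 * gamma ^+ 2 + L ^+ 2 * (4 * eta ^+ 2)) =
  s2 * gr * (3 / 2 * (zeta * n / L) + 27 * (rho ^+ 2 * (zeta ^+ 1 * zeta)) + 60 * zeta
             + 60 * (rho ^+ 4 * (zeta ^+ 2 * zeta)) - 1).
  rewrite /eta /s2 /gr /gamma; field.
  by rewrite n_neq0 L_neq0 p_neq0 rho_neq0 zeta_neq0.
rewrite (pmulr_rle0 _ (mulr_gt0 s2_gt0 gr_gt0)).
have z0 := ltW zeta_gt0.
have z1 : 0 <= zeta ^+ 1 * zeta by rewrite mulr_ge0.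
have z2 : 0 <= zeta ^+ 2 * zeta by rewrite mulr_ge0 ?exprn_ge0.
have h1 := rho_exp 2 z1; have h2 := rho_exp 4 z2.
have h3 := zeta_exp 2 z0.
have h4 : zeta ^+ 1 * zeta <= 1 / 576 * zeta.
  by rewrite ler_wpM2r// expr1; have := zeta_le; lra.
by have := zeta_nL; have := zeta_le; lra.
Qed.

Let KC : 2^-1 * (3 / gr) * (4 * gamma ^+ 2 * r0)
  + s2 * (3 / gr) * L ^+ 2 * (16 * gamma ^+ 2 * r0) - L / n * (p / 2)
  + L / n * (15 / p) * (4 * gamma ^+ 2 * r0)
  + s2 * (15 / p) * L ^+ 2 * (16 * gamma ^+ 2 * r0) <= 0.
Proof.
have -> : 2^-1 * (3 / gr) * (4 * gamma ^+ 2 * r0)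
  + s2 * (3 / gr) * L ^+ 2 * (16 * gamma ^+ 2 * r0) - L / n * (p / 2)
  + L / n * (15 / p) * (4 * gamma ^+ 2 * r0)
  + s2 * (15 / p) * L ^+ 2 * (16 * gamma ^+ 2 * r0) =
  L / n * p * (6 * (zeta * n * r0 / L) + 108 * (rho ^+ 2 * (zeta * (zeta * r0)))
               + 240 * (rho ^+ 4 * (zeta ^+ 1 * (zeta * (zeta * r0)))) - 1 / 2).
  rewrite /s2 /gr /gamma; field.
  by rewrite n_neq0 L_neq0 p_neq0 rho_neq0 zeta_neq0.
rewrite (pmulr_rle0 _ (mulr_gt0 (divr_gt0 L_gt0 n_gt0) p_gt0)).
have z0 := ltW zeta_gt0.
have zr : 0 <= zeta * r0 by rewrite mulr_ge0.
have zzr : 0 <= zeta * (zeta * r0) by rewrite mulr_ge0.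
have zzzr : 0 <= zeta ^+ 1 * (zeta * (zeta * r0)) by rewrite mulr_ge0.
have h1 := rho_exp 2 zzr; have h2 := rho_exp 4 zzzr; have h3 := zeta_exp 1 zzr.
have h4 : zeta * (zeta * r0) <= 1 / 576 * (zeta * r0).
  by rewrite ler_wpM2r//; have := zeta_le; lra.
by have := zeta_nr0L; have := zeta_0r0; lra.
Qed.

Let KE : s2 * (3 / gr) * (4 * gamma ^+ 2 * r0) - s2 * (p / 2)
  + s2 * (15 / p) * (4 * gamma ^+ 2 * r0) <= 0.
Proof.
have -> : s2 * (3 / gr) * (4 * gamma ^+ 2 * r0) - s2 * (p / 2)
  + s2 * (15 / p) * (4 * gamma ^+ 2 * r0) =
  s2 * p * (12 * (zeta * r0) + 60 * (rho ^+ 2 * (zeta * (zeta * r0))) - 1 / 2).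
  rewrite /s2 /gr /gamma; field.
  by rewrite n_neq0 L_neq0 p_neq0 rho_neq0 zeta_neq0.
rewrite (pmulr_rle0 _ (mulr_gt0 s2_gt0 p_gt0)).
have z0 := ltW zeta_gt0.
have zr : 0 <= zeta * r0 by rewrite mulr_ge0.
have zzr : 0 <= zeta * (zeta * r0) by rewrite mulr_ge0.
have h1 := rho_exp 2 zzr.
have h4 : zeta * (zeta * r0) <= 1 / 576 * (zeta * r0).
  by rewrite ler_wpM2r//; have := zeta_le; lra.
by have := zeta_0r0; lra.
Qed.

Let KH : - (eta / 2) + L * eta ^+ 2 + s2 * (3 / gr) * L ^+ 2 * (4 * eta ^+ 2 * n)
  + L / n * (15 / p) * (eta ^+ 2 * n) + s2 * (15 / p) * L ^+ 2 * (4 * eta ^+ 2 * n) <= 0.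
Proof.
have -> : - (eta / 2) + L * eta ^+ 2 + s2 * (3 / gr) * L ^+ 2 * (4 * eta ^+ 2 * n)
  + L / n * (15 / p) * (eta ^+ 2 * n) + s2 * (15 / p) * L ^+ 2 * (4 * eta ^+ 2 * n) =
  eta * (p * (rho ^+ 3 * (zeta * zeta)) + 27 * (rho ^+ 3 * (zeta * zeta))
         + 60 * (rho ^+ 5 * (zeta ^+ 1 * (zeta * zeta))) - 1 / 2).
  rewrite /eta /s2 /gr /gamma; field.
  by rewrite n_neq0 L_neq0 p_neq0 rho_neq0 zeta_neq0.
rewrite pmulr_rle0//.
have z0 := ltW zeta_gt0.
have zz : 0 <= zeta * zeta by rewrite mulr_ge0.
have rzz : 0 <= rho ^+ 3 * (zeta * zeta) by rewrite mulr_ge0 ?exprn_ge0 ?(ltW rho_gt0).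
have zzz : 0 <= zeta ^+ 1 * (zeta * zeta) by rewrite mulr_ge0.
have h1 := rho_exp 3 zz; have h2 := rho_exp 5 zzz; have h3 := zeta_exp 1 zz.
have h4 : zeta * zeta <= 1 / 576 * zeta.
  by rewrite ler_wpM2r//; have := zeta_le; lra.
have h5 : p * (rho ^+ 3 * (zeta * zeta)) <= rho ^+ 3 * (zeta * zeta).
  by rewrite ler_piMl.
by have := zeta_le; lra.
Qed.

(** The product of [s_const] and [vartheta2], divided by [2 n d]. *)
Definition noise_coef (lambda : R) :=
  2^-1 * (9 * (1 - gr) ^+ 2 / gr)
  + s2 * (36 * (1 - gr) ^+ 2 * L ^+ 2 / gr + 9 * (1 - gr) ^+ 2 / gr)
  + L / n * (16 * ((1 - gr) ^+ 2 + 1) / p)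
  + s2 * ((64 * lambda ^+ 2 + 16 * (lambda ^+ 2 + 1)) / p).

Lemma noise_coef_ge0 lambda : 0 <= noise_coef lambda.
Proof.
have gr0 := ltW gr_gt0; have s20 := ltW s2_gt0.
have h20 : 0 <= 2^-1 :> R by rewrite invr_ge0.
by rewrite /noise_coef; nonneg.
Qed.

Lemma gr_small : 576 * gr <= 1.
Proof.
have z0 := ltW zeta_gt0.
have -> : gr = p * (rho ^+ 2 * zeta) by rewrite /gr /gamma; ring.
have h1 := rho_exp 2 z0.
have r2 : 0 <= rho ^+ 2 * zeta by rewrite mulr_ge0// exprn_ge0// ltW.
have h2 : p * (rho ^+ 2 * zeta) <= rho ^+ 2 * zeta by rewrite ler_piMl.
by have := zeta_le; lra.
Qed.

(* The constants 9 and 36 of the paper leave room for the smaller ones obtained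
   here, which pays for the term [L ^+ 2 * 4] that has no counterpart in the
   last entry of vartheta_2. *)
Let KN lambda : L / n + 2^-1 * (3 / gr) + s2 * (3 / gr) * (1 + L ^+ 2 * 4)
  + L / n * (15 / p) * 2 + s2 * (15 / p) * (2 + L ^+ 2 * 4) <= noise_coef lambda.
Proof.
(* As [gr <= 1 / 576], the square of [1 - gr] can be replaced by a numerical constant, which makes
   the comparison linear. *)
have lh : 99 / 100 <= (1 - gr) ^+ 2.
  by have := gr_small; have := gr_gt0; nra.
apply: (@le_trans _ _ (2^-1 * (9 * (99 / 100) / gr)
  + s2 * (36 * (99 / 100) * L ^+ 2 / gr + 9 * (99 / 100) / gr))); last first.
  rewrite /noise_coef -[leRHS]addrA -[leRHS]addrA lerD//.
    by rewrite ler_pM2l ?invr_gt0// ler_pM2r ?invr_gt0// ler_pM2l.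
  apply: (@le_trans _ _ (s2 * (36 * (1 - gr) ^+ 2 * L ^+ 2 / gr
     + 9 * (1 - gr) ^+ 2 / gr))).
    rewrite ler_pM2l// lerD// ler_pM2r ?invr_gt0//.
      by rewrite ler_pM2r ?exprn_gt0// ler_pM2l.
    by rewrite ler_pM2l.
  by rewrite lerDl; nonneg.
rewrite -(ler_pM2l gr_gt0).
have -> : gr * (L / n + 2^-1 * (3 / gr) + s2 * (3 / gr) * (1 + L ^+ 2 * 4)
  + L / n * (15 / p) * 2 + s2 * (15 / p) * (2 + L ^+ 2 * 4)) =
  p * (rho ^+ 2 * u) + 3 / 2 + 30 * (rho ^+ 2 * u)
  + (3 * s2 + 12 * (s2 * L ^+ 2) + 30 * (zeta ^+ 1 * (rho ^+ 2 * s2))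
     + 60 * (zeta ^+ 1 * (rho ^+ 2 * (s2 * L ^+ 2)))).
  rewrite /s2 /gr /gamma /u; field.
  by rewrite n_neq0 L_neq0 p_neq0 rho_neq0 zeta_neq0.
have -> : gr * (2^-1 * (9 * (99 / 100) / gr)
  + s2 * (36 * (99 / 100) * L ^+ 2 / gr + 9 * (99 / 100) / gr)) =
  9 * (99 / 100) / 2 + 9 * (99 / 100) * s2 + 36 * (99 / 100) * (s2 * L ^+ 2).
  by field; rewrite lt0r_neq0.
have r2u : 0 <= rho ^+ 2 * u by rewrite mulr_ge0// exprn_ge0// ltW.
have h1 := rho_exp 2 u_ge0.
have h2 : p * (rho ^+ 2 * u) <= rho ^+ 2 * u by rewrite ler_piMl.
have s20 := ltW s2_gt0.
have sL0 : 0 <= s2 * L ^+ 2 by rewrite mulr_ge0// sqr_ge0.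
have h3 := rho_exp 2 s20; have h4 := rho_exp 2 sL0.
have small x : 0 <= x -> zeta ^+ 1 * (rho ^+ 2 * x) <= 1 / 576 * x.
  move=> x0; rewrite expr1; apply: ler_pM => //; [exact: ltW| | |exact: rho_exp].
    by rewrite mulr_ge0// exprn_ge0// ltW.
  by have := zeta_le; lra.
have h5 := small _ s20; have h6 := small _ sL0.
by have := u_le; lra.
Qed.

(** Pure real algebra, with primes for the next iteration: [A], [B] are the squared consensus errors
    of x and y, [C], [E] their compression errors, [D] the increment of x, [F] the objective, [G]
    and [H] the squared norms of the gradient and of the mean of y, [S] the accumulated noise, [nu]
    the bound on the current noise. *)
Lemma lyapunov_decrease (lambda A B C E F G H S D A' B' C' E' F' nu : R) :
  0 <= A -> 0 <= B -> 0 <= C -> 0 <= E -> 0 <= G -> 0 <= H -> 0 <= nu ->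
  A' <= (1 - gr) * A + 3 / gr * (nu + 4 * gamma ^+ 2 * (r0 * C) + eta ^+ 2 * B) ->
  D <= 4 * (4 * gamma ^+ 2 * A + nu + 4 * gamma ^+ 2 * (r0 * C) + eta ^+ 2 * (B + n * H)) ->
  B' <= (1 - gr) * B + 3 / gr * (nu + 4 * gamma ^+ 2 * (r0 * E) + L ^+ 2 * D) ->
  C' <= (1 - p / 2) * C + 15 / p * (4 * gamma ^+ 2 * A + 2 * nu
         + 4 * gamma ^+ 2 * (r0 * C) + eta ^+ 2 * (B + n * H)) ->
  E' <= (1 - p / 2) * E + 15 / p * (4 * gamma ^+ 2 * B + 2 * nu
         + 4 * gamma ^+ 2 * (r0 * E) + L ^+ 2 * D) ->
  F' <= F - eta / 2 * G - eta / 2 * H + eta * (L ^+ 2 / n * A + n^-1 * S)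
         + L * (n^-1 * nu + eta ^+ 2 * H) ->
  F' + 2^-1 * A' + s2 * B' + L / n * C' + s2 * E' <=
  F + 2^-1 * A + s2 * B + L / n * C + s2 * E - eta / 4 * (G + A) + eta / n * S
  + noise_coef lambda * nu.
Proof.
move=> A0 B0 C0 E0 G0 H0 nu0 hA hD hB hC hE hF.
have := KA; have := KB; have := KC; have := KE; have := KH; have := KN lambda.
have [e0 s0] := (ltW eta_gt0, ltW s2_gt0).
have c1_ge0 : 0 <= 3 / gr by rewrite divr_ge0// ltW.
have c2_ge0 : 0 <= 15 / p by rewrite divr_ge0// ltW.
have Ln_ge0 : 0 <= L / n by rewrite divr_ge0// ltW.
have l_ge0 : 0 <= L ^+ 2 by exact: sqr_ge0.
have LnE : L * (n^-1 * nu) = L / n * nu by rewrite mulrA.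
have eLE : eta * (L ^+ 2 / n * A) = eta * L ^+ 2 / n * A by rewrite !mulrA.
have enE : eta * (n^-1 * S) = eta / n * S by rewrite mulrA.
move: hA hD hB hC hE hF; rewrite !mulrDr LnE eLE enE.
(* Quotients become opaque variables, and every product of inequalities is supplied by hand, so that
   [lra] sees a problem linear in its monomials. *)
move: (noise_coef lambda) => N.
move: (3 / gr) (15 / p) c1_ge0 c2_ge0 => c1 c2 c1_ge0 c2_ge0.
move: (L / n) Ln_ge0 => ln ln_ge0.
move: (eta * L ^+ 2 / n) => eln.
move=> hA hD hB hC hE hF hN hH hEE hCC hBB hAA.
have h20 : 0 <= 2^-1 :> R by rewrite invr_ge0.
have mA := ler_wpM2l h20 hA.
have mB := ler_wpM2l s0 hB.
have mC := ler_wpM2l ln_ge0 hC.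
have mE := ler_wpM2l s0 hE.
(* [D] enters through both [B'] and [E'], hence two multiples of its bound. *)
have mD1 := ler_wpM2l (mulr_ge0 (mulr_ge0 s0 c1_ge0) l_ge0) hD.
have mD2 := ler_wpM2l (mulr_ge0 (mulr_ge0 s0 c2_ge0) l_ge0) hD.
have kA := mulr_le0_ge0 hAA A0.
have kB := mulr_le0_ge0 hBB B0.
have kC := mulr_le0_ge0 hCC C0.
have kE := mulr_le0_ge0 hEE E0.
have kH := mulr_le0_ge0 hH H0.
have kN := ler_wpM2r nu0 hN.
have kG := mulr_ge0 e0 G0.
by move: kA kB kC kE kH kN kG mA mB mC mE mD1 mD2 hF; lra.
Qed.

End StepSizes.

(** * The Lyapunov recursion in expectation *)

Section Recursion.
Context {R : realType} {n d : nat} {L : R} {dS : measure_display}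
  {S : measurableType dS}.
Variables (f : 'I_n -> 'rV[R]_d -> R) (W : 'M[R]_n) (Q : probability S R)
  (C : S -> 'rV[R]_d -> 'rV[R]_d) (r phi : R).
Hypotheses (n_gt0 : (0 < n)%N) (L_gt0 : 0 < L) (f_smooth : forall i, smooth L (f i))
  (W_sym : W^T = W) (W_ds : doubly_stochastic W)
  (C_meas : measurable_compressor C) (r_gt0 : 0 < r) (phi_range : 0 < phi <= 1)
  (C_contr : contractive_compressor Q C r phi).
Context {dO : measure_display} {Omega : measurableType dO}.
Variables (P : probability Omega R) (s_x s_y q : 'I_n -> R).
Hypotheses (s_x_gt0 : forall i, 0 < s_x i) (s_y_gt0 : forall i, 0 < s_y i)
  (q_range : forall i, 0 < q i < 1).
Variables (xi_x xi_y : nat -> 'I_n -> 'I_d -> {RV P >-> R})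
  (u_x u_y : nat -> 'I_n -> {mfun Omega >-> S}).
Hypotheses
  (xi_x_law : forall k i j, laplace_distributed (xi_x k i j) (s_x i * q i ^+ k))
  (xi_y_law : forall k i j, laplace_distributed (xi_y k i j) (s_y i * q i ^+ k))
  (u_x_law : forall k i A, measurable A -> distribution P (u_x k i) A = Q A)
  (u_y_law : forall k i A, measurable A -> distribution P (u_y k i) A = Q A)
  (indep : mutually_independent P (source_events xi_x xi_y u_x u_y)).
Variables (x0 : 'I_n -> 'rV[R]_d) (eta gamma alpha_x alpha_y p zeta : R).
Hypotheses (alpha_x_range : 0 < alpha_x < r^-1) (alpha_y_range : 0 < alpha_y < r^-1).

Local Notation rho := (spectral_gap W).
Local Notation r0 := (r0_const r phi).
Hypotheses (rho_gt0 : 0 < rho) (p_gt0 : 0 < p)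
  (p_x : p <= alpha_x * r * phi) (p_y : p <= alpha_y * r * phi)
  (zeta_gt0 : 0 < zeta)
  (gammaE : gamma = zeta * rho * p) (etaE : eta = zeta * gamma * rho ^+ 2 / L)
  (zeta_L : zeta * (n%:R / L + 1860 * L) <= n%:R)
  (zeta_n : zeta * ((2 + 18 * n%:R) / L + 576) <= 1)
  (zeta_r0 : zeta * ((2 + 72 * n%:R * r0) / L + 576 + 1024 * r0) <= 1).

Local Notation w := (inputs_at xi_x xi_y u_x u_y).
Local Notation st omega := (pgtc f W C eta gamma alpha_x alpha_y x0 (w omega)).
Local Notation E := (Ex P).

Let L2S := L2_linear_class P.

Let Ltraj k : state_class (L2 P) (fun omega => st omega k).
Proof. exact: (L2_trajectory W L_gt0 f_smooth C_meas r_gt0 C_contr s_x_gt0 s_y_gt0 q_range xi_x_law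
  xi_y_law u_x_law u_y_law indep x0 eta gamma alpha_x alpha_y k). Qed.

Lemma entries_stack (T : Type) (Phi : (T -> R) -> Prop) (V : T -> 'I_n -> 'rV[R]_d) :
  (forall i, entries Phi (fun t => V t i)) -> entries Phi (fun t => stack (V t)).
Proof. by move=> PV i j; under eq_fun do rewrite mxE; exact: PV. Qed.

Lemma entries_mulmx (T : Type) (Phi : (T -> R) -> Prop) (M : 'M[R]_n)
    (V : T -> 'M[R]_(n, d)) : linear_class Phi ->
  entries Phi V -> entries Phi (fun t => M *m V t).
Proof.
move=> PhiL PV i j; have [PD PZ P0] := PhiL; under eq_fun do rewrite mxE.
elim: (index_enum _) => [|k s ih]; first by under eq_fun do rewrite big_nil.
by under eq_fun do rewrite big_cons; apply: PD => //; apply: PZ; exact: PV.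
Qed.

Let xs k omega := stack (st_x (st omega k)).
Let ys k omega := stack (st_y (st omega k)).

Let Lx k : entries (L2 P) (xs k).
Proof. by apply: entries_stack => i; have [] := Ltraj k i. Qed.

Let Ly k : entries (L2 P) (ys k).
Proof. by apply: entries_stack => i; have [] := Ltraj k i. Qed.

(** Random counterparts of the letters of [lyapunov_decrease], given by the second letter of the
    name, with [qm] for [S]. Further, [nx], [ny] are the noises, [dx], [dy] the distortions, [ex],
    [ey] the compressor errors and [cr] the cross term of mean zero. *)
Let qa k omega := sqn (centered (xs k omega)).
Let qb k omega := sqn (centered (ys k omega)).
Let qc k omega := sqn (stack (zx (w omega k) (st omega k))).
Let qe k omega := sqn (stack (zy (w omega k) (st omega k))).
Let qg k omega := sqn (gradient (average f) (mean (st_x (st omega k)))).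
Let qh k omega := sqn (mean (st_y (st omega k))).
Let qf k omega := average f (mean (st_x (st omega k))).
Let qd k omega := sqn (xs k.+1 omega - xs k omega).
Let qm k omega := sqn (\sum_(0 <= t < k) stack (in_xi_y (w omega t))).
Let nx k omega := sqn (stack (in_xi_x (w omega k))).
Let ny k omega := sqn (stack (in_xi_y (w omega k))).
Let dx k omega := distortion_x C r (w omega k) (st omega k).
Let dy k omega := distortion_y C r (w omega k) (st omega k).
Let ex k omega := sqn (stack (err_x C r (w omega k) (st omega k))).
Let ey k omega := sqn (stack (err_y C r (w omega k) (st omega k))).
Let cr k omega := dotm (gradient (average f) (mean (st_x (st omega k))))
                       (mean (in_xi_x (w omega k))).

Let ia k : int1 P (qa k).
Proof.
apply: int1_sqn; apply: (entriesB L2S); first exact: Lx.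
by apply: (entries_mulmx _ L2S); exact: Lx.
Qed.

Let ib k : int1 P (qb k).
Proof.
apply: int1_sqn; apply: (entriesB L2S); first exact: Ly.
by apply: (entries_mulmx _ L2S); exact: Ly.
Qed.

Let ic k : int1 P (qc k).
Proof.
apply: int1_sqn; apply: entries_stack => i.
exact: (L2_zx W L_gt0 f_smooth C_meas r_gt0 C_contr s_x_gt0 s_y_gt0 q_range xi_x_law
  xi_y_law u_x_law u_y_law indep x0 eta gamma alpha_x alpha_y k i).
Qed.

Let ie k : int1 P (qe k).
Proof.
apply: int1_sqn; apply: entries_stack => i.
exact: (L2_zy W L_gt0 f_smooth C_meas r_gt0 C_contr s_x_gt0 s_y_gt0 q_range xi_x_law
  xi_y_law u_x_law u_y_law indep x0 eta gamma alpha_x alpha_y k i).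
Qed.

Let Lgrad k : entries (L2 P)
  (fun omega => gradient (average f) (mean (st_x (st omega k)))).
Proof.
exact: (L2_grad_mean W L_gt0 f_smooth C_meas r_gt0 C_contr s_x_gt0 s_y_gt0 q_range xi_x_law
  xi_y_law u_x_law u_y_law indep x0 eta gamma alpha_x alpha_y k).
Qed.

Let ig k : int1 P (qg k). Proof. by apply: int1_sqn; exact: Lgrad. Qed.

Let Lmean k : entries (L2 P) (fun omega => mean (st_x (st omega k))).
Proof. by apply: (entries_mean L2S) => i; have [] := Ltraj k i. Qed.

Let ih k : int1 P (qh k).
Proof. by apply: int1_sqn; apply: (entries_mean L2S) => i; have [] := Ltraj k i. Qed.

Let id_ k : int1 P (qd k).
Proof. by apply: int1_sqn; apply: (entriesB L2S); exact: Lx. Qed.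

Let nu k : R := 2 * n%:R * d%:R * (q_bar q ^+ (2 * k) * s_bar s_x s_y ^+ 2).

Let Enx k : int1 P (nx k) /\ E (nx k) <= nu k.
Proof. exact: (Ex_noise_x n_gt0 s_y s_x_gt0 q_range xi_y u_x u_y xi_x_law k). Qed.

Let Eny k : int1 P (ny k) /\ E (ny k) <= nu k.
Proof. exact: (Ex_noise_y n_gt0 s_x s_y_gt0 q_range xi_x u_x u_y xi_y_law k). Qed.

Let Eex k : int1 P (ex k) /\ E (ex k) <= (1 - phi) * E (qc k).
Proof.
exact: (Ex_err_x W L_gt0 f_smooth C_meas r_gt0 C_contr s_x_gt0 s_y_gt0 q_range xi_x_law
  xi_y_law u_x_law u_y_law indep x0 eta gamma alpha_x alpha_y k).
Qed.

Let Eey k : int1 P (ey k) /\ E (ey k) <= (1 - phi) * E (qe k).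
Proof.
exact: (Ex_err_y W L_gt0 f_smooth C_meas r_gt0 C_contr s_x_gt0 s_y_gt0 q_range xi_x_law
  xi_y_law u_x_law u_y_law indep x0 eta gamma alpha_x alpha_y k).
Qed.

Let Ecr k : int1 P (cr k) /\ E (cr k) = 0.
Proof.
exact: (Ex_grad_noise W n_gt0 L_gt0 f_smooth C_meas r_gt0 C_contr s_x_gt0 s_y_gt0 q_range xi_x_law
  xi_y_law u_x_law u_y_law indep x0 eta gamma alpha_x alpha_y k).
Qed.

Let Edx k : int1 P (dx k) /\ E (dx k) <= r0 * E (qc k).
Proof.
have [iex Ee] := Eex k.
have i1 : int1 P (fun omega => 2 * r ^+ 2 * ex k omega) by exact: int1Z.
have i2 : int1 P (fun omega => 2 * (1 - r) ^+ 2 * qc k omega) by exact: int1Z.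
split; first exact: int1D.
rewrite [X in E X](_ : _ = fun o => 2 * r ^+ 2 * ex k o + 2 * (1 - r) ^+ 2 * qc k o)//.
rewrite (ExD i1 i2) (ExZ _ iex) (ExZ _ (ic k)) /r0_const [leRHS]mulrDl lerD2r.
by rewrite -[leRHS]mulrA ler_wpM2l// mulr_ge0// sqr_ge0.
Qed.

Let Edy k : int1 P (dy k) /\ E (dy k) <= r0 * E (qe k).
Proof.
have [iey Ee] := Eey k.
have i1 : int1 P (fun omega => 2 * r ^+ 2 * ey k omega) by exact: int1Z.
have i2 : int1 P (fun omega => 2 * (1 - r) ^+ 2 * qe k omega) by exact: int1Z.
split; first exact: int1D.
rewrite [X in E X](_ : _ = fun o => 2 * r ^+ 2 * ey k o + 2 * (1 - r) ^+ 2 * qe k o)//.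
rewrite (ExD i1 i2) (ExZ _ iey) (ExZ _ (ie k)) /r0_const [leRHS]mulrDl lerD2r.
by rewrite -[leRHS]mulrA ler_wpM2l// mulr_ge0// sqr_ge0.
Qed.

Let im k : int1 P (qm k).
Proof.
apply: int1_sqn.
exact: (L2_noise_sum s_x_gt0 s_y_gt0 q_range u_x u_y xi_x_law xi_y_law k).
Qed.

(** The descent lemma from [0] to [x] bounds the objective from above, and from [x] to [0] from
    below, by squares of [x] and of gradients, which are integrable. *)
Let if_ k : int1 P (qf k).
Proof.
have fL := smooth_average n_gt0 L_gt0 f_smooth.
pose X omega := mean (st_x (st omega k)).
have iX : int1 P (fun omega => sqn (X omega)) by apply: int1_sqn; exact: Lmean.
pose g0 := gradient (average f) 0.
have iB : int1 P (fun omega => `|average f 0| + sqn g0 + (qg k omega + (1 + L) * sqn (X omega))).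
  by apply: int1D; [exact: int1_cst|apply: int1D => //; exact: int1Z].
apply: le_int1 iB.
  by apply: (measurable_smooth fL) => j; have [] := Lmean k 0 j.
move=> omega; rewrite /qf -/(X omega); set x := X omega.
have h1 := descent_lemma 0 x L_gt0 fL; have h2 := descent_lemma x 0 L_gt0 fL.
have y1 := dotm_young g0 (x - 0) ltr01.
have y2 := dotm_young (gradient (average f) x) (0 - x) ltr01.
rewrite -/g0 in h1; rewrite invr1 !mul1r in y1 y2.
rewrite sub0r sqnN in h2 y2; rewrite subr0 in h1 y1.
have := ler_norm (average f 0); have := ler_norm (- average f 0); rewrite normrN.
have := sqn_ge0 g0; have := sqn_ge0 x; have := sqn_ge0 (gradient (average f) x).
rewrite /qg -/(X omega) -/x.
by move=> p1 p2 p3 p4 p5; rewrite ler_norml; apply/andP; split; nra.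
Qed.

Let n_ge1 : 1 <= n%:R :> R. Proof. by rewrite ler1n. Qed.
Let rho_le1 : rho <= 1. Proof. exact: spectral_gap_le1. Qed.

Let p_le1 : p <= 1.
Proof.
apply: (le_trans p_x); have /andP[ax0 axr] := alpha_x_range; have /andP[f0 f1] := phi_range.
have ar : alpha_x * r < 1 by rewrite -lter_pdivlMr// div1r.
by rewrite mulr_ile1// ?mulr_ge0// ltW.
Qed.

Let r0_ge0 : 0 <= r0.
Proof.
have /andP[f0 f1] := phi_range.
have r2 : 0 <= 2 * r ^+ 2 by rewrite mulr_ge0// sqr_ge0.
by apply: addr_ge0; apply: mulr_ge0; rewrite ?subr_ge0// sqr_ge0.
Qed.

Let gr_le : 576 * (gamma * rho) <= 1.
Proof.
rewrite gammaE; exact: (gr_small n_ge1 L_gt0 rho_gt0 rho_le1 p_le1 zeta_gt0 zeta_n).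
Qed.

Let gamma_gt0 : 0 < gamma. Proof. by rewrite gammaE !mulr_gt0. Qed.
Let gr_gt0 : 0 < gamma * rho. Proof. exact: mulr_gt0. Qed.
Let eta_gt0 : 0 < eta. Proof. by rewrite etaE divr_gt0// !mulr_gt0// exprn_gt0. Qed.

Let zeta_le : 576 * zeta <= 1.
Proof.
apply: le_trans zeta_n; rewrite mulrDr [576 * _]mulrC lerDr.
by nonneg.
Qed.

Let gamma_small : 576 * gamma <= 1.
Proof.
have rp : rho * p <= 1 by apply: mulr_ile1 => //; exact: ltW.
have : gamma <= zeta by rewrite gammaE -mulrA; apply: ler_piMr => //; exact: ltW.
by have := zeta_le; lra.
Qed.

Let gamma_le1 : gamma <= 1.
Proof. by have := gamma_small; have := gamma_gt0; lra. Qed.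

Let gr_lt1 : gamma * rho < 1.
Proof. by have := gr_le; have := gr_gt0; lra. Qed.

Let nu_ge0 k : 0 <= nu k.
Proof.
rewrite /nu exprM; apply: mulr_ge0; first by rewrite !mulr_ge0.
by apply: mulr_ge0; [apply: exprn_ge0|]; exact: sqr_ge0.
Qed.

(** The compression error at [k.+1] contains the noise of iteration [k.+1]. Bounding it by [nu k]
    merges it with the current noise, whence [2 * nu k] in [recC] and [recE]. *)
Let nu_le k : nu k.+1 <= nu k.
Proof.
have /andP[qb0 qb1] := q_bar_range n_gt0 q_range.
rewrite /nu ler_wpM2l ?mulr_ge0//; rewrite ler_wpM2r ?sqr_ge0//.
by apply: ler_wiXn2l; rewrite ?(ltW qb0) ?(ltW qb1)// leq_mul2l leqnSn orbT.
Qed.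

Let c3_ge0 : 0 <= 3 / (gamma * rho). Proof. by rewrite divr_ge0// ltW. Qed.
Let g4_ge0 : 0 <= 4 * gamma ^+ 2. Proof. by rewrite mulr_ge0// sqr_ge0. Qed.
Let e2_ge0 : 0 <= eta ^+ 2. Proof. exact: sqr_ge0. Qed.
Let l2_ge0 : 0 <= L ^+ 2. Proof. exact: sqr_ge0. Qed.

Let lhat_le1 : (1 - gamma * rho) ^+ 2 <= 1.
Proof.
by rewrite expr_le1// ?subr_ge0 ?(ltW gr_lt1)// lerBlDr lerDl ltW.
Qed.

Let lhat_noise x y : x <= y -> 0 <= y -> (1 - gamma * rho) ^+ 2 * x <= y.
Proof.
move=> xy y0; apply: (@le_trans _ _ ((1 - gamma * rho) ^+ 2 * y)).
  by rewrite ler_wpM2l// sqr_ge0.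
by rewrite ler_piMl.
Qed.

Let recA k : E (qa k.+1) <= (1 - gamma * rho) * E (qa k) +
  3 / (gamma * rho) * (nu k + 4 * gamma ^+ 2 * (r0 * E (qc k)) + eta ^+ 2 * E (qb k)).
Proof.
have [inx bn] := Enx k; have [idx bd] := Edx k.
pose l := [:: (1 - gamma * rho, qa k);
  (3 / (gamma * rho) * (1 - gamma * rho) ^+ 2, nx k);
  (3 / (gamma * rho) * (4 * gamma ^+ 2), dx k);
  (3 / (gamma * rho) * eta ^+ 2, qb k)].
have h : E (qa k.+1) <= \sum_(t <- l) t.1 * E t.2.
  apply: (Ex_le_lincomb (l := l) (ia k.+1)
    (conj (ia k) (conj inx (conj idx (conj (ib k) I))))) => omega.
  apply: (le_trans (consensus_x_step f C eta alpha_x alpha_y n_gt0 W_sym W_ds r_gt0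
     gamma_gt0 gamma_le1 rho_gt0 gr_lt1 (w omega k) (st omega k))).
  rewrite /l !big_cons big_nil /= /qa /qb /nx /dx /xs /ys le_eqVlt; apply/orP; left.
  by apply/eqP; ring.
apply: (le_trans h); rewrite /l !big_cons big_nil /=.
have n1 := ler_wpM2l c3_ge0 (lhat_noise bn (nu_ge0 k)).
have d1 := ler_wpM2l (mulr_ge0 c3_ge0 g4_ge0) bd.
by move: (3 / _) n1 d1 => c n1 d1; lra.
Qed.

Let recD k : E (qd k) <= 4 * (4 * gamma ^+ 2 * E (qa k) + nu k
  + 4 * gamma ^+ 2 * (r0 * E (qc k)) + eta ^+ 2 * (E (qb k) + n%:R * E (qh k))).
Proof.
have [inx bn] := Enx k; have [idx bd] := Edx k.
pose l := [:: (4 * (4 * gamma ^+ 2), qa k); (4, nx k); (4 * (4 * gamma ^+ 2), dx k);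
  (4 * eta ^+ 2, qb k); (4 * eta ^+ 2 * n%:R, qh k)].
have h : E (qd k) <= \sum_(t <- l) t.1 * E t.2.
  apply: (Ex_le_lincomb (l := l) (id_ k)
    (conj (ia k) (conj inx (conj idx (conj (ib k) (conj (ih k) I)))))) => omega.
  apply: (le_trans (increment_x_step f C eta alpha_x alpha_y n_gt0 W_ds r_gt0
     gamma_gt0 gamma_le1 (w omega k) (st omega k))).
  rewrite /l !big_cons big_nil /= /qa /qb /nx /dx /qh /xs /ys le_eqVlt; apply/orP; left.
  by apply/eqP; ring.
apply: (le_trans h); rewrite /l !big_cons big_nil /=.
have bd' := ler_wpM2l g4_ge0 bd.
by move: bn bd'; lra.
Qed.

Let recB k : E (qb k.+1) <= (1 - gamma * rho) * E (qb k) +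
  3 / (gamma * rho) * (nu k + 4 * gamma ^+ 2 * (r0 * E (qe k)) + L ^+ 2 * E (qd k)).
Proof.
have [iny bn] := Eny k; have [idy bd] := Edy k.
pose l := [:: (1 - gamma * rho, qb k);
  (3 / (gamma * rho) * (1 - gamma * rho) ^+ 2, ny k);
  (3 / (gamma * rho) * (4 * gamma ^+ 2), dy k);
  (3 / (gamma * rho) * L ^+ 2, qd k)].
have h : E (qb k.+1) <= \sum_(t <- l) t.1 * E t.2.
  apply: (Ex_le_lincomb (l := l) (ib k.+1)
    (conj (ib k) (conj iny (conj idy (conj (id_ k) I))))) => omega.
  apply: (le_trans (consensus_y_step C eta alpha_x alpha_y n_gt0 L_gt0 f_smooth W_sym W_ds
     r_gt0 gamma_gt0 gamma_le1 rho_gt0 gr_lt1 (w omega k) (st omega k))).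
  rewrite /l !big_cons big_nil /= /qb /ny /dy /qd /xs /ys le_eqVlt; apply/orP; left.
  by apply/eqP; ring.
apply: (le_trans h); rewrite /l !big_cons big_nil /=.
have n1 := ler_wpM2l c3_ge0 (lhat_noise bn (nu_ge0 k)).
have d1 := ler_wpM2l (mulr_ge0 c3_ge0 g4_ge0) bd.
by move: (3 / _) n1 d1 => c n1 d1; lra.
Qed.

(** [(1 + p / 2) (1 - p) <= 1 - p / 2]: half of the gain [p] pays for Young's inequality. *)
Let contraction a (c e : R) : 0 <= a -> p <= a * phi -> 0 <= c -> e <= (1 - phi) * c ->
  (1 + p / 2) * (a * e + (1 - a) * c) <= (1 - p / 2) * c.
Proof.
move=> a0 pa c0 ec; have p0 := p_gt0; have p1 := p_le1.
apply: (@le_trans _ _ ((1 + p / 2) * ((1 - p) * c))).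
  apply: ler_wpM2l; first by lra.
  have h1 := ler_wpM2l a0 ec; have h2 := ler_wpM2r c0 pa; lra.
by rewrite mulrA; apply: ler_wpM2r => //; nra.
Qed.

Let c5_le : (1 + 2 / p) * 5 <= 15 / p.
Proof.
have p0 := p_gt0; have p1 := p_le1.
by rewrite ler_pdivlMr// mulrAC mulrDl mul1r divfK ?lt0r_neq0//; lra.
Qed.

Let g4_le1 : 4 * gamma ^+ 2 <= 1.
Proof. by have := gamma_small; have := gamma_gt0; nra. Qed.

Let qa_ge0 k : 0 <= E (qa k). Proof. by apply: Ex_ge0 => omega; exact: sqn_ge0. Qed.
Let qb_ge0 k : 0 <= E (qb k). Proof. by apply: Ex_ge0 => omega; exact: sqn_ge0. Qed.
Let qc_ge0 k : 0 <= E (qc k). Proof. by apply: Ex_ge0 => omega; exact: sqn_ge0. Qed.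
Let qe_ge0 k : 0 <= E (qe k). Proof. by apply: Ex_ge0 => omega; exact: sqn_ge0. Qed.
Let qd_ge0 k : 0 <= E (qd k). Proof. by apply: Ex_ge0 => omega; exact: sqn_ge0. Qed.
Let qg_ge0 k : 0 <= E (qg k). Proof. by apply: Ex_ge0 => omega; exact: sqn_ge0. Qed.
Let qh_ge0 k : 0 <= E (qh k). Proof. by apply: Ex_ge0 => omega; exact: sqn_ge0. Qed.
Let a_x_ge0 : 0 <= alpha_x * r.
Proof. by have /andP[a0 _] := alpha_x_range; rewrite mulr_ge0// ltW. Qed.
Let a_y_ge0 : 0 <= alpha_y * r.
Proof. by have /andP[a0 _] := alpha_y_range; rewrite mulr_ge0// ltW. Qed.

Let compression_bound (I I' : R) : I <= I' -> 0 <= I' ->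
  (1 + 2 / p) * 5 * I <= 15 / p * I'.
Proof.
move=> II I0; have c0 : 0 <= (1 + 2 / p) * 5.
  by rewrite mulr_ge0// addr_ge0// divr_ge0// ltW.
exact: le_trans (ler_wpM2l c0 II) (ler_wpM2r I0 c5_le).
Qed.

Let noise_small (x y : R) : x <= y -> 0 <= y -> 4 * gamma ^+ 2 * x <= y.
Proof.
move=> xy y0; apply: (le_trans (ler_wpM2l g4_ge0 xy)).
by rewrite ler_piMl.
Qed.

Let recC k : E (qc k.+1) <= (1 - p / 2) * E (qc k) +
  15 / p * (4 * gamma ^+ 2 * E (qa k) + 2 * nu k + 4 * gamma ^+ 2 * (r0 * E (qc k))
            + eta ^+ 2 * (E (qb k) + n%:R * E (qh k))).
Proof.
have [inx bn] := Enx k; have [idx bd] := Edx k; have [iex be] := Eex k.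
have [inx' bn'] := Enx k.+1.
pose c := (1 + 2 / p) * 5.
pose l := [:: ((1 + p / 2) * (alpha_x * r), ex k);
  ((1 + p / 2) * (1 - alpha_x * r), qc k); (c * (4 * gamma ^+ 2), qa k);
  (c * (4 * gamma ^+ 2), nx k); (c * (4 * gamma ^+ 2), dx k);
  (c * eta ^+ 2, qb k); (c * eta ^+ 2 * n%:R, qh k); (c, nx k.+1)].
have h : E (qc k.+1) <= \sum_(t <- l) t.1 * E t.2.
  apply: (Ex_le_lincomb (l := l) (ic k.+1)
    (conj iex (conj (ic k) (conj (ia k) (conj inx (conj idx (conj (ib k)
      (conj (ih k) (conj inx' I))))))))) => omega.
  apply: (le_trans (compression_x_step f C eta gamma alpha_y n_gt0 W_ds r_gt0
     alpha_x_range p_gt0 (w omega k) (w omega k.+1) (st omega k))).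
  rewrite /l !big_cons big_nil /= /qa /qb /qc /nx /dx /qh /ex /xs /ys /c.
  rewrite le_eqVlt; apply/orP; left.
  by apply/eqP; ring.
apply: (le_trans h); rewrite /l !big_cons big_nil /=.
have h1 := contraction a_x_ge0 p_x (qc_ge0 k) be.
have I0 : 0 <= 4 * gamma ^+ 2 * E (qa k) + 2 * nu k + 4 * gamma ^+ 2 * (r0 * E (qc k))
            + eta ^+ 2 * (E (qb k) + n%:R * E (qh k)).
  have m0 : 0 <= 2 * nu k by rewrite mulr_ge0.
  by rewrite !addr_ge0// mulr_ge0// ?mulr_ge0// addr_ge0// mulr_ge0.
have n1 := noise_small bn (nu_ge0 k); have n2 := le_trans bn' (nu_le k).
have d1 := ler_wpM2l g4_ge0 bd.
have II : 4 * gamma ^+ 2 * E (qa k) + 4 * gamma ^+ 2 * E (nx k) + 4 * gamma ^+ 2 * E (dx k)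
  + eta ^+ 2 * (E (qb k) + n%:R * E (qh k)) + E (nx k.+1) <=
  4 * gamma ^+ 2 * E (qa k) + 2 * nu k + 4 * gamma ^+ 2 * (r0 * E (qc k))
            + eta ^+ 2 * (E (qb k) + n%:R * E (qh k)).
  by move: n1 n2 d1; lra.
have h2 := compression_bound II I0; rewrite -/c in h2.
clear l h; move: (15 / p * _) h1 h2 => X; move: c => c h1 h2.
by lra.
Qed.

Let recE k : E (qe k.+1) <= (1 - p / 2) * E (qe k) +
  15 / p * (4 * gamma ^+ 2 * E (qb k) + 2 * nu k + 4 * gamma ^+ 2 * (r0 * E (qe k))
            + L ^+ 2 * E (qd k)).
Proof.
have [iny bn] := Eny k; have [idy bd] := Edy k; have [iey be] := Eey k.
have [iny' bn'] := Eny k.+1.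
pose c := (1 + 2 / p) * 5.
pose l := [:: ((1 + p / 2) * (alpha_y * r), ey k);
  ((1 + p / 2) * (1 - alpha_y * r), qe k); (c * (4 * gamma ^+ 2), qb k);
  (c * (4 * gamma ^+ 2), ny k); (c * (4 * gamma ^+ 2), dy k);
  (c * L ^+ 2, qd k); (c, ny k.+1)].
have h : E (qe k.+1) <= \sum_(t <- l) t.1 * E t.2.
  apply: (Ex_le_lincomb (l := l) (ie k.+1)
    (conj iey (conj (ie k) (conj (ib k) (conj iny (conj idy (conj (id_ k)
      (conj iny' I)))))))) => omega.
  apply: (le_trans (compression_y_step C eta gamma alpha_x L_gt0 f_smooth W_ds r_gt0
     alpha_y_range p_gt0 (w omega k) (w omega k.+1) (st omega k))).
  rewrite /l !big_cons big_nil /= /qd /qb /qe /ny /dy /ey /xs /ys /c.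
  rewrite le_eqVlt; apply/orP; left.
  by apply/eqP; ring.
apply: (le_trans h); rewrite /l !big_cons big_nil /=.
have h1 := contraction a_y_ge0 p_y (qe_ge0 k) be.
have I0 : 0 <= 4 * gamma ^+ 2 * E (qb k) + 2 * nu k + 4 * gamma ^+ 2 * (r0 * E (qe k))
            + L ^+ 2 * E (qd k).
  have m0 : 0 <= 2 * nu k by rewrite mulr_ge0.
  by rewrite !addr_ge0// mulr_ge0// mulr_ge0.
have n1 := noise_small bn (nu_ge0 k); have n2 := le_trans bn' (nu_le k).
have d1 := ler_wpM2l g4_ge0 bd.
have II : 4 * gamma ^+ 2 * E (qb k) + 4 * gamma ^+ 2 * E (ny k) + 4 * gamma ^+ 2 * E (dy k)
  + L ^+ 2 * E (qd k) + E (ny k.+1) <=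
  4 * gamma ^+ 2 * E (qb k) + 2 * nu k + 4 * gamma ^+ 2 * (r0 * E (qe k))
            + L ^+ 2 * E (qd k).
  by move: n1 n2 d1; lra.
have h2 := compression_bound II I0; rewrite -/c in h2.
clear l h; move: (15 / p * _) h1 h2 => X; move: c => c h1 h2.
by lra.
Qed.

Let tracking k omega :
  mean (st_y (st omega k)) - mean (fun i => gradient (f i) (st_x (st omega k) i)) =
  mean (fun i => row i (\sum_(0 <= t < k) stack (in_xi_y (w omega t)))).
Proof.
elim: k => [|k IH].
  by rewrite /= subrr /mean big1 ?scaler0// => i _; rewrite big_geq// row0.
rewrite big_nat_recr//=.
rewrite [LHS](mean_y_step f C eta gamma alpha_x alpha_y W_ds (w omega k) (st omega k)) IH.
rewrite /mean -scalerDr -big_split/=; congr (_ *: _); apply: eq_bigr => i _.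
by rewrite linearD; congr (_ + _); apply/rowP => j; rewrite !mxE.
Qed.

Let recF k : E (qf k.+1) <= E (qf k) - eta / 2 * E (qg k) - eta / 2 * E (qh k)
  + eta * (L ^+ 2 / n%:R * E (qa k) + n%:R^-1 * E (qm k))
  + L * (n%:R^-1 * nu k + eta ^+ 2 * E (qh k)).
Proof.
have [inx bn] := Enx k; have [icr cr0] := Ecr k.
pose l := [:: (1, qf k); (1, cr k); (- (eta / 2), qg k); (- (eta / 2), qh k);
  (eta * (L ^+ 2 / n%:R), qa k); (eta * n%:R^-1, qm k); (L * n%:R^-1, nx k);
  (L * eta ^+ 2, qh k)].
have h : E (qf k.+1) <= \sum_(t <- l) t.1 * E t.2.
  apply: (Ex_le_lincomb (l := l) (if_ k.+1)
    (conj (if_ k) (conj icr (conj (ig k) (conj (ih k) (conj (ia k) (conj (im k)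
      (conj inx (conj (ih k) I))))))))) => omega.
  apply: (le_trans (objective_step C gamma alpha_x alpha_y n_gt0 L_gt0 f_smooth W_ds
     eta_gt0 (w omega k) (tracking k omega))).
  rewrite /l !big_cons big_nil /= /qf /cr /qg /qh /qa /qm /nx /xs.
  rewrite le_eqVlt; apply/orP; left.
  by apply/eqP; ring.
apply: (le_trans h); rewrite /l !big_cons big_nil /= cr0.
have n1 : L * n%:R^-1 * E (nx k) <= L * n%:R^-1 * nu k.
  by apply: ler_wpM2l => //; rewrite divr_ge0// ltW.
by move: n%:R^-1 (L ^+ 2 / n%:R) n1 => a b n1; lra.
Qed.

Let s2 := zeta * rho ^+ 2 / (n%:R * L).
(** The Lyapunov function without the constant [f^*], which cancels in differences and returns in
    [descent_sum] as a lower bound on the last value. *)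
Let V k := E (qf k) + 2^-1 * E (qa k) + s2 * E (qb k) + L / n%:R * E (qc k) + s2 * E (qe k).

Let decrease lambda k : V k.+1 <= V k - eta / 4 * (E (qg k) + E (qa k)) + eta / n%:R * E (qm k)
  + @noise_coef R n%:R L rho p zeta lambda * nu k.
Proof.
have := @lyapunov_decrease R n%:R L rho p zeta r0 n_ge1 L_gt0 rho_gt0 rho_le1 p_gt0 p_le1
  zeta_gt0 r0_ge0 zeta_L zeta_n zeta_r0 lambda.
cbv zeta; rewrite -gammaE -etaE => H.
exact: (H _ _ _ _ _ _ _ _ _ _ _ _ _ _ _ (qa_ge0 k) (qb_ge0 k) (qc_ge0 k) (qe_ge0 k)
  (qg_ge0 k) (qh_ge0 k) (nu_ge0 k) (recA k) (recD k) (recB k) (recC k) (recE k) (recF k)).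
Qed.

Let noise_sums T : \sum_(0 <= k < T.+1) E (qm k) <= T%:R * E (qm T).
Proof.
have m0 : E (qm 0) = 0.
  rewrite -[RHS](Ex_cst P 0); congr (E _); apply/funext => omega.
  by rewrite /qm big_geq// sqn0.
rewrite big_nat_recl// m0 add0r.
apply: (@le_trans _ _ (\sum_(0 <= k < T) E (qm T))); last first.
  by rewrite sumr_const_nat subn0 mulr_natl.
rewrite big_nat [leRHS]big_nat; apply: ler_sum => k /andP[_ kT].
exact: (Ex_noise_sum_le s_x_gt0 s_y_gt0 q_range xi_x_law xi_y_law indep kT).
Qed.

Let telescoped lambda T : eta / 4 * \sum_(0 <= k < T) (E (qg k) + E (qa k)) + V T <=
  V 0 + eta / n%:R * \sum_(0 <= k < T) E (qm k)
  + \sum_(0 <= k < T) @noise_coef R n%:R L rho p zeta lambda * nu k.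
Proof.
elim: T => [|k IH]; first by rewrite !big_geq// !mulr0 add0r !addr0.
rewrite !big_nat_recr//= !mulrDr.
by have := decrease lambda k; move: IH; rewrite !mulrDr; lra.
Qed.

Lemma descent_sum (lambda fmin : R) (T : nat) : (forall x, fmin <= average f x) ->
  eta / 4 * \sum_(0 <= k < T.+1)
    (E (fun omega => sqn (gradient (average f) (mean (st_x (st omega k)))))
     + E (fun omega => sqn (centered (stack (st_x (st omega k)))))) <=
  E (fun omega => average f (mean (st_x (st omega 0)))) - fmin
  + 2^-1 * E (fun omega => sqn (centered (stack (st_x (st omega 0)))))
  + zeta * rho ^+ 2 / (n%:R * L) * E (fun omega => sqn (centered (stack (st_y (st omega 0)))))
  + L / n%:R * E (fun omega => sqn (stack (zx (w omega 0) (st omega 0))))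
  + zeta * rho ^+ 2 / (n%:R * L) * E (fun omega => sqn (stack (zy (w omega 0) (st omega 0))))
  + eta / n%:R * (T%:R * E (fun omega => sqn (\sum_(0 <= t < T) stack (in_xi_y (w omega t)))))
  + \sum_(0 <= k < T.+1) @noise_coef R n%:R L rho p zeta lambda
      * (2 * n%:R * d%:R * (q_bar q ^+ (2 * k) * s_bar s_x s_y ^+ 2)).
Proof.
move=> fmin_le.
have fV : fmin <= V T.+1.
  apply: (@le_trans _ _ (E (qf T.+1))).
    by rewrite -[leLHS](Ex_cst P); apply: Ex_le (int1_cst P _) (if_ _) _ => omega;
    exact: fmin_le.
  have s20 : 0 <= s2 by rewrite /s2 divr_ge0 ?mulr_ge0 ?sqr_ge0// ltW.
  by rewrite /V -!addrA lerDl !addr_ge0// mulr_ge0// divr_ge0// ltW.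
have en0 : 0 <= eta / n%:R by rewrite divr_ge0// ltW.
have h1 := telescoped lambda T.+1; have h2 := ler_wpM2l en0 (noise_sums T).
have key : eta / 4 * \sum_(0 <= k < T.+1) (E (qg k) + E (qa k)) <= V 0 - fmin
  + eta / n%:R * (T%:R * E (qm T)) + \sum_(0 <= k < T.+1) @noise_coef R n%:R L rho p zeta lambda * nu k.
  by move: h1 h2 fV; move: (V _) (V _) => v v'; lra.
apply: (le_trans key); rewrite le_eqVlt; apply/orP; left; apply/eqP.
congr (_ + _ + _); rewrite /V /s2 /qf /qa /qb /qc /qe /xs /ys.
by ring.
Qed.

Lemma integrable_terms k :
  [/\ int1 P (fun omega => average f (mean (st_x (st omega k)))),
      int1 P (fun omega => sqn (gradient (average f) (mean (st_x (st omega k))))),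
      int1 P (fun omega => sqn (centered (stack (st_x (st omega k))))),
      int1 P (fun omega => sqn (centered (stack (st_y (st omega k))))) &
      int1 P (fun omega => sqn (stack (zx (w omega k) (st omega k)))) /\
      int1 P (fun omega => sqn (stack (zy (w omega k) (st omega k))))].
Proof.
by split; [exact: if_|exact: ig|exact: ia|exact: ib|split; [exact: ic|exact: ie]].
Qed.

End Recursion.

(** * From the recursion to the stated constants *)

(** [F] receives the index along with the entry, because the summands multiply an entry by a second
    quantity that depends on the index. *)
Lemma sum_col4 (R : realType) (V : nmodType) (a b c e : R) (F : R -> 'I_4 -> V) :
  \sum_(i < 4) F (col4 a b c e i 0) i =
  F a 0 + (F b 1 + (F c 2%:R + F e 3%:R)).
Proof.
rewrite !big_ord_recl big_ord0 addr0 !mxE /=.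
by do ![congr (_ + _)]; congr F; apply/val_inj.
Qed.

(** Positive real denominators can be multiplied out in the extended reals, which turns entries of
    the minimum into bounds over [R]. *)
Lemma le_zeta_bar1 (R : realType) (n : nat) (L lambda r0 phi1 zeta : R) :
  (0 < n)%N -> 0 < L -> 0 <= r0 -> (zeta%:E <= zeta_bar1 n L lambda r0 phi1)%E ->
  [/\ zeta * (n%:R / L + 1860 * L) <= n%:R,
      zeta * ((2 + 18 * n%:R) / L + 576) <= 1 &
      zeta * ((2 + 72 * n%:R * r0) / L + 576 + 1024 * r0) <= 1].
Proof.
move=> n_gt0 L_gt0 r0_ge0; rewrite /zeta_bar1 !big_cons big_nil !le_min.
have divE (a b : R) : 0 < b -> (zeta%:E <= a%:E / b%:E)%E -> zeta * b <= a.
  by move=> b0; rewrite inver (gt_eqF b0) -EFinM lee_fin ler_pdivlMr.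
have nR : 0 < n%:R :> R by rewrite ltr0n.
move=> /and5P[_ h1 h2 h3 _]; split.
- have b0 : 0 < n%:R / L + 1860 * L.
    have c0 : 0 < 1860 :> R by rewrite ltr0n.
    by apply: addr_gt0; [exact: divr_gt0|exact: mulr_gt0].
  have bE : 2 * L * (n%:R / (2 * L ^+ 2) + 930) = n%:R / L + 1860 * L.
    by field; rewrite lt0r_neq0.
  by rewrite -bE; apply: divE h1; rewrite bE.
- by apply: divE h2; rewrite addr_gt0 ?ltr0n// divr_gt0// addr_gt0// mulr_gt0.
- apply: divE h3.
  have a0 : 0 <= (2 + 72 * n%:R * r0) / L.
    by rewrite divr_ge0 ?(ltW L_gt0)// addr_ge0 ?ler0n// !mulr_ge0 ?ler0n.
  by lra.
Qed.

Lemma b1_noise_coef (R : realType) (n d : nat) (L lambda rho p zeta : R) :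
  (0 < n)%N -> 0 < L ->
  let gamma := zeta * rho * p in
  let eta := zeta * gamma * rho ^+ 2 / L in
  b1_const n d L lambda rho gamma eta p zeta =
  2 * n%:R * d%:R * @noise_coef R n%:R L rho p zeta lambda + (eta^-1 + L) * n%:R.
Proof.
move=> n_gt0 L_gt0 gamma eta; rewrite /b1_const; congr (_ + _).
have n0 : n%:R != 0 :> R by rewrite pnatr_eq0 -lt0n.
have L0 : L != 0 by rewrite lt0r_neq0.
rewrite /vartheta2 /= -scalemxAr mxE; congr (_ * _).
rewrite mxE /s_const; under eq_bigr do rewrite [(_^T) _ _]mxE.
rewrite (sum_col4 _ _ _ _ (fun a i => a * col4 _ _ _ _ i 0)) !mxE /=.
rewrite /noise_coef !addrA; congr (_ * _ + _ + _ * _ + _).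
- by field; rewrite n0.
- by rewrite mul1r.
Qed.

Lemma lyapunovE (R : realType) (dO : measure_display) (Omega : measurableType dO)
    (P : probability Omega R) (n d : nat) (S : Type) (f : 'I_n -> 'rV[R]_d -> R)
    (L rho zeta fmin : R) (w : Omega -> nat -> pgtc_input R n d S)
    (st : Omega -> nat -> pgtc_state R n d) (k : nat) :
  (0 < n)%N -> 0 < L -> optimal_value (average f) = fmin%:E ->
  int1 P (fun omega => average f (mean (st_x (st omega k)))) ->
  int1 P (fun omega => sqn (centered (stack (st_x (st omega k))))) ->
  int1 P (fun omega => sqn (centered (stack (st_y (st omega k))))) ->
  int1 P (fun omega => sqn (stack (zx (w omega k) (st omega k)))) ->
  int1 P (fun omega => sqn (stack (zy (w omega k) (st omega k)))) ->
  lyapunov P f (s_const n L rho zeta) w st k =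
  (Ex P (fun omega => average f (mean (st_x (st omega k)))) - fmin
  + 2^-1 * Ex P (fun omega => sqn (centered (stack (st_x (st omega k)))))
  + zeta * rho ^+ 2 / (n%:R * L) * Ex P (fun omega => sqn (centered (stack (st_y (st omega k)))))
  + L / n%:R * Ex P (fun omega => sqn (stack (zx (w omega k) (st omega k))))
  + zeta * rho ^+ 2 / (n%:R * L)
    * Ex P (fun omega => sqn (stack (zy (w omega k) (st omega k)))))%:E.
Proof.
move=> n_gt0 L_gt0 fE i_f ia ib ic ie.
have n0 : n%:R != 0 :> R by rewrite pnatr_eq0 -lt0n.
have L0 : L != 0 by rewrite lt0r_neq0.
rewrite /lyapunov fE int1_Ex// /s_const.
rewrite (sum_col4 _ _ _ _ (fun a i => a%:E * 'E_P[fun omega => (Theta (w omega k) (st omega k) i 0)%R])%E).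
have T0 : (fun omega => Theta (w omega k) (st omega k) 0 0) =
    (fun omega => sqn (centered (stack (st_x (st omega k))))).
  by apply/funext => omega; rewrite /Theta mxE /= consensus_error_center.
have T1 : (fun omega => Theta (w omega k) (st omega k) 1 0) =
    (fun omega => sqn (centered (stack (st_y (st omega k))))).
  by apply/funext => omega; rewrite /Theta mxE /= consensus_error_center.
have T2 : (fun omega => Theta (w omega k) (st omega k) 2%:R 0) =
    (fun omega => sqn (stack (zx (w omega k) (st omega k)))).
  (* The compression error is [x^c - x^a = - z], whence the change of sign. *)
  apply/funext => omega; rewrite /Theta mxE /= enorm_sqn -sqnN; congr sqn.
  by apply/matrixP => i j; rewrite !mxE opprB.
have T3 : (fun omega => Theta (w omega k) (st omega k) 3%:R 0) =
    (fun omega => sqn (stack (zy (w omega k) (st omega k)))).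
  apply/funext => omega; rewrite /Theta mxE /= enorm_sqn -sqnN; congr sqn.
  by apply/matrixP => i j; rewrite !mxE opprB.
rewrite T0 T1 T2 T3 (int1_Ex ia) (int1_Ex ib) (int1_Ex ic) (int1_Ex ie).
rewrite -!EFinM -!EFinD; congr EFin; rewrite !addrA mul1r.
by congr (_ + _ * _ + _ + _ + _); field; rewrite n0.
Qed.

Theorem theorem1 (R : realType) (n d : nat) (n_gt0 : (0 < n)%N)
  (f : 'I_n -> 'rV[R]_d -> R) (L : R)
  (L_gt0 : 0 < L)
  (f_smooth : forall i, smooth L (f i))
  (f_bounded : (-oo < optimal_value (average f))%E)
  (e : rel 'I_n) (W : 'M[R]_n)
  (e_sym : symmetric e) (e_irr : irreflexive e)
  (W_weights : weighted_adjacency e W)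
  (e_connected : connected_graph e)
  (W_stochastic : doubly_stochastic W)
  (dS : measure_display) (S : measurableType dS) (Q : probability S R)
  (C : S -> 'rV[R]_d -> 'rV[R]_d) (r phi : R)
  (C_meas : measurable_compressor C)
  (phi_range : 0 < phi <= 1) (r_gt0 : 0 < r)
  (C_contr : contractive_compressor Q C r phi)
  (dO : measure_display) (Omega : measurableType dO) (P : probability Omega R)
  (s_x s_y q : 'I_n -> R)
  (s_x_gt0 : forall i, 0 < s_x i) (s_y_gt0 : forall i, 0 < s_y i)
  (q_range : forall i, 0 < q i < 1)
  (xi_x xi_y : nat -> 'I_n -> 'I_d -> {RV P >-> R})
  (u_x u_y : nat -> 'I_n -> {mfun Omega >-> S})
  (xi_x_law : forall k i j, laplace_distributed (xi_x k i j) (s_x i * q i ^+ k))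
  (xi_y_law : forall k i j, laplace_distributed (xi_y k i j) (s_y i * q i ^+ k))
  (u_x_law : forall k i A, measurable A -> distribution P (u_x k i) A = Q A)
  (u_y_law : forall k i A, measurable A -> distribution P (u_y k i) A = Q A)
  (indep : mutually_independent P (source_events xi_x xi_y u_x u_y))
  (x0 : 'I_n -> 'rV[R]_d)
  (eta gamma alpha_x alpha_y zeta_gamma zeta_eta : R)
  (eta_gt0 : 0 < eta) (gamma_gt0 : 0 < gamma)
  (alpha_x_range : 0 < alpha_x < r^-1) (alpha_y_range : 0 < alpha_y < r^-1) :
  let rho := spectral_gap W in
  let lambda := spectral_radius (W - 1%:M) in
  let r0 := r0_const r phi in
  let phi1 := phi1_const alpha_x alpha_y r phi in
  let w := inputs_at xi_x xi_y u_x u_y in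
  let st omega := pgtc f W C eta gamma alpha_x alpha_y x0 (w omega) in
  let x k omega := st_x (st omega k) in
  let s := s_const n L rho zeta_eta in
  let b1 := b1_const n d L lambda rho gamma eta phi1 zeta_eta in
  let kappa1 := 4 / eta in
  let M1 := (lyapunov P f s w st 0
             + \sum_(0 <= k <oo) (b1 * q_bar q ^+ (2 * k) * s_bar s_x s_y ^+ 2)%:E)%E in
  gamma = zeta_gamma * rho * phi1 ->
  eta = zeta_eta * gamma * rho ^+ 2 / L ->
  0 < zeta_gamma -> zeta_gamma = zeta_eta ->
  (zeta_eta%:E <= zeta_bar1 n L lambda r0 phi1)%E ->
  forall T : nat, (1 <= T)%N ->
  ((T%:R^-1)%:E *
     \sum_(0 <= k < T.+1)
       ('E_P[(fun omega => enorm (gradient (average f) (mean (x k omega))) ^+ 2)%R]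
        + 'E_P[(fun omega => consensus_error (x k omega) ^+ 2)%R])
   <= (kappa1 / T%:R)%:E * M1
      + (4 / n%:R)%:E *
        'E_P[(fun omega =>
               enorm (limn (series (fun t => stack (in_xi_y (w omega t))))) ^+ 2)%R])%E.

Proof.
move=> rho lambda r0 phi1 w st x s b1 kappa1 M1 gammaE etaE zeta_gt0 zetaE zeta_le T T_ge1.
have [W_sym _] := W_weights.
have nR : 0 < n%:R :> R by rewrite ltr0n.
have n_ge1 : 1 <= n%:R :> R by rewrite ler1n.
have n0 : n%:R != 0 :> R by rewrite lt0r_neq0.
have TR : 0 < T%:R :> R by rewrite ltr0n.
have /andP[phi_gt0 phi_le1] := phi_range.
have /andP[ax0 _] := alpha_x_range; have /andP[ay0 _] := alpha_y_range.
have p_gt0 : 0 < phi1 by rewrite /phi1 /phi1_const lt_min !mulr_gt0.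
have p_x : phi1 <= alpha_x * r * phi by rewrite /phi1 /phi1_const ge_min lexx.
have p_y : phi1 <= alpha_y * r * phi by rewrite /phi1 /phi1_const ge_min lexx orbT.
(* Read off [0 < gamma = zeta_gamma * rho * phi1], whose other two factors are positive. *)
have rho_gt0 : 0 < rho.
  by move: gamma_gt0; rewrite gammaE pmulr_lgt0// pmulr_rgt0.
have r0_ge0 : 0 <= r0.
  have r2 : 0 <= 2 * r ^+ 2 by rewrite mulr_ge0// sqr_ge0.
  by apply: addr_ge0; apply: mulr_ge0; rewrite ?subr_ge0// sqr_ge0.
have [zeta_L zeta_n zeta_r0] := le_zeta_bar1 n_gt0 L_gt0 r0_ge0 zeta_le.
rewrite zetaE in gammaE zeta_gt0.
have fmin_lb x' : (optimal_value (average f) <= (average f x')%:E)%E.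
  by apply: ereal_inf_lbound; exists x'.
have opt_fin : optimal_value (average f) \is a fin_num.
  by rewrite fin_numElt f_bounded/= (le_lt_trans (fmin_lb 0))// ltry.
have optE := esym (fineK opt_fin); set fmin := fine _ in optE.
have fmin_le x' : fmin <= average f x' by rewrite -lee_fin -optE.
have key := descent_sum n_gt0 L_gt0 f_smooth W_sym W_stochastic C_meas r_gt0 phi_range C_contr
  s_x_gt0 s_y_gt0 q_range xi_x_law xi_y_law u_x_law u_y_law indep x0 alpha_x_range alpha_y_range
  rho_gt0 p_gt0 p_x p_y zeta_gt0 gammaE etaE zeta_L zeta_n zeta_r0 lambda T fmin_le.
have terms_int1 k := integrable_terms W n_gt0 L_gt0 f_smooth C_meas r_gt0 C_contr
  s_x_gt0 s_y_gt0 q_range xi_x_law xi_y_law u_x_law u_y_law indep x0 eta gamma alpha_x alpha_y k.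
have qb := q_bar_range n_gt0 q_range; have /andP[qb0 qb1] := qb.
set Mm := Ex P (fun omega => sqn (\sum_(0 <= t < T) stack (in_xi_y (w omega t)))) in key.
(* The noise moments decay like [q_bar q ^+ (2 * t)], so the series lemma applies with ratio
   [q_bar q], starting from the partial sum at [T]. *)
have lim_ge : (Mm%:E <= 'E_P[(fun omega =>
    enorm (limn (series (fun t => stack (in_xi_y (w omega t))))) ^+ 2)%R])%E.
  rewrite unlock; apply: (@limit_second_moment _ _ _ _ _ P
    (fun t omega => stack (in_xi_y (w omega t))) (q_bar q)
    (2 * n%:R * d%:R * s_bar s_x s_y ^+ 2) qb0 qb1).
  - move=> t.
    exact: (L2_noise_y s_x_gt0 s_y_gt0 q_range u_x u_y xi_x_law xi_y_law t).
  - move=> t; have [_] := Ex_noise_y n_gt0 s_x s_y_gt0 q_range xi_x u_x u_y xi_y_law t.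
    by rewrite mulnC exprM [_ * s_bar _ _ ^+ 2]mulrC mulrA.
  - move=> N TN.
    exact: (Ex_noise_sum_le s_x_gt0 s_y_gt0 q_range xi_x_law xi_y_law indep TN).
set Nf := @noise_coef R n%:R L rho phi1 zeta_eta lambda in key.
have b1E : b1 = 2 * n%:R * d%:R * Nf + (eta^-1 + L) * n%:R.
  rewrite /b1 etaE gammaE.
  exact: (@b1_noise_coef R n d L lambda rho phi1 zeta_eta n_gt0 L_gt0).
have Nf_ge0 : 0 <= Nf.
  exact: (noise_coef_ge0 n_ge1 L_gt0 rho_gt0 p_gt0 zeta_gt0).
have eL_ge0 : 0 <= eta^-1 + L by apply: addr_ge0; rewrite ?invr_ge0; exact: ltW.
have b1_ge0 : 0 <= b1.
  by rewrite b1E; apply: addr_ge0; apply: mulr_ge0 => //; rewrite !mulr_ge0 ?ler0n.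
have q2_ge0 k : 0 <= q_bar q ^+ (2 * k) by rewrite exprM exprn_ge0// sqr_ge0.
pose noise k := b1 * q_bar q ^+ (2 * k) * s_bar s_x s_y ^+ 2.
have noise_ge0 k : 0 <= noise k by apply: mulr_ge0; [exact: mulr_ge0|exact: sqr_ge0].
have noise_le k : Nf * (2 * n%:R * d%:R * (q_bar q ^+ (2 * k) * s_bar s_x s_y ^+ 2)) <= noise k.
  rewrite /noise b1E; set Z := (X in X <= _).
  rewrite (_ : Z = 2 * n%:R * d%:R * Nf * q_bar q ^+ (2 * k) * s_bar s_x s_y ^+ 2).
    rewrite ler_wpM2r ?sqr_ge0// ler_wpM2r// lerDl.
    by apply: mulr_ge0 => //; exact: ltW.
  by rewrite /Z; ring.
have series_ge : ((\sum_(0 <= k < T.+1) noise k)%:E <= \sum_(0 <= k <oo) (noise k)%:E)%E.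
  by rewrite -sumEFin; apply: nneseries_lim_ge => i *; rewrite lee_fin.
have [i_f _ ia ib [ic ie]] := terms_int1 0%N.
have lyap := @lyapunovE R dO Omega P n d S f L rho zeta_eta fmin w st 0 n_gt0 L_gt0 optE
  i_f ia ib ic ie.
set X := (X in _ = X%:E) in lyap.
have key' : T%:R^-1 * \sum_(0 <= k < T.+1)
    (Ex P (fun omega => sqn (gradient (average f) (mean (st_x (st omega k)))))
     + Ex P (fun omega => sqn (centered (stack (st_x (st omega k)))))) <=
  kappa1 / T%:R * (X + \sum_(0 <= k < T.+1) noise k) + 4 / n%:R * Mm.
  have NN : \sum_(0 <= k < T.+1) Nf * (2 * n%:R * d%:R * (q_bar q ^+ (2 * k) * s_bar s_x s_y ^+ 2))
      <= \sum_(0 <= k < T.+1) noise k by apply: ler_sum => i _; exact: noise_le.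
  move: key NN; rewrite -/X; set Sum := \sum_(0 <= k < _) (_ + _).
  set N1 := \sum_(0 <= k < _) Nf * _; set N2 := \sum_(0 <= k < _) noise k => key NN.
  (* This factor normalizes the left-hand side, and turns [eta / n * (T * Mm)] into [4 / n * Mm]. *)
  have c0 : 0 <= 4 / (eta * T%:R) by rewrite divr_ge0// mulr_ge0// ltW.
  have h := ler_wpM2l c0 (le_trans key (lerD (lexx _) NN)).
  rewrite (_ : T%:R^-1 * Sum = 4 / (eta * T%:R) * (eta / 4 * Sum)); last first.
    by field; rewrite !lt0r_neq0.
  apply: (le_trans h); rewrite le_eqVlt; apply/orP; left; apply/eqP.
  by rewrite /kappa1; field; rewrite n0 !lt0r_neq0.
apply: (@le_trans _ _ ((T%:R^-1 * \sum_(0 <= k < T.+1)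
    (Ex P (fun omega => sqn (gradient (average f) (mean (st_x (st omega k)))))
     + Ex P (fun omega => sqn (centered (stack (st_x (st omega k)))))))%:E)).
  rewrite EFinM -sumEFin le_eqVlt; apply/orP; left; apply/eqP; congr (_ * _)%E.
  apply: eq_bigr => k _; have [_ ig ia' _ _] := terms_int1 k.
  rewrite EFinD -(int1_Ex ig) -(int1_Ex ia').
  congr ('E_P[_] + 'E_P[_])%E; apply/funext => omega; first by rewrite enorm_sqn.
  by rewrite consensus_error_center.
rewrite -lee_fin in key'; apply: (le_trans key').
(* The second moment of the series has not been shown to be finite, so the last comparison is made
   term by term in the extended reals. *)
rewrite EFinD !EFinM; apply: leeD; last first.
  by apply: lee_wpmul2l => //; rewrite lee_fin divr_ge0.
apply: lee_wpmul2l; first by rewrite lee_fin !divr_ge0// ltW.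
by rewrite EFinD /M1 lyap leeD2l.
Qed.
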